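(* Let $\lambda,a>0$ be such that $a>2\left(\frac{\lambda}{2}\right)^3$, and let $\varphi$ be a real-valued smooth function defined in a neighborhood of $0\in\mathbb{R}$ with $\varphi(y)=O(|y|^5)$ as $|y|\to 0$. For small $r>0$, let $\Gamma=\Gamma_r\subset\mathbb{R}^2$ be the curve parametrized by $$\gamma:[-r,r]\to\mathbb{R}^2,\qquad \gamma(y)=(y,g(y)),\qquad g(y)=\frac{\lambda}{2}y^2+ay^4+\varphi(y),$$ and let $\sigma=\sigma_r$ be the arclength measure on $\Gamma$. Then there exists $r_0>0$ such that for every $0<r<r_0$: (i) the triple convolution $\sigma\ast\sigma\ast\sigma$ attains a strict global maximum at the origin $(0,0)$; (ii) every extremizing sequence for the inequality $$\|\widehat{f\sigma}\|_{L^6(\mathbb{R}^2)}\le\mathbf{C}\,\|f\|_{L^2(\sigma)},\qquad f\in L^2(\sigma),$$ where $\mathbf{C}=\sup_{0\ne f\in L^2(\sigma)}\|\widehat{f\sigma}\|_{L^6(\mathbb{R}^2)}\|f\|_{L^2(\sigma)}^{-1}$ is the optimal constant, concentrates at the origin; (iii) there are no extremizers for the inequality in (ii).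
   Context: For complex-valued $f\in L^2(\sigma)$, $\widehat{f\sigma}(\xi)=\int e^{-ix\cdot\xi}f(x)\,d\sigma(x)$, $\xi\in\mathbb{R}^2$. The optimal constant $\mathbf{C}$ (depending on $r,\lambda,a,\varphi$) is finite for small $r$ by the Tomas-Stein inequality. The measure $\sigma\ast\sigma\ast\sigma$ is absolutely continuous with respect to Lebesgue measure on $\mathbb{R}^2$ and is identified with its density, as a function of $(\xi,\tau)\in\mathbb{R}^2$. Its support lies in $\{|\xi|\le 3r,\ \tau\ge 3g(\xi/3)\}$, and the origin lies on the lower boundary $\tau=3g(\xi/3)$ of this region. The density is taken to be the representative that is continuous on $\{(\xi,\tau):|\xi|<3r,\ \tau\ge 3g(\xi/3)\}$ (so that its values on the lower boundary, in particular at the origin, are limits from within this set) and zero elsewhere. An extremizing sequence is a sequence $\{f_n\}\subset L^2(\sigma)$ with $\|f_n\|_{L^2(\sigma)}\le 1$ and $\|\widehat{f_n\sigma}\|_{L^6(\mathbb{R}^2)}\to\mathbf{C}$ as $n\to\infty$. An extremizer is a function $0\ne f\in L^2(\sigma)$ with $\|\widehat{f\sigma}\|_{L^6(\mathbb{R}^2)}=\mathbf{C}\|f\|_{L^2(\sigma)}$. A sequence $\{f_n\}$ in $L^2(\sigma)$ with $\|f_n\|_{L^2(\sigma)}\to 1$ concentrates at a point $p=\gamma(z)\in\Gamma$ if for every $\epsilon,\rho>0$ there exists $N\in\mathbb{N}$ such that for every $n\ge N$, $$\int_{|w-z|\ge \rho}|f_n(\gamma(w))|^2\,\|\gamma'(w)\|\,dw<\epsilon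 .$$ Here the origin is $\gamma(0)=(0,0)$. *)

(* Defs.v *)
From HB Require Import structures.
From mathcomp Require Import all_boot all_order all_algebra.
From mathcomp Require Import complex.
From mathcomp Require Import all_classical all_reals all_analysis.

Set Implicit Arguments.
Unset Strict Implicit.
Unset Printing Implicit Defensive.

Import Order.TTheory GRing.Theory Num.Theory.
Import numFieldNormedType.Exports.

Local Open Scope classical_set_scope.
Local Open Scope ring_scope.
Local Open Scope complex_scope.

(* [R * R], with the sigma-algebra on each factor which carries
   [lebesgue_measure]. *)
Definition plane (R : realType) : Type := (measurableTypeR R * measurableTypeR R)%type.
HB.instance Definition _ (R : realType) := Measurable.on (plane R).

Section plane.
Context {R : realType}.

Definition lebesgue2 : {measure set (plane R) -> \bar R} :=
  (@lebesgue_measure R \x @lebesgue_measure R)%E.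

Definition dotp (x y : R * R) : R := x.1 * y.1 + x.2 * y.2.

(* The library's norm on [R * R] is the max norm. *)
Definition enorm (x : R * R) : R := Num.sqrt (dotp x x).

End plane.

Section arclength.
Context {R : realType}.
Variables (gamma : R -> R * R) (a b : R).

Definition speed (y : R) : R := enorm (derive1 gamma y).

Definition rectifiable : Prop :=
  measurable_fun (`[a, b] : set (measurableTypeR R)) (gamma : _ -> plane R) /\
  (@lebesgue_measure R).-integrable `[a, b] (EFin \o speed).

(* Push-forward by [gamma] of the measure [speed y dy] on [a, b]; the zero
   measure when [gamma] is not rectifiable on [a, b]. *)
Definition arclength (A : set (plane R)) : \bar R :=
  if `[< rectifiable >] then
    (\int[lebesgue_measure]_(y in `[a, b] `&` gamma @^-1` A) (speed y)%:E)%E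
  else 0%E.

Lemma arclengthE (A : set (plane R)) : rectifiable ->
  arclength A =
    (\int[lebesgue_measure]_(y in `[a, b] `&` gamma @^-1` A) (speed y)%:E)%E.
Proof. by move=> hr; rewrite /arclength; case: asboolP. Qed.

Let speed_ge0 y : (0 <= (speed y)%:E)%E.
Proof. by rewrite lee_fin sqrtr_ge0. Qed.

Let arclength0 : arclength set0 = 0%E.
Proof.
by rewrite /arclength preimage_set0 setI0 integral_set0; case: ifP.
Qed.

Let arclength_ge0 A : (0 <= arclength A)%E.
Proof. by rewrite /arclength; case: ifP => // _; exact: integral_ge0. Qed.

Let arclength_sigma_additive : semi_sigma_additive arclength.
Proof.
move=> F mF tF mUF; rewrite /arclength; case: asboolP => [[mg /integrableP[ms _]]|_].
  rewrite preimage_bigcup setI_bigcupr ge0_integral_bigcup//=.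
  - by apply: is_cvg_ereal_nneg_natsum_cond => // n _ _; exact: integral_ge0.
  - by move=> k; exact: mg.
  - apply: measurable_funS ms => //.
    by move=> x [k _ []].
  - by apply/trivIsetP => i j _ _ /eqP ij; rewrite -subset0 => x [[_ Fi] [_ Fj]];
      apply: ij; apply: tF => //; exists (gamma x).
by under eq_fun do rewrite big1_eq; exact: cvg_cst.
Qed.

HB.instance Definition _ := isMeasure.Build _ _ _ arclength
  arclength0 arclength_ge0 arclength_sigma_additive.

Let arclength_fin : fin_num_fun arclength.
Proof.
move=> A mA; rewrite /arclength; case: asboolP => // -[mg si].
apply: integrable_fin_num; first exact: mg.
by apply: integrableS si => //; exact: mg.
Qed.

HB.instance Definition _ := Measure_isFinite.Build _ _ _ arclength arclength_fin.

End arclength.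

Section convolution.
Context {R : realType}.
Variables mu nu : set (plane R) -> \bar R.

Definition mconv : set (plane R) -> \bar R :=
  pushforward (mu \x nu)%E (fun z => z.1 + z.2).

End convolution.

Section complex_integral.
Context d {T : measurableType d} {R : realType}.
Variable mu : {measure set T -> \bar R}.

Definition cintegral (f : T -> R[i]) : R[i] :=
  (\int[mu]_x complex.Re (f x)) +i* (\int[mu]_x complex.Im (f x)).

(* Elements of L^p(mu) are represented by measurable functions, which are
   identified only through [cLnorm], i.e. up to mu-a.e. equality. *)
Definition cLnorm (p : R) (f : T -> R[i]) : \bar R :=
  'N[mu]_p%:E[EFin \o (@Normc.normc R \o f)]%E.

Definition L2fun (f : T -> R[i]) : Prop :=
  [/\ measurable_fun setT (@complex.Re R \o f),
      measurable_fun setT (@complex.Im R \o f) & (cLnorm 2 f < +oo)%E].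

End complex_integral.

Section extension.
Context {R : realType}.
Implicit Types (sigma : {measure set (plane R) -> \bar R}) (f : plane R -> R[i]).

Definition expi (t : R) : R[i] := cos t +i* sin t.

Definition extension sigma f (xi : plane R) : R[i] :=
  cintegral sigma (fun x => expi (- dotp x xi) * f x).

Definition ext_norm sigma f : \bar R := cLnorm lebesgue2 6 (extension sigma f).

(* The denominators are positive and finite. *)
Definition optimal_const sigma : \bar R :=
  ereal_sup [set (ext_norm sigma f / cLnorm sigma 2 f)%E
            | f in [set f | L2fun sigma f /\ cLnorm sigma 2 f != 0%E]].

Definition extremizer sigma f : Prop :=
  [/\ L2fun sigma f, cLnorm sigma 2 f != 0%E
    & ext_norm sigma f = (optimal_const sigma * cLnorm sigma 2 f)%E].

Definition extremizing_seq sigma (f : nat -> plane R -> R[i]) : Prop :=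
  (forall n, L2fun sigma (f n) /\ (cLnorm sigma 2 (f n) <= 1)%E) /\
  (ext_norm sigma (f n) @[n --> \oo] --> optimal_const sigma).

End extension.

Section curve.
Context {R : realType}.
Implicit Types (g : R -> R) (gamma : R -> R * R) (r : R).

Definition graph_curve g (y : R) : R * R := (y, g y).

(* Concentration at the point [gamma z]. *)
Definition concentrates gamma r (f : nat -> plane R -> R[i]) (z : R) : Prop :=
  (cLnorm (arclength gamma (- r) r) 2 (f n) @[n --> \oo] --> 1%E) /\
  forall eps rho : R, 0 < eps -> 0 < rho ->
    \forall n \near \oo,
      (\int[lebesgue_measure]_(w in `[(- r)%R, r] `&` [set w : R | (rho <= `|w - z|)%R])
         (Normc.normc (f n (gamma w)) ^+ 2 * speed gamma w)%:E < eps%:E)%E.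

Definition conv3_region g r : set (plane R) :=
  [set x | `|x.1| < 3 * r /\ 3 * g (x.1 / 3) <= x.2].

(* Such an [h] is unique when [g] is continuous on (-r, r): [conv3_region] is
   then contained in the closure of its interior, so that two such functions,
   being a.e. equal, agree on it. *)
Definition conv3_density g r (h : plane R -> R) : Prop :=
  let sigma := arclength (graph_curve g) (- r) r in
  [/\ measurable_fun (setT : set (plane R)) h /\ (forall x, 0 <= h x),
      (forall A, measurable A ->
         mconv (mconv sigma sigma) sigma A = (\int[lebesgue2]_(x in A) (h x)%:E)%E),
      {within conv3_region g r, continuous h}
    & forall x, ~ conv3_region g r x -> h x = 0].

Definition smooth_near (phi : R -> R) (x : R) : Prop :=
  \forall y \near x, forall n, derivable (derive1n n phi) y 1.

End curve.

Lemma graph_derive1 (R : realType) (g : R -> R) y : derivable g y 1 ->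
  derive1 (graph_curve g) y = (1, derive1 g y).
Proof.
move=> dg; rewrite derive1E.
have dg' : differentiable g y by exact/derivable1_diffP.
have di : differentiable (@id R) y by [].
rewrite /graph_curve deriveE; last exact: differentiable_pair.
rewrite diff_pair//=.
have -> : (fun y0 : R => y0) = @idfun R by [].
rewrite (_ : 'd idfun y = idfun :> (R -> R)); first by rewrite derive1E deriveE.
exact: diff_val.
Qed.

(* Hence [arclength] does not take its default value on short arcs. *)
Lemma smooth_rectifiable (R : realType) (g : R -> R) : smooth_near g 0 ->
  exists r0 : R, 0 < r0 /\ forall r, 0 < r -> r < r0 -> rectifiable (graph_curve g) (- r) r.
Proof.
move=> /nbhs_ballP[e /= e0 he]; exists e; split=> // r r_0 re.
have hy y : y \in `[- r, r] -> forall n, derivable (derive1n n g) y 1.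
  rewrite in_itv /= => /andP[h1 h2]; apply: he; rewrite /ball/= sub0r normrN.
  by apply: le_lt_trans re; rewrite ler_norml h1 h2.
have c0 : {within `[- r, r], continuous g}.
  by apply: derivable_within_continuous => y /hy/(_ 0).
have c1 : {within `[- r, r], continuous (derive1 g)}.
  by apply: derivable_within_continuous => y /hy/(_ 1).
split.
  have mg : measurable_fun `[-r, r] g by apply: measurable_realfun.subspace_continuous_measurable_fun.
  have mg' : measurable_fun (setT : set (measurableTypeR R)) (g \_ `[-r, r] : _ -> measurableTypeR R).
    by apply/(measurable_restrictT g).
  have mp := @measurable_fun_pair _ _ _ (measurableTypeR R) (measurableTypeR R) (measurableTypeR R) idfun _ (@measurable_id _ _ _) mg'.
  apply: eq_measurable_fun (measurable_funS _ _ mp) => // y yr /=.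
  by rewrite /graph_curve patchE yr.
have E y : (`[-r, r]%classic : set R) y -> speed (graph_curve g) y = Num.sqrt (1 + derive1 g y ^+ 2).
  move=> yr; rewrite /speed graph_derive1 ?/enorm/dotp/= ?mul1r// .
  by apply: (hy y _ 0%N); rewrite inE.
have : lebesgue_measure.-integrable `[-r, r] (EFin \o (fun y => Num.sqrt (1 + derive1 g y ^+ 2))).
  apply: continuous_compact_integrable; first exact: segment_compact.
  move=> x; apply: (@continuous_comp (subspace `[-r,r]) R R (fun y => 1 + derive1 g y ^+ 2) Num.sqrt); last exact: sqrt_continuous.
  apply: cvgD; first exact: cvg_cst.
  by apply: cvgM; exact: c1.
by apply: eq_integrable => //= y; rewrite inE => yr; rewrite E.
Qed.

(* Main.v *)
(** The extension operator cubed is the Fourier transform of a triple convolution, so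
    by Plancherel and Cauchy-Schwarz on the fibres of the sum map
    [||f^sigma||_6^6 <= (2 pi)^2 \int h(sum) |f f f|^2], where [h] is the density of
    the triple convolution.  The lower bound [a > 2 (lambda/2)^3] makes [h] strictly
    maximal at the origin, with a gap linear in the height above the origin, and every
    mass away from the origin loses a definite amount in this inequality.  Conversely
    the functions [exp (- k G)], [k -> oo], concentrate at the origin and reach the
    constant [((2 pi)^2 h(0, 0))^(1/6)], which is therefore optimal.  Plancherel is
    obtained from the Poisson kernel, and [h] is computed from the polar parametrisation
    of the fibres of the sum map. *)

From HB Require Import structures.
Require Import Defs.
From mathcomp Require Import all_boot all_order all_algebra.
From mathcomp Require Import complex.
From mathcomp Require Import all_classical all_reals all_analysis.
From mathcomp Require Import measurable_realfun.
From mathcomp Require Import ring lra.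

Set Implicit Arguments.
Unset Strict Implicit.
Unset Printing Implicit Defensive.

Import Order.TTheory GRing.Theory Num.Theory.
Import numFieldNormedType.Exports.

Local Open Scope classical_set_scope.
Local Open Scope ring_scope.

(** The fibre over [(xi, t)] lies in the plane of triples of sum [xi], centred at [eta = xi / 3]. A
    direction [(v, w, - (v + w))] kills the linear term of [g], so the height grows quadratically
    along each ray from the centre, and the factor [p] of the polar Jacobian cancels against the
    derivative of the height: [h] becomes an integral over slopes that stays bounded up to the
    boundary. At second order the quartic term lowers the density at relative rate at least
    [2 * a / lambda], while the speed [sqrt (1 + g' ^+ 2)] raises it at rate [lambda ^+ 2 / 2]; the
    hypothesis on [a] says that the first wins. A cross term of the expansion has no sign on one ray
    and cancels only between opposite rays, which are therefore integrated together. The density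
    jumps at the lower boundary of its support, so its Poisson means do not approach it uniformly.
    The upper bound uses instead a Lipschitz majorant depending on the height alone, the lower bound
    Fatou's lemma on the interior. The functions [exp (- k G)] fit because their triple product is
    constant on each fibre, the case of equality in Cauchy-Schwarz. *)

(** * Lebesgue measure under shifts, reflections and dilations *)

Section change_of_variables.
Context {R : realType}.
Local Notation mu := (@lebesgue_measure R).
Local Notation M := (measurableTypeR R).

Lemma ge0_integral_lebesgue_shift (f : R -> \bar R) (c : R) :
  measurable_fun [set: R] f -> (forall x, (0 <= f x)%E) ->
  (\int[mu]_x f (x + c)%R = \int[mu]_x f x)%E.
Proof.
move=> mf f0.
have mT : measurable_fun setT (fun x : M => x + c : M).
  by apply: measurable_funD.
transitivity (\int[pushforward mu (fun x : M => (x + c : M)%R)]_x f x)%E.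
  by rewrite ge0_integral_pushforward// => y; rewrite inE.
apply: eq_measure_integral => //= A mA _; apply/esym.
apply: lebesgue_measure_unique => //= _ [[a b]] _ <-.
rewrite /pushforward /=.
rewrite (_ : _ @^-1` _ = `]a - c, b - c]%classic); last first.
  by apply/seteqP; split => x /=; rewrite !in_itv/= ltrBlDr lerBrDr.
rewrite !lebesgue_measure_itv/= !lte_fin ltrD2r; case: ifPn => // _.
by congr (_%:E); rewrite opprB addrA addrNK.
Qed.

Lemma ge0_integral_lebesgue_opp (f : R -> \bar R) :
  measurable_fun [set: R] f -> (forall x, (0 <= f x)%E) ->
  (\int[mu]_x f (- x)%R = \int[mu]_x f x)%E.
Proof.
move=> mf f0.
transitivity (\int[pushforward mu (-%R : M -> M)]_x f x)%E.
  by rewrite ge0_integral_pushforward// => y; rewrite inE.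
by apply: eq_measure_integral => //= A mA _; exact: lebesgue_measureN.
Qed.

Lemma ge0_integral_lebesgue_scale (f : R -> \bar R) (c : R) : 0 < c ->
  measurable_fun [set: R] f -> (forall x, (0 <= f x)%E) ->
  (\int[mu]_x (c%:E * f (c * x)%R) = \int[mu]_x f x)%E.
Proof.
move=> c0 mf f0.
have mT : measurable_fun setT (fun x : M => c * x : M).
  by apply: measurable_funM.
rewrite ge0_integralZl//; [|exact: measurableT_comp|by rewrite lee_fin ltW].
transitivity (c%:E * \int[pushforward mu (fun x : M => (c * x : M)%R)]_x f x)%E.
  by rewrite ge0_integral_pushforward// => y; rewrite inE.
pose k : {nonneg R} := NngNum (ltW c0).
rewrite -(ge0_integral_mscale _ measurableT k)//=.
apply: eq_measure_integral => //= A mA _; apply/esym.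
apply: lebesgue_measure_unique => //= _ [[a b]] _ <-.
rewrite /mscale/= /pushforward.
rewrite (_ : _ @^-1` _ = `]c^-1 * a, c^-1 * b]%classic); last first.
  by apply/seteqP; split => x /=; rewrite !in_itv/= ltr_pdivrMl// ler_pdivlMl.
rewrite !lebesgue_measure_itv/= !lte_fin ltr_pM2l ?invr_gt0//.
case: ifPn => _; last by rewrite mule0.
by rewrite -!EFinB -EFinM -mulrBr mulVKf// gt_eqF.
Qed.

End change_of_variables.

(** * Measures with a density, and substitution along an increasing function *)

Section weighted_measure.
Context d (T : measurableType d) (R : realType).
Variables (mu : {measure set T -> \bar R}) (w : {mfun T >-> R}).
Local Open Scope ereal_scope.

(** The absolute value makes this a measure without a sign condition on [w]; the weights put in
    later are nonnegative. *)
Definition weighted (A : set T) : \bar R := \int[mu]_(x in A) `|w x|%:E.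

Let mw : measurable_fun setT (fun x => `|w x|%:E).
Proof. by apply/measurable_EFinP; apply: measurableT_comp. Qed.

Let weighted0 : weighted set0 = 0.
Proof. by rewrite /weighted integral_set0. Qed.

Let weighted_ge0 A : 0 <= weighted A.
Proof. by apply: integral_ge0. Qed.

Let weighted_sigma_additive : semi_sigma_additive weighted.
Proof.
move=> F mF tF mUF; rewrite /weighted ge0_integral_bigcup//=.
  by apply: is_cvg_ereal_nneg_natsum_cond => // n _ _; exact: integral_ge0.
exact: measurable_funTS.
Qed.

HB.instance Definition _ := isMeasure.Build _ _ _ weighted
  weighted0 weighted_ge0 weighted_sigma_additive.

Import HBNNSimple.

Lemma ge0_integral_weighted (f : T -> \bar R) :
  measurable_fun setT f -> (forall x, 0 <= f x) ->
  \int[weighted]_x f x = \int[mu]_x (f x * `|w x|%:E).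
Proof.
move=> mf f0; pose f_ := nnsfun_approx measurableT mf.
transitivity (limn (fun n => \int[weighted]_x (f_ n x)%:E)).
  rewrite -monotone_convergence//.
  - by apply: eq_integral => y _; apply/esym/cvg_lim => //; exact: cvg_nnsfun_approx.
  - by move=> n; exact/measurable_EFinP/measurable_funP.
  - by move=> n y _; rewrite lee_fin.
  - by move=> y _ m n mn; rewrite lee_fin; exact/lefP/nd_nnsfun_approx.
rewrite (_ : (fun _ => _) = (fun n => \int[mu]_x ((f_ n x)%:E * `|w x|%:E))).
  rewrite -monotone_convergence//; last 3 first.
  - by move=> n; apply: emeasurable_funM => //; exact/measurable_EFinP/measurable_funP.
  - by move=> n x _; rewrite mule_ge0 ?lee_fin.
  - by move=> x _ m n mn; rewrite lee_wpmul2r ?lee_fin//; exact/lefP/nd_nnsfun_approx.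
  apply: eq_integral => x _; apply/cvg_lim => //.
  by apply: cvgeZr => //; exact: cvg_nnsfun_approx.
apply/funext => n.
under [LHS]eq_integral do rewrite fimfunE -fsumEFin//.
rewrite ge0_integral_fsum//; last 2 first.
- by move=> y; exact/measurable_EFinP/measurable_funM.
- by move=> y x _; rewrite nnfun_muleindic_ge0.
under [RHS]eq_integral => x _.
  rewrite fimfunE -fsumEFin// ge0_mule_fsuml; last first.
    by move=> y; rewrite nnfun_muleindic_ge0.
  over.
rewrite ge0_integral_fsum//; last 2 first.
- by move=> y; apply: emeasurable_funM => //; exact/measurable_EFinP/measurable_funM.
- by move=> y x _; rewrite mule_ge0 ?nnfun_muleindic_ge0.
apply: eq_fsbigr => r _; rewrite integralZl_indic_nnsfun// integral_indic//= setIT.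
have [r0|r0] := ltP r 0%R.
  rewrite preimage_nnfun0// /weighted integral_set0 mule0.
  by apply/esym/integral0_eq => x _; rewrite indicE in_set0 mulr0 mul0e.
under [RHS]eq_integral => x _ do rewrite EFinM -muleA.
rewrite [RHS]ge0_integralZl//; last first.
  by apply: emeasurable_funM => //; exact/measurable_EFinP.
congr (_ * _); rewrite /weighted integral_mkcond; apply: eq_integral => x _.
by rewrite patchE indicE; case: (_ \in _); rewrite ?mul1e ?mul0e.
Qed.

End weighted_measure.

Section monotone_substitution.
Context {R : realType}.
Local Notation mu := (@lebesgue_measure R).
Variables (G G' p : R -> R).
Hypothesis dG : forall x : R, is_derive x 1 G (G' x).
Hypothesis cG' : continuous G'.
Hypothesis G'_gt0 : forall x : R, 0 < x -> 0 < G' x.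
Hypothesis p_ge0 : forall t, 0 <= p t.
Hypothesis pK : forall t, G 0 <= t -> G (p t) = t.

Let cG : continuous G.
Proof. by move=> x; apply: differentiable_continuous; apply/derivable1_diffP. Qed.

Let G_lt (x y : R) : 0 <= x -> x < y -> G x < G y.
Proof.
move=> x0 xy; rewrite -subr_gt0.
have [z] := MVT xy (fun z _ => dG z) (continuous_subspaceT cG).
rewrite in_itv/= => /andP[xz _] ->; rewrite mulr_gt0 ?subr_gt0//.
by rewrite G'_gt0// (le_lt_trans x0).
Qed.

Let G_lt_mono (x y : R) : 0 <= x -> 0 <= y -> (G x < G y) = (x < y).
Proof.
move=> x0 y0; apply/idP/idP => [|xy]; last exact: G_lt.
by apply: contraTT; rewrite -!leNgt le_eqVlt => /predU1P[->//|/(G_lt y0)/ltW].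
Qed.

Let integral_G' (x y : R) : 0 <= x -> x <= y ->
  (\int[mu]_(t in `]x, y]) (G' t)%:E = (G y - G x)%:E)%E.
Proof.
move=> x0; rewrite le_eqVlt => /predU1P[->|xy].
  by rewrite set_interval.set_itvoc0 integral_set0 subrr.
have mG' : measurable_fun `]x, y] (EFin \o G').
  by apply/measurable_EFinP/measurable_funTS; exact: continuous_measurable_fun.
rewrite integral_itv_obnd_cbnd//.
rewrite (@continuous_FTC2 _ _ G) ?EFinB//.
- exact: continuous_subspaceT.
- split; first by move=> z _; exact: ex_derive.
  + exact/cvg_at_right_filter/cG.
  + exact/cvg_at_left_filter/cG.
- by move=> z _; rewrite derive1E derive_val.
Qed.

(** Both sides compare two measures, so [f] need only be measurable. The push-forward under [G] of
    [G' dx] on []0, +oo[] is completed by Lebesgue measure on []-oo, G 0]], and the sum is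
    recognised as Lebesgue measure on the whole line. *)
Lemma ge0_integral_substitution (f : R -> \bar R) :
  measurable_fun [set: R] f -> (forall x, (0 <= f x)%E) ->
  (\int[mu]_(x in `]0%R, +oo[) (f (G x) * (G' x)%:E) =
   \int[mu]_(t in `](G 0)%R, +oo[) f t)%E.
Proof.
move=> mf f0.
have mG : measurable_fun [set: measurableTypeR R] (G : _ -> measurableTypeR R).
  exact: continuous_measurable_fun.
have mG' : measurable_fun [set: R] G' by exact: continuous_measurable_fun.
have mw : measurable_fun [set: measurableTypeR R] (G' \_ `]0, +oo[ : _ -> R).
  by apply/(measurable_restrictT _ _).1 => //; exact: measurable_funTS.
pose w : {mfun measurableTypeR R >-> R} :=
  HB.pack (G' \_ `]0, +oo[) (isMeasurableFun.Build _ _ _ _ _ mw).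
pose m1' : {measure set (measurableTypeR R) -> \bar R} := pushforward (weighted mu w) (G : measurableTypeR R -> measurableTypeR R).
pose m1 := m1' mG.
have mS : measurable (`]-oo, G 0] : set (measurableTypeR R)) by exact: measurable_itv.
pose m2 : {measure set (measurableTypeR R) -> \bar R} := mrestr mu mS.
have wE (x : R) : `|w x| = (G' \_ `]0, +oo[) x.
  rewrite /w/= ger0_norm// patchE; case: ifPn => //.
  by rewrite inE/= in_itv/= andbT => /G'_gt0/ltW.
(* It suffices to test intervals []a, b]]. The right inverse [p] supplies the endpoints of the
   preimage under [G], and the fundamental theorem of calculus its weighted length; the clipping by
   [G 0] separates the part carried by [m2]. *)
have nuE : forall A, measurable A -> mu A = measure_add m1 m2 A.
  apply: lebesgue_measure_unique => _ [[a b] _ <-].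
  pose I : set (measurableTypeR R) := `]a, b]%classic; transitivity (m1 I + m2 I)%E; last exact/esym/measure_addE.
  rewrite /I /m1 /m1' /m2 /= /pushforward /mrestr /weighted.
  under eq_integral => x _ do
    rewrite wE -[(_ x)%:E]/((EFin \o (G' \_ `]0%R, +oo[)) x) -restrict_EFin.
  have [ba|ab] := leP b a.
    by rewrite set_itv_ge ?bnd_simp -?leNgt// preimage_set0 set0I !measure0 integral_set0 adde0.
  have aG (x : R) : 0 < x -> (a < G x) = (p (Num.max a (G 0)) < x).
    move=> x0; rewrite -[RHS]G_lt_mono ?p_ge0 ?ltW// pK ?le_max ?lexx ?orbT//.
    by rewrite gt_max (G_lt _ x0)// andbT.
  have bG (x : R) : 0 < x -> (G x <= b) = (x <= p (Num.max b (G 0))).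
    move=> x0; rewrite !leNgt -[in RHS]G_lt_mono ?p_ge0 ?ltW// pK ?le_max ?lexx ?orbT//.
    by rewrite gt_max (G_lt _ x0)// andbT.
  have A1 : (`]0, +oo[ `&` G @^-1` `]a, b] =
      `]p (Num.max a (G 0)), p (Num.max b (G 0))])%classic.
    apply/seteqP; split => x /=; rewrite !in_itv/= andbT.
      by move=> [x0]; rewrite aG// bG.
    move=> /andP[px xp]; have x0 := le_lt_trans (p_ge0 _) px.
    by rewrite aG// bG// px xp.
  rewrite -integral_mkcondl A1 integral_G' ?p_ge0//; last first.
    rewrite leNgt -G_lt_mono ?p_ge0// !pK ?le_max ?lexx ?orbT// -leNgt.
    by rewrite ge_max !le_max (ltW ab) lexx !orbT.
  rewrite !pK ?le_max ?lexx ?orbT//.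
  have -> : (`]a, b] `&` `]-oo, (G 0)] = `]a, (Num.min b (G 0))])%classic.
    apply/seteqP; split => x /=; rewrite !in_itv/= le_min.
      by move=> [/andP[-> ->] ->].
    by move=> /and3P[-> -> ->].
  rewrite !lebesgue_measure_itv/= !lte_fin ab lt_min ab/=.
  have [ga|ag] := leP (G 0) a.
    by rewrite max_l ?(le_trans ga (ltW ab))// adde0.
  by have [bg|gb] := leP b (G 0); rewrite -!EFinD; congr (_%:E); ring.
transitivity (\int[measure_add m1 m2]_(t in `](G 0)%R, +oo[) f t)%E; last first.
  by apply: eq_measure_integral => A mA _; exact/esym/nuE.
rewrite ge0_integral_measure_add//=; last exact: measurable_funTS.
rewrite [X in (_ + X)%E]null_set_integral//; last 2 first.
- exact: measurable_funTS.
- rewrite /m2/= /mrestr -(measure0 mu); congr (mu _).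
  by apply/seteqP; split => x //=; rewrite !in_itv/= andbT => -[/lt_geF->].
rewrite adde0 ge0_integral_pushforward//; last exact: measurable_funTS.
rewrite integral_mkcond ge0_integral_weighted//; last 2 first.
- apply/(measurable_restrictT _ _).1 => //.
    by rewrite -[X in measurable X]setTI; apply: (mG) => //; exact: measurable_itv.
  by apply: measurable_funTS; exact: measurableT_comp.
- by move=> x; rewrite patchE; case: ifP => // _; exact: f0.
rewrite [LHS]integral_mkcond; apply: eq_integral => x _; rewrite wE !patchE.
have [|] := boolP (x \in `]0, +oo[%classic).
  rewrite inE/= in_itv/= andbT => x0; rewrite mem_set//=.
  by rewrite in_itv/= andbT G_lt.
by rewrite mule0.
Qed.
End monotone_substitution.

(** * The Poisson kernel: Fourier integral, mass and approximation of the identity *)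

Section poisson_kernel.
Context {R : realType}.
Local Notation mu := (@lebesgue_measure R).

(** The Fourier transform of [expabs e]. Its mass is [2 * pi] for every [e], which is the source of
    the constant [(2 * pi) ^+ 2] in the plane. *)
Definition poisson (e z : R) : R := 2 * e / (e ^+ 2 + z ^+ 2).

Definition expabs (e x : R) : R := expR (- (e * `|x|)).

Variable e : R.
Hypothesis e0 : 0 < e.

Let den_gt0 z : 0 < e ^+ 2 + z ^+ 2.
Proof. by rewrite ltr_wpDr ?sqr_ge0// exprn_gt0. Qed.

Lemma poisson_ge0 z : 0 <= poisson e z.
Proof. by rewrite divr_ge0 ?ltW// mulr_gt0. Qed.

Lemma poissonN z : poisson e (- z) = poisson e z.
Proof. by rewrite /poisson sqrrN. Qed.

Lemma expabs_gt0 x : 0 < expabs e x.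
Proof. exact: expR_gt0. Qed.

Lemma expabs_le1 x : expabs e x <= 1.
Proof. by rewrite -expR0 ler_expR oppr_le0 mulr_ge0 // ltW. Qed.

Lemma continuous_expabs : continuous (expabs e).
Proof.
move=> x; apply: (@continuous_comp _ _ _ (fun x => - (e * `|x|)) expR); last exact: continuous_expR.
apply: cvgN; apply: cvgM; first exact: cvg_cst.
exact: norm_continuous.
Qed.

Let cvg_expRM : expR (- (e * x)) @[x --> +oo] --> (0 : R).
Proof.
apply: (cvg_comp (fun x => e * x) (fun x => expR (- x))); last exact: cvgr_expR.
exact: gt0_cvgMry.
Qed.

(** The summand 1 makes the integrand nonnegative, as the improper form of the fundamental theorem
    used here demands; [integral_expabs_cos] subtracts it again. *)
Let integral_half z : (\int[mu]_(x in `[0%R, +oo[)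
    (expR (- (e * x)) * (1 + cos (z * x)))%:E =
  (e^-1 + e / (e ^+ 2 + z ^+ 2))%:E)%E.
Proof.
have e_neq0 : e != 0 by rewrite gt_eqF.
have d_neq0 : e ^+ 2 + z ^+ 2 != 0 by rewrite gt_eqF.
pose F (x : R) := expR (- (e * x)) * (- e^-1 +
  (z * sin (z * x) - e * cos (z * x)) / (e ^+ 2 + z ^+ 2)).
have dF (x : R) : is_derive x 1 F (expR (- (e * x)) * (1 + cos (z * x))).
  apply: is_derive_eq; rewrite /GRing.scale/=.
  field.
  by rewrite e_neq0 d_neq0.
rewrite (@ge0_continuous_FTC2y _ _ F _ 0).
- rewrite /F !mulr0 oppr0 expR0 mul1r sin0 cos0 mulr0 sub0r mulr1 -EFinB sub0r.
  by congr (_%:E); rewrite opprD opprK mulNr opprK.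
- by move=> x _; rewrite mulr_ge0 ?expR_ge0// -lerBlDl sub0r cos_geN1.
- apply: continuous_subspaceT => x.
  have : {for x, continuous (fun x => expR (- (e * x)) * (1 + cos (z * x)))}.
    by apply: differentiable_continuous; apply/derivable1_diffP.
  by [].
- pose C := e^-1 + (`|z| + e) / (e ^+ 2 + z ^+ 2).
  have C0 : 0 <= C.
    have d0 := ltW (den_gt0 z); have e1 := ltW e0.
    by apply: addr_ge0; [rewrite invr_ge0|apply: divr_ge0 => //; exact: addr_ge0].
  apply/cvgr0Pnorm_le => eps eps0.
  have := cvg_expRM => /cvgr0Pnorm_lt/(_ (eps / (C + 1))).
  rewrite divr_gt0 ?ltr_wpDl// => /(_ isT); apply: filterS => x.
  rewrite ger0_norm ?expR_ge0// ltr_pdivlMr ?ltr_wpDl// => hx.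
  rewrite normrM ger0_norm ?expR_ge0//; apply: le_trans (ltW hx).
  rewrite ler_wpM2l ?expR_ge0// (le_trans (ler_normD _ _))//.
  rewrite normrN [`|e^-1|]gtr0_norm ?invr_gt0// normrM [`|_^-1|]gtr0_norm ?invr_gt0//.
  have : `|z * sin (z * x) - e * cos (z * x)| <= `|z| + e.
    rewrite (le_trans (ler_normB _ _))// !normrM (gtr0_norm e0) lerD//.
    - by rewrite ler_piMr// ler_norml sin_geN1 sin_le1.
    - by rewrite ler_piMr ?(ltW e0)// ler_norml cos_geN1 cos_le1.
  rewrite -(@ler_pM2r _ (e ^+ 2 + z ^+ 2)^-1) ?invr_gt0// => h.
  by apply: (@le_trans _ _ C); rewrite ?lerDl// /C lerD2l.
- by move=> x _; exact: ex_derive.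
- apply: cvg_at_right_filter.
  have : {for 0, continuous F} by apply: differentiable_continuous; apply/derivable1_diffP.
  by [].
- by move=> x _; rewrite derive1E derive_val.
Qed.

Let integral_expabs_cosD1 z :
  (\int[mu]_x (expabs e x * (1 + cos (z * x)))%:E =
  (2 * e^-1 + poisson e z)%:E)%E.
Proof.
rewrite ge0_symfun_integralT.
- rewrite -set_itvcy; under eq_integral.
    move=> x; rewrite inE/= in_itv/= andbT => x0.
    rewrite /expabs ger0_norm//; over.
  by rewrite integral_half -EFinM mulrDr /poisson mulrA.
- move=> x; rewrite mulr_ge0 ?expR_ge0// -lerBlDl sub0r cos_geN1.
- move=> x; apply: cvgM; first exact: continuous_expabs.
  apply: cvgD; first exact: cvg_cst.
  apply: (@continuous_comp _ _ _ (fun x => z * x) cos); last exact: continuous_cos.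
  by apply: cvgM; [exact: cvg_cst|exact: cvg_id].
- by move=> x /=; rewrite /expabs normrN mulrN cosN.
Qed.


Let measurable_expabs : measurable_fun [set: R] (expabs e).
Proof. exact: continuous_measurable_fun continuous_expabs. Qed.

Lemma measurable_cosM z : measurable_fun [set: R] (fun x => cos (z * x)).
Proof.
apply: continuous_measurable_fun => x.
apply: (@continuous_comp _ _ _ (fun x => z * x) cos); last exact: continuous_cos.
exact: mulrl_continuous.
Qed.

Lemma measurable_sinM z : measurable_fun [set: R] (fun x => sin (z * x)).
Proof.
apply: continuous_measurable_fun => x.
apply: (@continuous_comp _ _ _ (fun x => z * x) sin); last exact: continuous_sin.
exact: mulrl_continuous.
Qed.

Let measurable_expabs_cosD1 z :
  measurable_fun [set: R] (fun x => (expabs e x * (1 + cos (z * x)))%:E).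
Proof.
apply/measurable_EFinP; apply: measurable_funM => //; apply: measurable_funD => //.
exact: measurable_cosM.
Qed.

Lemma integral_expabs : (\int[mu]_x (expabs e x)%:E = (2 / e)%:E)%E.
Proof.
transitivity (\int[mu]_x ((2^-1)%:E * (expabs e x * (1 + cos (0 * x)))%:E))%E.
  by apply: eq_integral => x _; rewrite mul0r cos0 -EFinM; congr (_%:E); field.
rewrite ge0_integralZl//; last 2 first.
- exact: (measurable_expabs_cosD1 0).
- by move=> x _; rewrite lee_fin mulr_ge0 ?expR_ge0// -lerBlDl sub0r cos_geN1.
rewrite integral_expabs_cosD1 -EFinM; congr (_%:E).
by rewrite /poisson; field; rewrite gt_eqF.
Qed.

Lemma integrable_expabs : mu.-integrable setT (fun x => (expabs e x)%:E).
Proof.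
apply/integrableP; split; first exact/measurable_EFinP.
under eq_integral do rewrite gee0_abs ?lee_fin ?expR_ge0//.
by rewrite integral_expabs ltry.
Qed.

Lemma integrable_expabs_bounded (f : R -> R) : measurable_fun [set: R] f ->
  (forall x, `|f x| <= 1) ->
  mu.-integrable setT (fun x => (expabs e x * f x)%:E).
Proof.
move=> mf f1; apply: le_integrable integrable_expabs => //.
  by apply/measurable_EFinP/measurable_funM.
move=> x _; rewrite lee_fin normrM [leRHS]ger0_norm ?expR_ge0//.
by rewrite ger0_norm ?expR_ge0// ler_piMr ?expR_ge0.
Qed.

Lemma integrable_expabs_cos z : mu.-integrable setT (fun x => (expabs e x * cos (z * x))%:E).
Proof.
apply: integrable_expabs_bounded => [|x]; last by rewrite ler_norml cos_geN1 cos_le1.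
exact: measurable_cosM.
Qed.

Lemma integrable_expabs_sin z : mu.-integrable setT (fun x => (expabs e x * sin (z * x))%:E).
Proof.
apply: integrable_expabs_bounded => [|x]; last by rewrite ler_norml sin_geN1 sin_le1.
exact: measurable_sinM.
Qed.

Lemma integral_expabs_cos z :
  (\int[mu]_x (expabs e x * cos (z * x))%:E = (poisson e z)%:E)%E.
Proof.
transitivity (\int[mu]_x ((expabs e x * (1 + cos (z * x)))%:E - (expabs e x)%:E))%E.
  by apply: eq_integral => x _; rewrite -EFinB; congr (_%:E); ring.
rewrite integralB_EFin//; last 2 first.
- rewrite [X in integrable _ _ X](_ : _ =
      (fun x => (expabs e x)%:E + (expabs e x * cos (z * x))%:E)%E); last first.
    by apply/funext => x; rewrite -EFinD /= mulrDr mulr1.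
  by apply: integrableD => //; [exact: integrable_expabs|exact: integrable_expabs_cos].
- exact: integrable_expabs.
by rewrite integral_expabs_cosD1 integral_expabs -EFinB addrAC subrr add0r.
Qed.

Lemma integral_expabs_sin z :
  (\int[mu]_x (expabs e x * sin (z * x))%:E = 0)%E.
Proof.
(* Again a summand 1 gives a nonnegative function. Reflection changes the sign of the sine part
   alone, so that part equals its own opposite. *)
pose f x := (expabs e x * (1 + sin (z * x)))%:E.
have f0 x : (0 <= f x)%E by rewrite lee_fin mulr_ge0 ?expR_ge0// -lerBlDl sub0r sin_geN1.
have mf : measurable_fun [set: R] f.
  apply/measurable_EFinP; apply: measurable_funM => //; apply: measurable_funD => //.
  exact: measurable_sinM.
have := ge0_integral_lebesgue_opp mf f0.
have fE (s : R) : (\int[mu]_x (expabs e x * (1 + s * sin (z * x)))%:E =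
    \int[mu]_x (expabs e x)%:E + s%:E * \int[mu]_x (expabs e x * sin (z * x))%:E)%E.
  rewrite -integralZl//; last exact: integrable_expabs_sin.
  rewrite -integralD//; [|exact: integrable_expabs|].
    by apply: eq_integral => x _; rewrite -EFinM -EFinD; congr (_%:E); ring.
  by apply: integrableZl => //; exact: integrable_expabs_sin.
have -> : (\int[mu]_x f (- x)%R = \int[mu]_x (expabs e x * (1 + (-1) * sin (z * x)))%:E)%E.
  by apply: eq_integral => x _; rewrite /f /expabs normrN mulrN sinN mulN1r.
have -> : (\int[mu]_x f x = \int[mu]_x (expabs e x * (1 + 1 * sin (z * x)))%:E)%E.
  by apply: eq_integral => x _; rewrite /f mul1r.
rewrite !fE integral_expabs.
have := integrable_fin_num measurableT (integrable_expabs_sin z).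
case: (\int[mu]_x _)%E => // s _ [/addrI]; rewrite mul1r mulN1r => sE.
by congr (_%:E); lra.
Qed.

Lemma continuous_poisson : continuous (poisson e).
Proof.
move=> z; apply: cvgM; first exact: cvg_cst.
apply: cvgV; first by rewrite gt_eqF.
by apply: cvgD; [exact: cvg_cst|exact: exprn_continuous].
Qed.

Lemma measurable_poisson : measurable_fun [set: R] (poisson e).
Proof. exact: continuous_measurable_fun continuous_poisson. Qed.

Lemma poisson_le z : poisson e z <= 2 / e.
Proof.
rewrite /poisson ler_pdivrMr//.
have -> : 2 / e * (e ^+ 2 + z ^+ 2) = 2 * e + 2 / e * z ^+ 2 by field; rewrite gt_eqF.
by rewrite lerDl mulr_ge0 ?sqr_ge0// divr_ge0// ltW.
Qed.

End poisson_kernel.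
Section poisson_mass.
Context {R : realType}.
Local Notation mu := (@lebesgue_measure R).

Lemma integral_poisson (e : R) : 0 < e ->
  (\int[mu]_z (poisson e z)%:E = (2 * pi)%:E)%E.
Proof.
move=> e0.
have den_gt0 z : 0 < e ^+ 2 + z ^+ 2 by rewrite ltr_wpDr ?sqr_ge0// exprn_gt0.
rewrite ge0_symfun_integralT; last 3 first.
- exact: poisson_ge0.
- exact: continuous_poisson.
- by move=> z /=; rewrite poissonN.
rewrite EFinM; congr (_ * _)%E.
rewrite -set_itvcy; pose F (z : R) := 2 * atan (e^-1 * z).
have dF (z : R) : is_derive z 1 F (poisson e z).
  apply: is_derive_eq; rewrite /GRing.scale/= /poisson.
  have h : 1 + (e^-1 * z) ^+ 2 != 0 by rewrite gt_eqF// ltr_wpDr ?sqr_ge0.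
  have := den_gt0 z => /lt0r_neq0 h2.
  by field; rewrite h2 gt_eqF.
rewrite (@ge0_continuous_FTC2y _ _ F _ pi).
- by rewrite /F mulr0 atan0 mulr0 sube0.
- by move=> x _; exact: poisson_ge0.
- apply: continuous_subspaceT; exact: continuous_poisson.
- rewrite /F (_ : pi = 2 * (pi / 2)); last by field.
  apply: cvgM; first exact: cvg_cst.
  apply: (cvg_comp (fun z => e^-1 * z) atan); last exact: cvgy_atan.
  by apply: gt0_cvgMry; rewrite ?invr_gt0//; exact: cvg_id.
- by move=> x _; exact: ex_derive.
- apply: cvg_at_right_filter.
  have : {for 0, continuous F} by apply: differentiable_continuous; apply/derivable1_diffP.
  by [].
- by move=> x _; rewrite derive1E derive_val.
Qed.

Lemma poisson_tail (e rho u : R) : 0 < e -> 0 < rho -> rho <= `|u| ->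
  poisson e u <= e * (1 + rho ^- 2) * poisson 1 u.
Proof.
move=> e0 rho0 hu.
have u2 : rho ^+ 2 <= u ^+ 2 by rewrite -(real_normK (num_real u)) ler_sqr ?nnegrE ?(ltW rho0)//.
have r2 : 0 < rho ^+ 2 by rewrite exprn_gt0.
have u0 := lt_le_trans r2 u2.
rewrite /poisson expr1n mulr1.
apply: (@le_trans _ _ (2 * e / u ^+ 2)).
  by rewrite ler_pM2l ?mulr_gt0// lef_pV2 ?posrE ?ltr_wpDl ?ltr_wpDr ?lerDr ?sqr_ge0// exprn_gt0.
have -> : e * (1 + rho ^- 2) * (2 / (1 + u ^+ 2)) = 2 * e * ((1 + rho ^- 2) / (1 + u ^+ 2)) by ring.
rewrite ler_pM2l ?mulr_gt0// ler_pdivlMr ?ltr_wpDr ?sqr_ge0// mulrDr mulr1.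
by rewrite mulVf ?gt_eqF// addrC lerD2l lef_pV2 ?posrE.
Qed.

Lemma poisson_scale (e z : R) : 0 < e -> e * poisson e (e * z) = poisson 1 z.
Proof.
move=> e0; rewrite /poisson.
have h : 1 + z ^+ 2 != 0 by rewrite gt_eqF// ltr_wpDr ?sqr_ge0.
have -> : e ^+ 2 + (e * z) ^+ 2 = e ^+ 2 * (1 + z ^+ 2) by ring.
by field; rewrite h gt_eqF.
Qed.

(* Away from the diagonal [poisson e] is dominated by [e * poisson 1], so that
   the error is controlled uniformly in [t]. *)
Lemma poisson_approx_le (psi : R -> R) (B d rho : R) :
  measurable_fun [set: R] psi -> (forall t, 0 <= psi t <= B) ->
  0 < d -> 0 < rho -> (forall t u, `|u| < rho -> psi (t + u) <= psi t + d) ->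
  forall e t : R, 0 < e ->
  (\int[mu]_z (poisson e (t - z) * psi z)%:E <=
     (2 * pi * (psi t + d + B * (e * (1 + rho ^- 2))))%:E)%E.
Proof.
move=> mpsi psiB d0 rho0 hpsi e t e0.
have B0 : 0 <= B by have /andP[] := psiB 0; exact: le_trans.
have mp := measurable_poisson.
rewrite -(@ge0_integral_lebesgue_shift _ _ t); last 2 first.
- apply/measurable_EFinP; apply: measurable_funM => //.
  by apply: (measurableT_comp (mp _ _ e0)); exact: measurable_funB.
- by move=> x; rewrite lee_fin mulr_ge0 ?poisson_ge0//; have /andP[] := psiB x.
have k0 : 0 <= e * (1 + rho ^- 2) by rewrite mulr_ge0 ?addr_ge0 ?invr_ge0 ?sqr_ge0// ltW.
have Bk0 := mulr_ge0 B0 k0.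
have psi0 : 0 <= psi t by have /andP[] := psiB t.
apply: (@le_trans _ _ (\int[mu]_u ((psi t + d)%:E * (poisson e u)%:E +
    (B * (e * (1 + rho ^- 2)))%:E * (poisson 1 u)%:E))%E).
  apply: ge0_le_integral => //.
  - by move=> x _; rewrite lee_fin mulr_ge0 ?poisson_ge0//; have /andP[] := psiB (x + t).
  - apply/measurable_EFinP; apply: measurable_funM.
      by apply: (measurableT_comp (mp _ _ e0)); apply: measurable_funB => //; exact: measurable_funD.
    by apply: (measurableT_comp mpsi); exact: measurable_funD.
  - by apply: emeasurable_funD; apply: emeasurable_funM => //; apply/measurable_EFinP; exact: mp.
  - move=> u _; rewrite lee_fin.
    have -> : t - (u + t) = - u by ring.
    rewrite poissonN [u + t]addrC mulrC.
    have pu := poisson_ge0 e0 u; have p1 := poisson_ge0 ltr01 u.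
    have [ur|ru] := ltP `|u| rho.
      apply: (@le_trans _ _ ((psi t + d) * poisson e u)); first by rewrite ler_wpM2r ?hpsi.
      by rewrite lerDl mulr_ge0.
    apply: (@le_trans _ _ (B * poisson e u)).
      by rewrite ler_wpM2r//; have /andP[] := psiB (t + u).
    rewrite -[leLHS]add0r lerD//; first by rewrite mulr_ge0 ?addr_ge0 ?(ltW d0).
    by rewrite -mulrA ler_wpM2l// poisson_tail.
rewrite ge0_integralD//; last 4 first.
- by move=> x _; rewrite -EFinM lee_fin mulr_ge0 ?poisson_ge0 ?addr_ge0 ?(ltW d0).
- by apply: emeasurable_funM => //; apply/measurable_EFinP; exact: mp.
- by move=> x _; rewrite -EFinM lee_fin mulr_ge0 ?poisson_ge0.
- by apply: emeasurable_funM => //; apply/measurable_EFinP; exact: mp.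
rewrite !ge0_integralZl//; try by (apply/measurable_EFinP; exact: mp).
- rewrite !integral_poisson// -!EFinM -EFinD lee_fin.
  by rewrite le_eqVlt; apply/orP; left; apply/eqP; ring.
- by move=> x _; rewrite lee_fin poisson_ge0.
- by move=> x _; rewrite lee_fin poisson_ge0.
- by rewrite lee_fin addr_ge0// ltW.
Qed.

End poisson_mass.

(* In this version of MathComp-Analysis the canonical sigma-finite structure of
   [m1 \x m2] is shadowed by the one for subprobabilities; the alias [sprod]
   carries the general structure. *)
Section sigma_finite_product.
Context d1 d2 (T1 : measurableType d1) (T2 : measurableType d2) (R : realType).
Variables (m1 : {sigma_finite_measure set T1 -> \bar R}).
Variables (m2 : {sigma_finite_measure set T2 -> \bar R}).

Definition sprod : set (T1 * T2) -> \bar R := (m1 \x m2)%E.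

HB.instance Definition _ := Measure.on sprod.

Let sprod_sigma_finite : sigma_finite setT sprod.
Proof.
have /sigma_finiteP[F [FT ndF F_fin]] := sigma_finiteT m1.
have /sigma_finiteP[G [GT ndG G_fin]] := sigma_finiteT m2.
exists (fun n => F n `*` G n); last first.
  move=> k; have [mF Fk] := F_fin k; have [mG Gk] := G_fin k.
  split; first exact: measurableX.
  by rewrite [ltLHS]product_measure1E// lte_mul_pinfty// ge0_fin_numE.
apply/seteqP; split => // -[x y] _.
have [i _ Fix] : (\bigcup_n F n) x by rewrite -FT.
have [j _ Gjy] : (\bigcup_n G n) y by rewrite -GT.
exists (maxn i j) => //; split => /=.
  by move: x Fix; exact/subsetPset/ndF/leq_maxl.
by move: y Gjy; exact/subsetPset/ndG/leq_maxr.
Qed.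

HB.instance Definition _ := Measure_isSigmaFinite.Build _ _ _ sprod
  sprod_sigma_finite.

End sigma_finite_product.

(** * Integrals of tensor products, and Plancherel's identity with an exponential weight *)

Section product_integrals.
Context d1 d2 (T1 : measurableType d1) (T2 : measurableType d2) (R : realType).
Variables (m1 : {sigma_finite_measure set T1 -> \bar R}).
Variables (m2 : {sigma_finite_measure set T2 -> \bar R}).
Implicit Types (f : T1 -> R) (g : T2 -> R).

Lemma integrable_prodM f g : m1.-integrable setT (EFin \o f) ->
  m2.-integrable setT (EFin \o g) ->
  (sprod m1 m2).-integrable setT (fun z => (f z.1 * g z.2)%:E).
Proof.
move=> /integrableP[mf fi] /integrableP[mg gi].
have mf' : measurable_fun setT f by exact/measurable_EFinP.
have mg' : measurable_fun setT g by exact/measurable_EFinP.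
apply/(integrable12ltyP _ _ _).2.
  apply/measurable_EFinP; apply: measurable_funM; first exact: measurableT_comp.
  exact: measurableT_comp.
under eq_integral => x _.
  under eq_integral => y _ do rewrite /= normrM EFinM.
  rewrite ge0_integralZl//; last by apply/measurable_EFinP; exact: measurableT_comp.
  over.
rewrite ge0_integralZr//; last 2 first.
- by apply/measurable_EFinP; exact: measurableT_comp.
- by apply: integral_ge0.
by apply: lte_mul_pinfty => //; [exact: integral_ge0|rewrite ge0_fin_numE ?integral_ge0].
Qed.

Lemma integral_prodM f g : m1.-integrable setT (EFin \o f) ->
  m2.-integrable setT (EFin \o g) ->
  (\int[sprod m1 m2]_z (f z.1 * g z.2) = (\int[m1]_x f x) * \int[m2]_y g y)%R.
Proof.
move=> fi gi; have fgi := integrable_prodM fi gi.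
rewrite /Rintegral -(integral12_prod_meas1 fgi)/= /fubini_F.
under eq_integral => x _.
  under eq_integral => y _ do rewrite /= EFinM.
  rewrite integralZl//.
  rewrite -[X in (_ * X)%E]fineK; last exact: integrable_fin_num.
  over.
rewrite integralZr//=.
by rewrite -[X in (X * _)%E]fineK//; exact: integrable_fin_num.
Qed.

End product_integrals.
Section plancherel.
Context d (T : measurableType d) (R : realType).
Variables (mu : {sigma_finite_measure set T -> \bar R}).
Variables (th1 th2 H1 H2 : T -> R) (e : R).
Hypothesis e0 : 0 < e.
Hypotheses (mth1 : measurable_fun setT th1) (mth2 : measurable_fun setT th2).
Hypotheses (iH1 : mu.-integrable setT (EFin \o H1))
  (iH2 : mu.-integrable setT (EFin \o H2)).
Local Notation leb := (@lebesgue_measure R).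
Local Notation M := (measurableTypeR R).
Local Notation plane := (M * M)%type.

Let phase (x : R * R) X : R := x.1 * th1 X + x.2 * th2 X.
(** [u1] and [u2] are the real and imaginary parts of [expi (- phase x X) * (H1 X + i H2 X)], so
    that the whole argument runs in real integrals. *)
Let u1 x X := cos (phase x X) * H1 X + sin (phase x X) * H2 X.
Let u2 x X := cos (phase x X) * H2 X - sin (phase x X) * H1 X.
Let w (x : R * R) := expabs e x.1 * expabs e x.2.
Let K x (P : T * T) := u1 x P.1 * u1 x P.2 + u2 x P.1 * u2 x P.2.
Let b X := `|H1 X| + `|H2 X|.

Let mH1 : measurable_fun setT H1.
Proof. by apply/measurable_EFinP; exact: measurable_int iH1. Qed.
Let mH2 : measurable_fun setT H2.
Proof. by apply/measurable_EFinP; exact: measurable_int iH2. Qed.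

Let ib : mu.-integrable setT (EFin \o b).
Proof.
by apply: eq_integrable (integrableD measurableT (integrable_norm iH1) (integrable_norm iH2)).
Qed.

Let u1_le x X : `|u1 x X| <= b X.
Proof.
rewrite (le_trans (ler_normD _ _))// !normrM lerD// ler_piMl//.
- by rewrite ler_norml cos_geN1 cos_le1.
- by rewrite ler_norml sin_geN1 sin_le1.
Qed.

Let u2_le x X : `|u2 x X| <= b X.
Proof.
rewrite (le_trans (ler_normB _ _))// !normrM /b addrC lerD// ler_piMl//.
- by rewrite ler_norml sin_geN1 sin_le1.
- by rewrite ler_norml cos_geN1 cos_le1.
Qed.

Let K_le x P : `|K x P| <= 2 * (b P.1 * b P.2).
Proof.
rewrite (le_trans (ler_normD _ _))// !normrM mulr_natl mulr2n lerD// ler_pM//.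
Qed.

Let mcos : measurable_fun setT (@cos R).
Proof. exact: continuous_measurable_fun (@continuous_cos R). Qed.
Let msin : measurable_fun setT (@sin R).
Proof. exact: continuous_measurable_fun (@continuous_sin R). Qed.

Let mphase d' (S : measurableType d') (x1 x2 : S -> M) (X : S -> T) :
  measurable_fun setT x1 -> measurable_fun setT x2 -> measurable_fun setT X ->
  measurable_fun setT (fun s => phase (x1 s, x2 s) (X s)).
Proof.
move=> m1 m2 mX; rewrite /phase/=.
by apply: measurable_funD; apply: measurable_funM => //; exact: measurableT_comp.
Qed.

Let mu1 d' (S : measurableType d') (x1 x2 : S -> M) (X : S -> T) :
  measurable_fun setT x1 -> measurable_fun setT x2 -> measurable_fun setT X ->
  measurable_fun setT (fun s => u1 (x1 s, x2 s) (X s)).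
Proof.
move=> m1 m2 mX; have mp := mphase m1 m2 mX; apply: measurable_funD.
- apply: measurable_funM; last exact: measurableT_comp.
  exact: (measurableT_comp mcos).
- apply: measurable_funM; last exact: measurableT_comp.
  exact: (measurableT_comp msin).
Qed.

Let mu2 d' (S : measurableType d') (x1 x2 : S -> M) (X : S -> T) :
  measurable_fun setT x1 -> measurable_fun setT x2 -> measurable_fun setT X ->
  measurable_fun setT (fun s => u2 (x1 s, x2 s) (X s)).
Proof.
move=> m1 m2 mX; have mp := mphase m1 m2 mX; apply: measurable_funB.
- apply: measurable_funM; last exact: measurableT_comp.
  exact: (measurableT_comp mcos).
- apply: measurable_funM; last exact: measurableT_comp.
  exact: (measurableT_comp msin).
Qed.

Let iu1 x : mu.-integrable setT (EFin \o u1 x).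
Proof.
apply: le_integrable ib => //.
  by apply/measurable_EFinP; case: x => x1 x2; apply: (mu1 (x1 := cst x1) (x2 := cst x2)).
by move=> X _; rewrite lee_fin [leRHS]ger0_norm// /b addr_ge0.
Qed.

Let iu2 x : mu.-integrable setT (EFin \o u2 x).
Proof.
apply: le_integrable ib => //.
  by apply/measurable_EFinP; case: x => x1 x2; apply: (mu2 (x1 := cst x1) (x2 := cst x2)).
by move=> X _; rewrite lee_fin [leRHS]ger0_norm// /b addr_ge0.
Qed.

Let sqrA x : (\int[mu]_X u1 x X) ^+ 2 + (\int[mu]_X u2 x X) ^+ 2 =
  \int[(sprod mu mu)]_P K x P.
Proof.
rewrite !expr2 -!integral_prodM// RintegralD//; exact: integrable_prodM.
Qed.

Let iw : (sprod leb leb).-integrable setT (EFin \o w).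
Proof. by apply: integrable_prodM; exact: integrable_expabs. Qed.

Let iwK : (sprod (sprod leb leb) (sprod mu mu)).-integrable setT
  (fun z => (w z.1 * K z.1 z.2)%:E).
Proof.
have iB : (sprod mu mu).-integrable setT (EFin \o (fun P => 2 * (b P.1 * b P.2))).
  by have := integrable_prodM ib ib => /(integrableZl measurableT 2).
have h := @integrable_prodM _ _ _ _ _ (sprod leb leb) (sprod mu mu) _ _ iw iB.
apply: (le_integrable measurableT _ _ h).
- apply/measurable_EFinP; apply: measurable_funM.
    have mw : measurable_fun setT w by apply/measurable_EFinP; exact: measurable_int iw.
    exact: measurableT_comp.
  apply: measurable_funD; apply: measurable_funM.
  + by apply: (mu1 (x1 := fun z => z.1.1) (x2 := fun z => z.1.2) (X := fun z => z.2.1)); do 2 ?apply: measurableT_comp.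
  + by apply: (mu1 (x1 := fun z => z.1.1) (x2 := fun z => z.1.2) (X := fun z => z.2.2)); do 2 ?apply: measurableT_comp.
  + by apply: (mu2 (x1 := fun z => z.1.1) (x2 := fun z => z.1.2) (X := fun z => z.2.1)); do 2 ?apply: measurableT_comp.
  + by apply: (mu2 (x1 := fun z => z.1.1) (x2 := fun z => z.1.2) (X := fun z => z.2.2)); do 2 ?apply: measurableT_comp.
- move=> [x P] _ /=; rewrite lee_fin !normrM ler_wpM2l//.
  by rewrite -!normrM [leRHS]ger0_norm// !mulr_ge0// /b addr_ge0.
Qed.


Let inner (P : T * T) : \int[sprod leb leb]_x (w x * K x P) =
  poisson e (th1 P.1 - th1 P.2) * poisson e (th2 P.1 - th2 P.2) *
  (H1 P.1 * H1 P.2 + H2 P.1 * H2 P.2).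
Proof.
set D1 := th1 P.1 - th1 P.2; set D2 := th2 P.1 - th2 P.2.
set S := (H1 P.1 * H1 P.2 + H2 P.1 * H2 P.2).
set A := (H2 P.1 * H1 P.2 - H1 P.1 * H2 P.2).
pose c (D : R) (x : R) := expabs e x * cos (D * x).
pose s (D : R) (x : R) := expabs e x * sin (D * x).
have ic D : leb.-integrable setT (EFin \o c D) by exact: integrable_expabs_cos.
have is_ D : leb.-integrable setT (EFin \o s D) by exact: integrable_expabs_sin.
have cE D : \int[leb]_x c D x = poisson e D.
  by rewrite /Rintegral integral_expabs_cos.
have sE D : \int[leb]_x s D x = 0.
  by rewrite /Rintegral integral_expabs_sin.
(* The addition formulas separate the two coordinates of [x]; every summand that contains a sine
   then integrates to zero, and only [S * (c D1 x.1 * c D2 x.2)] survives. *)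
have wKE x : w x * K x P = (S * (c D1 x.1 * c D2 x.2) - S * (s D1 x.1 * s D2 x.2)) +
    (A * (s D1 x.1 * c D2 x.2) + A * (c D1 x.1 * s D2 x.2)).
  have hc : cos (phase x P.1) * cos (phase x P.2) + sin (phase x P.1) * sin (phase x P.2) =
      cos (D1 * x.1) * cos (D2 * x.2) - sin (D1 * x.1) * sin (D2 * x.2).
    by rewrite -cosB -cosD; congr cos; rewrite /phase /D1 /D2; ring.
  have hs : sin (phase x P.1) * cos (phase x P.2) - cos (phase x P.1) * sin (phase x P.2) =
      sin (D1 * x.1) * cos (D2 * x.2) + cos (D1 * x.1) * sin (D2 * x.2).
    by rewrite -sinB -sinD; congr sin; rewrite /phase /D1 /D2; ring.
  transitivity (w x * (S * (cos (phase x P.1) * cos (phase x P.2) + sin (phase x P.1) * sin (phase x P.2)) +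
     A * (sin (phase x P.1) * cos (phase x P.2) - cos (phase x P.1) * sin (phase x P.2)))).
    by rewrite /K /u1 /u2 /S /A; ring.
  by rewrite hc hs /w /c /s; ring.
under eq_Rintegral do rewrite wKE.
have iM (f g : R -> R) k : leb.-integrable setT (EFin \o f) -> leb.-integrable setT (EFin \o g) ->
    (sprod leb leb).-integrable setT (EFin \o (fun x => k * (f x.1 * g x.2))).
  by move=> fi gi; have := integrable_prodM fi gi => /(integrableZl measurableT k).
rewrite RintegralD//=; last 2 first.
- by have := integrableB measurableT (iM _ _ S (ic D1) (ic D2)) (iM _ _ S (is_ D1) (is_ D2)).
- by have := integrableD measurableT (iM _ _ A (is_ D1) (ic D2)) (iM _ _ A (ic D1) (is_ D2)).
rewrite RintegralB//=; [|exact: iM|exact: iM].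
rewrite RintegralD//=; [|exact: iM|exact: iM].
rewrite !RintegralZl//; try exact: integrable_prodM.
by rewrite !integral_prodM// !cE !sE; ring.
Qed.

(** The squared modulus is a double integral over [mu]. The exponential weight makes the full
    integral absolutely convergent, so the integral in [x] may be taken first, and it produces one
    Poisson kernel for each difference of phases. *)
Lemma poisson_plancherel :
  (\int[sprod leb leb]_x (expabs e x.1 * expabs e x.2 *
      ((\int[mu]_X (cos (x.1 * th1 X + x.2 * th2 X) * H1 X +
                    sin (x.1 * th1 X + x.2 * th2 X) * H2 X)) ^+ 2 +
       (\int[mu]_X (cos (x.1 * th1 X + x.2 * th2 X) * H2 X -
                    sin (x.1 * th1 X + x.2 * th2 X) * H1 X)) ^+ 2)%R)%:E =
   \int[sprod mu mu]_P (poisson e (th1 P.1 - th1 P.2) *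
      poisson e (th2 P.1 - th2 P.2) *
      (H1 P.1 * H1 P.2 + H2 P.1 * H2 P.2))%:E)%E.
Proof.
transitivity (\int[sprod leb leb]_x \int[sprod mu mu]_P (w x * K x P)%:E)%E.
  apply: eq_integral => x _.
  have iK : (sprod mu mu).-integrable setT (EFin \o K x).
    by have := integrableD measurableT (integrable_prodM (iu1 x) (iu1 x)) (integrable_prodM (iu2 x) (iu2 x)).
  rewrite (sqrA x) EFinM /Rintegral fineK; last first.
    exact: (integrable_fin_num measurableT iK).
  under [RHS]eq_integral do rewrite EFinM.
  by rewrite integralZl.
rewrite (Fubini iwK); apply: eq_integral => P _.
rewrite -inner /Rintegral fineK//; apply: integrable_fin_num => //.
have h : (sprod leb leb).-integrable setT (EFin \o (fun x => 2 * (b P.1 * b P.2) * w x)).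
  exact: (integrableZl measurableT _ iw).
apply: (le_integrable measurableT _ _ h).
- apply/measurable_EFinP; apply: measurable_funM.
    by apply/measurable_EFinP; exact: measurable_int iw.
  apply: measurable_funD; apply: measurable_funM.
  + by apply: (@mu1 _ _ fst snd (cst P.1)); [exact: measurable_fst|exact: measurable_snd|exact: measurable_cst].
  + by apply: (@mu1 _ _ fst snd (cst P.2)); [exact: measurable_fst|exact: measurable_snd|exact: measurable_cst].
  + by apply: (@mu2 _ _ fst snd (cst P.1)); [exact: measurable_fst|exact: measurable_snd|exact: measurable_cst].
  + by apply: (@mu2 _ _ fst snd (cst P.2)); [exact: measurable_fst|exact: measurable_snd|exact: measurable_cst].
- move=> x _ /=; rewrite lee_fin normrM mulrC [leRHS]normrM ler_wpM2r//.
  by rewrite [leRHS]ger0_norm// !mulr_ge0// /b addr_ge0.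
Qed.

End plancherel.

Local Open Scope complex_scope.

(** * Complex integrals, triple products and the cube of the extension operator *)

Section complex_integral_products.
Context {R : realType}.
Local Notation Re := (@complex.Re R).
Local Notation Im := (@complex.Im R).
Local Notation nrm := (@Normc.normc R).

Lemma normc2 (z : R[i]) : nrm z ^+ 2 = Re z ^+ 2 + Im z ^+ 2.
Proof. by case: z => a b /=; rewrite sqr_sqrtr// addr_ge0// sqr_ge0. Qed.

Lemma normc_ge0 (z : R[i]) : 0 <= nrm z.
Proof. by case: z => a b; exact: sqrtr_ge0. Qed.

Lemma ReM (z w : R[i]) : Re (z * w) = Re z * Re w - Im z * Im w.
Proof. by case: z => a b; case: w. Qed.

Lemma ImM (z w : R[i]) : Im (z * w) = Re z * Im w + Im z * Re w.
Proof. by case: z => a b; case: w. Qed.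

Lemma Re_normc (z : R[i]) : `|Re z| <= nrm z.
Proof.
by rewrite -ler_sqr ?nnegrE ?normc_ge0// normc2 real_normK ?num_real// lerDl sqr_ge0.
Qed.

Lemma Im_normc (z : R[i]) : `|Im z| <= nrm z.
Proof.
by rewrite -ler_sqr ?nnegrE ?normc_ge0// normc2 real_normK ?num_real// lerDr sqr_ge0.
Qed.

Lemma expiD (s t : R) : expi (s + t) = expi s * expi t.
Proof.
apply/eqP; rewrite eq_complex /= -/(Re _) -/(Im _) cosD sinD eqxx/=.
by apply/eqP; ring.
Qed.

Section cintegrable.
Context d (T : measurableType d) (m : {measure set T -> \bar R}).

Definition cintegrable (f : T -> R[i]) : Prop :=
  m.-integrable setT (EFin \o (Re \o f)) /\ m.-integrable setT (EFin \o (Im \o f)).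

Definition cmeasurable (f : T -> R[i]) : Prop :=
  measurable_fun setT (Re \o f) /\ measurable_fun setT (Im \o f).

Lemma cintegrable_measurable f : cintegrable f -> cmeasurable f.
Proof.
by move=> [rf jf]; split; apply/measurable_EFinP;
  [exact: measurable_int rf|exact: measurable_int jf].
Qed.

Lemma cmeasurable_normc f : cmeasurable f -> measurable_fun setT (nrm \o f).
Proof.
move=> [rf jf].
have -> : nrm \o f = (fun x => Num.sqrt ((Re \o f) x ^+ 2 + (Im \o f) x ^+ 2)).
  by apply/funext => x /=; case: (f x).
apply: (measurableT_comp (continuous_measurable_fun (@sqrt_continuous R))).
by apply: measurable_funD; exact: measurable_funX.
Qed.

Lemma cintegrable_expi (t : T -> R) f : measurable_fun setT t ->
  cintegrable f -> cintegrable (fun x => expi (t x) * f x).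
Proof.
move=> mt cf; have [mrf mjf] := cintegrable_measurable cf; have [rf jf] := cf.
have mc : measurable_fun setT (fun x => cos (t x)).
  exact: (measurableT_comp (continuous_measurable_fun (@continuous_cos R))). 
have ms : measurable_fun setT (fun x => sin (t x)).
  exact: (measurableT_comp (continuous_measurable_fun (@continuous_sin R))). 
have ib : m.-integrable setT (EFin \o (fun x => `|Re (f x)| + `|Im (f x)|)).
  by apply: eq_integrable (integrableD measurableT (integrable_norm rf) (integrable_norm jf)).
split.
- rewrite (_ : _ \o _ = (fun x => cos (t x) * Re (f x) - sin (t x) * Im (f x))); last first.
    by apply/funext => x /=; rewrite ReM.
  apply: le_integrable ib => //.
    by apply/measurable_EFinP; apply: measurable_funB; exact: measurable_funM.
  move=> x _; rewrite lee_fin [leRHS]ger0_norm ?addr_ge0//.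
  rewrite (le_trans (ler_normB _ _))// !normrM lerD// ler_piMl// ler_norml.
    by rewrite cos_geN1 cos_le1.
  by rewrite sin_geN1 sin_le1.
- rewrite (_ : _ \o _ = (fun x => cos (t x) * Im (f x) + sin (t x) * Re (f x))); last first.
    by apply/funext => x /=; rewrite ImM.
  apply: le_integrable ib => //.
    by apply/measurable_EFinP; apply: measurable_funD; exact: measurable_funM.
  move=> x _; rewrite lee_fin [leRHS]ger0_norm ?addr_ge0//.
  rewrite (le_trans (ler_normD _ _))// !normrM addrC lerD// ler_piMl// ler_norml.
    by rewrite sin_geN1 sin_le1.
  by rewrite cos_geN1 cos_le1.
Qed.

End cintegrable.

Section product.
Context d1 d2 (T1 : measurableType d1) (T2 : measurableType d2).
Variables (m1 : {sigma_finite_measure set T1 -> \bar R}).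
Variables (m2 : {sigma_finite_measure set T2 -> \bar R}).

Lemma cintegrable_prodM f g : cintegrable m1 f -> cintegrable m2 g ->
  cintegrable (sprod m1 m2) (fun z => f z.1 * g z.2).
Proof.
move=> [rf jf] [rg jg]; split.
- apply: eq_integrable (integrableB measurableT (integrable_prodM rf rg) (integrable_prodM jf jg)) => //.
  by move=> z _ /=; rewrite ReM.
- apply: eq_integrable (integrableD measurableT (integrable_prodM rf jg) (integrable_prodM jf rg)) => //.
  by move=> z _ /=; rewrite ImM.
Qed.

Lemma cintegral_prodM f g : cintegrable m1 f -> cintegrable m2 g ->
  cintegral (sprod m1 m2) (fun z => f z.1 * g z.2) =
  cintegral m1 f * cintegral m2 g.
Proof.
move=> [rf jf] [rg jg]; rewrite /cintegral.
under eq_Rintegral do rewrite ReM.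
under [in X in _ +i* X]eq_Rintegral do rewrite ImM.
rewrite RintegralB//=; [|exact: integrable_prodM rf rg|exact: integrable_prodM jf jg].
rewrite RintegralD//=; [|exact: integrable_prodM rf jg|exact: integrable_prodM jf rg].
by rewrite (integral_prodM rf rg) (integral_prodM jf jg) (integral_prodM rf jg) (integral_prodM jf rg).
Qed.

End product.

End complex_integral_products.
Section triple_sums.
Context d (T : measurableType d) (R : realType).
Variables (nu : {finite_measure set T -> \bar R}) (G1 G2 : T -> R).
Hypotheses (mG1 : measurable_fun setT G1) (mG2 : measurable_fun setT G2).
Local Notation Re := (@complex.Re R).
Local Notation Im := (@complex.Im R).
Local Notation nrm := (@Normc.normc R).
Local Notation leb := (@lebesgue_measure R).
Local Notation leb2 := (sprod leb leb).
Local Notation nu3 := (sprod nu (sprod nu nu)).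

Definition sum3 (G : T -> R) (X : T * (T * T)) : R := G X.1 + (G X.2.1 + G X.2.2).
Definition prod3 {K : pzRingType} (f : T -> K) (X : T * (T * T)) : K :=
  f X.1 * (f X.2.1 * f X.2.2).

Definition curve_ext (f : T -> R[i]) (x : R * R) : R[i] :=
  cintegral nu (fun y => expi (- (G1 y * x.1 + G2 y * x.2)) * f y).

Definition square_integrable (f : T -> R[i]) : Prop :=
  cmeasurable f /\ (\int[nu]_y (nrm (f y) ^+ 2)%:E < +oo)%E.

Lemma measurable_sum3 G : measurable_fun setT G -> measurable_fun setT (sum3 G).
Proof.
move=> mG; apply: measurable_funD; first exact: measurableT_comp.
by apply: measurable_funD; apply: (measurableT_comp mG); apply: measurableT_comp.
Qed.

Lemma square_integrable_normc2 f : square_integrable f ->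
  nu.-integrable setT (EFin \o (fun y => nrm (f y) ^+ 2)).
Proof.
move=> [mf f2]; apply/integrableP; split.
  by apply/measurable_EFinP; apply: measurable_funX; exact: cmeasurable_normc.
by under eq_integral do rewrite /= ger0_norm ?sqr_ge0//.
Qed.

Lemma square_integrable_cintegrable f : square_integrable f -> cintegrable nu f.
Proof.
move=> sf; have [[mr mi] _] := sf; have if2 := square_integrable_normc2 sf.
have i1 : nu.-integrable setT (EFin \o (fun y => 1 + nrm (f y) ^+ 2)).
  have := finite_measure_integrable_cst nu 1 => /(_ setT) ic.
  by apply: eq_integrable (integrableD measurableT (ic measurableT) if2).
have h (t : R) : t <= 1 + t ^+ 2 by nra.
split; apply: le_integrable i1 => //; try exact/measurable_EFinP.
- move=> x _; rewrite lee_fin [leRHS]ger0_norm ?addr_ge0 ?sqr_ge0//.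
  exact: le_trans (Re_normc _) (h _).
- move=> x _; rewrite lee_fin [leRHS]ger0_norm ?addr_ge0 ?sqr_ge0//.
  exact: le_trans (Im_normc _) (h _).
Qed.

Lemma cintegrable_prod3 f : cintegrable nu f -> cintegrable nu3 (prod3 f).
Proof. by move=> cf; exact: cintegrable_prodM cf (cintegrable_prodM cf cf). Qed.

Lemma curve_ext_cube f x : cintegrable nu f ->
  curve_ext f x ^+ 3 = cintegral nu3 (fun X =>
    expi (- (x.1 * sum3 G1 X + x.2 * sum3 G2 X)) * prod3 f X).
Proof.
move=> cf.
have mt : measurable_fun setT (fun y => - (G1 y * x.1 + G2 y * x.2)).
  by apply: measurableT_comp => //; apply: measurable_funD; exact: measurable_funM.
have ce := cintegrable_expi mt cf.
rewrite 2!exprS expr1 /curve_ext -(cintegral_prodM ce ce).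
rewrite -(cintegral_prodM ce (cintegrable_prodM ce ce)).
congr cintegral; apply/funext => X.
have -> : expi (- (x.1 * sum3 G1 X + x.2 * sum3 G2 X)) =
    expi (- (G1 X.1 * x.1 + G2 X.1 * x.2)) *
    (expi (- (G1 X.2.1 * x.1 + G2 X.2.1 * x.2)) *
     expi (- (G1 X.2.2 * x.1 + G2 X.2.2 * x.2))).
  by rewrite -!expiD; congr expi; rewrite /sum3; ring.
by rewrite /prod3; ring.
Qed.

Lemma normc_expr (z : R[i]) n : nrm (z ^+ n) = nrm z ^+ n.
Proof.
elim: n => [|n IH]; first by rewrite !expr0 Normc.normc1.
by rewrite !exprS Normc.normcM IH.
Qed.

Lemma curve_ext_plancherel f (e : R) : 0 < e -> cintegrable nu f ->
  (\int[leb2]_x (expabs e x.1 * expabs e x.2 * nrm (curve_ext f x) ^+ 6)%:E =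
   \int[sprod nu3 nu3]_P (poisson e (sum3 G1 P.1 - sum3 G1 P.2) *
      poisson e (sum3 G2 P.1 - sum3 G2 P.2) *
      (Re (prod3 f P.1) * Re (prod3 f P.2) +
       Im (prod3 f P.1) * Im (prod3 f P.2)))%:E)%E.
Proof.
move=> e0 cf; have [iR iI] := cintegrable_prod3 cf.
rewrite -(poisson_plancherel e0 (measurable_sum3 mG1) (measurable_sum3 mG2) iR iI).
apply: eq_integral => x _; congr (_ * _)%:E.
rewrite (_ : nrm _ ^+ 6 = nrm (curve_ext f x ^+ 3) ^+ 2); last first.
  by rewrite normc_expr -exprM.
rewrite normc2 curve_ext_cube// /cintegral/=; congr (_ ^+ 2 + _ ^+ 2).
- by apply: eq_Rintegral => X _; rewrite ReM /= cosN sinN mulNr opprK.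
- by apply: eq_Rintegral => X _; rewrite ImM /= cosN sinN mulNr.
Qed.

End triple_sums.

Section measurable_extension.
Context d (T : measurableType d) (R : realType).
Variables (nu : {finite_measure set T -> \bar R}) (G1 G2 : T -> R).
Hypotheses (mG1 : measurable_fun setT G1) (mG2 : measurable_fun setT G2).

(* Measurability of a partial integral does not depend on the measure put on
   the other factor; the zero measure makes integrability trivial. *)
Lemma measurable_Rintegral_param d' (S : measurableType d') (u : S * T -> R) :
  measurable_fun setT u ->
  measurable_fun setT (fun x => \int[nu]_y u (x, y)).
Proof.
move=> mu; apply: (measurableT_comp (f := fine)) => //.
have iu : (@mzero _ S R \x nu)%E.-integrable setT (EFin \o u).
  apply/(integrable12ltyP _ _ _).2; first exact/measurable_EFinP.
  rewrite integral_measure_zero//.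
exact: (measurable_fubini_F iu).
Qed.

Lemma measurable_curve_ext f : cmeasurable f -> cmeasurable (curve_ext nu G1 G2 f : plane R -> R[i]).
Proof.
move=> [mr mi].
pose ph (z : plane R * T) := - (G1 z.2 * z.1.1 + G2 z.2 * z.1.2).
have mph : measurable_fun setT ph.
  apply: measurableT_comp => //; apply: measurable_funD; apply: measurable_funM;
    do ?[exact: (measurableT_comp mG1)|exact: (measurableT_comp mG2)].
  - by apply: (measurableT_comp (f := fst)); [exact: measurable_fst|exact: measurable_fst].
  - by apply: (measurableT_comp (f := snd)); [exact: measurable_snd|exact: measurable_fst].
have mc := measurableT_comp (continuous_measurable_fun (@continuous_cos R)) mph.
have ms := measurableT_comp (continuous_measurable_fun (@continuous_sin R)) mph.
have mr2 := measurableT_comp mr (@measurable_snd _ _ (plane R) T).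
have mi2 := measurableT_comp mi (@measurable_snd _ _ (plane R) T).
split.
- apply: (@measurable_Rintegral_param _ (plane R) (fun z => complex.Re (expi (ph z) * f z.2))).
  under eq_fun do rewrite ReM.
  by apply: measurable_funB; exact: measurable_funM.
- apply: (@measurable_Rintegral_param _ (plane R) (fun z => complex.Im (expi (ph z) * f z.2))).
  under eq_fun do rewrite ImM.
  by apply: measurable_funD; exact: measurable_funM.
Qed.

End measurable_extension.

Lemma cvg_expabs_harmonic (R : realType) (x : R) :
  expabs (n.+1%:R^-1) x @[n --> \oo] --> (1 : R).
Proof.
rewrite -[X in _ --> X]expR0 -oppr0 -[in X in _ --> X](mul0r `|x|).
apply: (continuous_cvg _ (@continuous_expR R _)).
apply: cvgN; apply: cvgM; last exact: cvg_cst.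
exact: cvg_harmonic.
Qed.

Lemma expabs_harmonic_le (R : realType) (x : R) :
  {homo (fun n => expabs (n.+1%:R^-1) x) : m n / (m <= n)%N >-> m <= n}.
Proof.
move=> m n mn; rewrite ler_expR lerN2 ler_wpM2r// lef_pV2 ?posrE ?ltr0n//.
by rewrite ler_nat.
Qed.
Opaque poisson.

(** * Upper bound of the extension by a majorant of the density that depends on the height *)

Section upper_bound.
Context d (T : measurableType d) (R : realType).
Variables (nu : {finite_measure set T -> \bar R}) (G1 G2 : T -> R).
Hypotheses (mG1 : measurable_fun setT G1) (mG2 : measurable_fun setT G2).
Local Notation Re := (@complex.Re R).
Local Notation Im := (@complex.Im R).
Local Notation nrm := (@Normc.normc R).
Local Notation leb := (@lebesgue_measure R).
Local Notation leb2 := (sprod leb leb).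
Local Notation nu3 := (sprod nu (sprod nu nu)).
Variable h : plane R -> R.
Hypothesis mh : measurable_fun setT h.
Hypothesis h_ge0 : forall x, 0 <= h x.
Hypothesis h_density : forall Phi : plane R -> \bar R, measurable_fun setT Phi ->
  (forall x, (0 <= Phi x)%E) ->
  (\int[nu3]_X Phi (sum3 G1 X, sum3 G2 X) = \int[leb2]_x (Phi x * (h x)%:E))%E.
Variables (psi : R -> R) (B : R).
Hypothesis mpsi : measurable_fun setT psi.
Hypothesis psiB : forall t, 0 <= psi t <= B.
Hypothesis psi_usc : forall eps, 0 < eps -> exists2 rho, 0 < rho &
  forall t u, `|u| < rho -> psi (t + u) <= psi t + eps.
Hypothesis h_psi : forall x, h x <= psi x.2.

Let mS1 := measurable_sum3 mG1.
Let mS2 := measurable_sum3 mG2.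

Let integral_poissonB (e s : R) : 0 < e ->
  (\int[leb]_z (poisson e (s - z))%:E = (2 * pi)%:E)%E.
Proof.
move=> e0; rewrite -(integral_poisson e0).
have mp : measurable_fun [set: R] (fun z => (poisson e z)%:E).
  by apply/measurable_EFinP; exact: measurable_poisson.
rewrite -(@ge0_integral_lebesgue_shift _ (fun z => (poisson e z)%:E) (- s))//; last first.
  by move=> x; rewrite lee_fin poisson_ge0.
by apply: eq_integral => x _; rewrite -poissonN opprB.
Qed.

Section fixed_parameter.
Variable e : R.
Hypothesis e0 : 0 < e.

Let ker (X Y : T * (T * T)) :=
  poisson e (sum3 G1 X - sum3 G1 Y) * poisson e (sum3 G2 X - sum3 G2 Y).

Let ker_ge0 X Y : 0 <= ker X Y.
Proof. by rewrite mulr_ge0 ?poisson_ge0. Qed.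

Let kerC X Y : ker X Y = ker Y X.
Proof. by rewrite /ker -poissonN opprB -[X in _ * X]poissonN opprB. Qed.

Let ker_le X Y : ker X Y <= (2 / e) ^+ 2.
Proof. by rewrite expr2 ler_pM ?poisson_ge0 ?poisson_le. Qed.

Let mker : measurable_fun setT (fun P => ker P.1 P.2).
Proof.
have mp := measurable_poisson e0.
apply: measurable_funM; apply: (measurableT_comp mp); apply: measurable_funB.
- exact: (measurableT_comp mS1).
- exact: (measurableT_comp mS1).
- exact: (measurableT_comp mS2).
- exact: (measurableT_comp mS2).
Qed.

(** The integral is a Poisson mean of [h] at the point of sums of [X]. Replacing [h] by [psi] leaves
    a product: the first coordinate integrates to [2 * pi], and the second is controlled uniformly
    by [poisson_approx_le], for which the one-sided estimate on [psi] is enough. *)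
Lemma integral_kernel_le (X : T * (T * T)) (eps rho : R) : 0 < eps -> 0 < rho ->
  (forall t u, `|u| < rho -> psi (t + u) <= psi t + eps) ->
  (\int[nu3]_Y (ker X Y)%:E <=
    ((2 * pi) ^+ 2 * (psi (sum3 G2 X) + eps + B * (e * (1 + rho ^- 2))))%:E)%E.
Proof.
move=> eps0 rho0 hrho.
set s1 := sum3 G1 X; set s2 := sum3 G2 X.
pose Phi (x : plane R) := (poisson e (s1 - x.1) * poisson e (s2 - x.2))%:E.
have mp := measurable_poisson e0.
have mP1 : measurable_fun setT (fun x : plane R => poisson e (s1 - x.1)).
  by apply: (measurableT_comp mp); exact: measurable_funB.
have mP2 : measurable_fun setT (fun x : plane R => poisson e (s2 - x.2)).
  by apply: (measurableT_comp mp); exact: measurable_funB.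
have mPhi : measurable_fun setT Phi.
  by apply/measurable_EFinP; exact: measurable_funM.
have -> : (\int[nu3]_Y (ker X Y)%:E = \int[leb2]_x (Phi x * (h x)%:E))%E.
  by rewrite -h_density// => x; rewrite lee_fin mulr_ge0 ?poisson_ge0.
pose Psi (x : plane R) := ((poisson e (s1 - x.1))%:E * (poisson e (s2 - x.2) * psi x.2)%:E)%E.
have mPsi : measurable_fun setT Psi.
  apply: emeasurable_funM; first exact/measurable_EFinP.
  by apply/measurable_EFinP; apply: measurable_funM => //; exact: measurableT_comp.
have psi0 t : 0 <= psi t by have /andP[] := psiB t.
apply: (@le_trans _ _ (\int[leb2]_x Psi x)%E).
  apply: ge0_le_integral => //.
  - move=> x _; rewrite -EFinM lee_fin.
    exact: mulr_ge0 (mulr_ge0 (poisson_ge0 e0 _) (poisson_ge0 e0 _)) (h_ge0 _).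
  - by apply: emeasurable_funM => //; exact/measurable_EFinP.
  - move=> x _; have -> : Psi x = (Phi x * (psi x.2)%:E)%E.
      by rewrite /Psi /Phi -!EFinM mulrA.
    rewrite lee_wpmul2l ?lee_fin//.
    exact: mulr_ge0 (poisson_ge0 e0 _) (poisson_ge0 e0 _).
rewrite [leLHS](fubini_tonelli1 Psi)//; last first.
  move=> x; rewrite /Psi -EFinM lee_fin.
  exact: mulr_ge0 (poisson_ge0 e0 _) (mulr_ge0 (poisson_ge0 e0 _) (psi0 _)).
rewrite /fubini_F /Psi/=.
under eq_integral => x1 _.
  rewrite ge0_integralZl//; last 3 first.
  - apply/measurable_EFinP; apply: measurable_funM => //.
    by apply: (measurableT_comp mp); exact: measurable_funB.
  - by move=> x2 _; rewrite lee_fin mulr_ge0 ?poisson_ge0.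
  - by rewrite lee_fin poisson_ge0.
  over.
rewrite ge0_integralZr//; last 3 first.
- apply/measurable_EFinP; apply: (measurableT_comp mp); exact: measurable_funB.
- by move=> x _; rewrite lee_fin poisson_ge0.
- by apply: integral_ge0 => x _; rewrite lee_fin mulr_ge0 ?poisson_ge0.
rewrite integral_poissonB// expr2 -mulrA [leRHS]EFinM lee_wpmul2l//.
  by rewrite lee_fin mulr_ge0 ?pi_ge0.
exact: poisson_approx_le.
Qed.


Variable f : T -> R[i].
Hypothesis f2 : square_integrable nu f.

Let q X := nrm (prod3 f X) ^+ 2.

Let iq : nu3.-integrable setT (EFin \o q).
Proof.
have i2 := square_integrable_normc2 f2.
have := integrable_prodM i2 (integrable_prodM i2 i2).
by apply: eq_integrable => // X _; rewrite /q /prod3 /= !Normc.normcM !exprMn.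
Qed.

Let mq : measurable_fun setT q.
Proof. by apply/measurable_EFinP; exact: measurable_int iq. Qed.

Let i1 : nu3.-integrable setT (EFin \o cst 1).
Proof.
have ic : nu.-integrable setT (EFin \o cst 1) by exact: finite_measure_integrable_cst.
have := integrable_prodM ic (integrable_prodM ic ic).
by apply: eq_integrable => // X _ /=; rewrite !mulr1.
Qed.

Let kq P := ker P.1 P.2 * q P.1.
Let kq' P := ker P.1 P.2 * q P.2.

Let q_ge0 X : 0 <= q X. Proof. exact: sqr_ge0. Qed.

Let kq_ge0 P : 0 <= kq P. Proof. exact: mulr_ge0 (ker_ge0 _ _) (q_ge0 _). Qed.
Let kq'_ge0 P : 0 <= kq' P. Proof. exact: mulr_ge0 (ker_ge0 _ _) (q_ge0 _). Qed.

Let ikq : (sprod nu3 nu3).-integrable setT (EFin \o kq).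
Proof.
have := integrableZl measurableT ((2 / e) ^+ 2) (integrable_prodM iq i1).
apply: le_integrable => //.
  by apply/measurable_EFinP; apply: measurable_funM => //; exact: measurableT_comp.
move=> P _; rewrite lee_fin mulr1 [leLHS]ger0_norm ?kq_ge0//.
rewrite ger0_norm; last exact: mulr_ge0 (sqr_ge0 _) (q_ge0 _).
exact: ler_wpM2r (q_ge0 _) _ _ (ker_le _ _).
Qed.

Let ikq' : (sprod nu3 nu3).-integrable setT (EFin \o kq').
Proof.
have := integrableZl measurableT ((2 / e) ^+ 2) (integrable_prodM i1 iq).
apply: le_integrable => //.
  by apply/measurable_EFinP; apply: measurable_funM => //; exact: measurableT_comp.
move=> P _; rewrite lee_fin mul1r [leLHS]ger0_norm ?kq'_ge0//.
rewrite ger0_norm; last exact: mulr_ge0 (sqr_ge0 _) (q_ge0 _).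
exact: ler_wpM2r (q_ge0 _) _ _ (ker_le _ _).
Qed.

Let mkerl X : measurable_fun setT (ker X).
Proof. exact: (measurableT_comp mker (measurable_pair1 X)). Qed.

Let integral_kq : (\int[sprod nu3 nu3]_P (kq P)%:E =
  \int[nu3]_X ((q X)%:E * \int[nu3]_Y (ker X Y)%:E))%E.
Proof.
rewrite [LHS](fubini_tonelli1 (EFin \o kq)); last 2 first.
- by apply/measurable_EFinP; apply: measurable_funM => //; exact: measurableT_comp.
- by move=> P; rewrite lee_fin kq_ge0.
apply: eq_integral => X _; rewrite /fubini_F.
under eq_integral do rewrite /= /kq mulrC EFinM /=.
by rewrite ge0_integralZl//; [exact/measurable_EFinP|move=> Y _; rewrite lee_fin|rewrite lee_fin].
Qed.

Let integral_kq' : (\int[sprod nu3 nu3]_P (kq' P)%:E =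
  \int[nu3]_X ((q X)%:E * \int[nu3]_Y (ker X Y)%:E))%E.
Proof.
rewrite [LHS](fubini_tonelli2 (EFin \o kq')); last 2 first.
- by apply/measurable_EFinP; apply: measurable_funM => //; exact: measurableT_comp.
- by move=> P; rewrite lee_fin kq'_ge0.
apply: eq_integral => X _; rewrite /fubini_G.
under eq_integral do rewrite /= /kq' kerC mulrC EFinM /=.
by rewrite ge0_integralZl//; [exact/measurable_EFinP|move=> Y _; rewrite lee_fin|rewrite lee_fin].
Qed.

(* AM-GM turns the bilinear form of the Poisson kernel into a weighted norm. *)
Let plancherel_le :
  (\int[leb2]_x (expabs e x.1 * expabs e x.2 *
      nrm (curve_ext nu G1 G2 f x) ^+ 6)%:E <=
   \int[nu3]_X ((q X)%:E * \int[nu3]_Y (ker X Y)%:E))%E.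
Proof.
have cf := square_integrable_cintegrable f2.
rewrite curve_ext_plancherel//.
have ikk : (sprod nu3 nu3).-integrable setT (EFin \o (fun P => 2^-1 * (kq P + kq' P))).
  have := integrableZl measurableT 2^-1 (integrableD measurableT ikq ikq').
  by apply: eq_integrable.
have le1 P : `|ker P.1 P.2 * (Re (prod3 f P.1) * Re (prod3 f P.2) +
       Im (prod3 f P.1) * Im (prod3 f P.2))| <= 2^-1 * (kq P + kq' P).
  rewrite normrM ger0_norm ?ker_ge0// /kq /kq' -mulrDr mulrCA ler_wpM2l ?ker_ge0//.
  rewrite /q !normc2 ler_norml.
  set a := Re _; set b := Re _; set c := Im _; set d' := Im _.
  have := sqr_ge0 (a + b); have := sqr_ge0 (a - b).
  have := sqr_ge0 (c + d'); have := sqr_ge0 (c - d').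
  by move=> *; apply/andP; split; nra.
apply: (@le_trans _ _ (\int[sprod nu3 nu3]_P (2^-1 * (kq P + kq' P))%:E)%E).
  apply: le_integral => //.
    apply: le_integrable ikk => //.
      have [[mr mi] [mr' mi']] := (cintegrable_measurable cf, cintegrable_measurable (cintegrable_prod3 cf)).
      apply/measurable_EFinP; apply: measurable_funM => //.
      apply: measurable_funD; apply: measurable_funM.
      - exact: (measurableT_comp mr').
      - exact: (measurableT_comp mr').
      - exact: (measurableT_comp mi').
      - exact: (measurableT_comp mi').
    by move=> P _; rewrite lee_fin (le_trans (le1 P))// ler_norm.
  by move=> P _; rewrite lee_fin (le_trans (ler_norm _) (le1 P)).
under eq_integral do rewrite EFinM EFinD.
rewrite integralZl//; last by apply: eq_integrable (integrableD measurableT ikq ikq').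
rewrite integralD// integral_kq integral_kq'.
set I := (\int[nu3]_X _)%E.
have I0 : (0 <= I)%E.
  apply: integral_ge0 => X _; rewrite mule_ge0 ?lee_fin//.
  by apply: integral_ge0 => Y _; rewrite lee_fin.
case: I I0 => [s _| _|//]; last by rewrite leey.
by rewrite -EFinD -EFinM lee_fin; lra.
Qed.

Lemma weighted_curve_ext_le (eps rho : R) : 0 < eps -> 0 < rho ->
  (forall t u, `|u| < rho -> psi (t + u) <= psi t + eps) ->
  (\int[leb2]_x (expabs e x.1 * expabs e x.2 *
      nrm (curve_ext nu G1 G2 f x) ^+ 6)%:E <=
   ((2 * pi) ^+ 2)%:E * (\int[nu3]_X (nrm (prod3 f X) ^+ 2 * psi (sum3 G2 X))%:E +
     (eps + B * (e * (1 + rho ^- 2)))%:E * \int[nu3]_X (nrm (prod3 f X) ^+ 2)%:E))%E.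
Proof.
move=> eps0 rho0 hrho; apply: (le_trans plancherel_le).
set k := eps + _.
have B0 : 0 <= B by have /andP[] := psiB 0; exact: le_trans.
have k0 : 0 <= k.
  by rewrite addr_ge0 ?(ltW eps0)// mulr_ge0// mulr_ge0 ?(ltW e0)// addr_ge0// invr_ge0 sqr_ge0.
have psi0 t : 0 <= psi t by have /andP[] := psiB t.
have mpS : measurable_fun setT (fun X => psi (sum3 G2 X)) by exact: (measurableT_comp mpsi mS2).
rewrite -ge0_integralZl//; [|exact/measurable_EFinP|by move=> X _; rewrite lee_fin sqr_ge0].
rewrite -ge0_integralD//; last 4 first.
- by move=> X _; rewrite lee_fin mulr_ge0 ?sqr_ge0.
- by apply/measurable_EFinP; exact: measurable_funM.
- by move=> X _; rewrite -EFinM lee_fin mulr_ge0 ?sqr_ge0.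
- by apply: emeasurable_funM => //; exact/measurable_EFinP.
rewrite -ge0_integralZl//; last 3 first.
- apply: emeasurable_funD; first by apply/measurable_EFinP; exact: measurable_funM.
  by apply: emeasurable_funM => //; exact/measurable_EFinP.
- move=> X _; rewrite -EFinM -EFinD lee_fin.
  exact: addr_ge0 (mulr_ge0 (q_ge0 _) (psi0 _)) (mulr_ge0 k0 (q_ge0 _)).
- by rewrite lee_fin sqr_ge0.
apply: ge0_le_integral => //.
- by move=> X _; rewrite mule_ge0 ?lee_fin//; apply: integral_ge0 => Y _; rewrite lee_fin.
- apply: emeasurable_funM; first exact/measurable_EFinP.
  apply: (measurable_fun_fubini_tonelli_F (fun P => (ker P.1 P.2)%:E)).
    exact/measurable_EFinP.
  by move=> P; rewrite lee_fin.
- apply: emeasurable_funM => //.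
  apply: emeasurable_funD; first by apply/measurable_EFinP; exact: measurable_funM.
  by apply: emeasurable_funM => //; exact/measurable_EFinP.
- move=> X _; have := integral_kernel_le X eps0 rho0 hrho.
  move=> /(lee_wpmul2l (x := (q X)%:E)); rewrite lee_fin q_ge0 => /(_ isT)/le_trans; apply.
  by rewrite -!EFinM lee_fin le_eqVlt; apply/orP; left; apply/eqP; rewrite /k /q; ring.
Qed.

End fixed_parameter.
(** Along [e = 1 / n.+1] the exponential weights increase to 1, so the left side converges
    monotonically, while the error terms of [weighted_curve_ext_le] are [eps] plus a multiple of
    [e], with [eps] arbitrary. *)
Lemma curve_ext_le f : square_integrable nu f ->
  (\int[leb2]_x (nrm (curve_ext nu G1 G2 f x) ^+ 6)%:E <=
   ((2 * pi) ^+ 2)%:E * \int[nu3]_X (nrm (prod3 f X) ^+ 2 * psi (sum3 G2 X))%:E)%E.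
Proof.
move=> f2.
have mE : measurable_fun setT (fun x : plane R => nrm (curve_ext nu G1 G2 f x) ^+ 6).
  apply: measurable_funX; apply: cmeasurable_normc; apply: measurable_curve_ext => //.
  by case: f2.
pose w n (x : plane R) := expabs (n.+1%:R^-1) x.1 * expabs (n.+1%:R^-1) x.2.
have w0 n x : 0 <= w n x by rewrite mulr_ge0 ?expR_ge0.
have mw n : measurable_fun setT (w n).
  by apply: measurable_funM; (apply: measurableT_comp => //; apply: continuous_measurable_fun;
    exact: continuous_expabs).
have E0 x : 0 <= nrm (curve_ext nu G1 G2 f x) ^+ 6 by rewrite exprn_ge0// normc_ge0.
pose u n (x : plane R) := (w n x * nrm (curve_ext nu G1 G2 f x) ^+ 6)%:E.
have -> : (\int[leb2]_x (nrm (curve_ext nu G1 G2 f x) ^+ 6)%:E =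
    \int[leb2]_x (limn (u ^~ x)))%E.
  apply: eq_integral => x _; apply/esym/cvg_lim => //; apply: cvg_EFin; first exact: nearW.
  have <- : 1 * 1 * nrm (curve_ext nu G1 G2 f x) ^+ 6 = nrm (curve_ext nu G1 G2 f x) ^+ 6.
    by rewrite !mul1r.
  apply: cvgM; last exact: cvg_cst.
  by apply: cvgM; exact: cvg_expabs_harmonic.
have iq : nu3.-integrable setT (EFin \o (fun X => nrm (prod3 f X) ^+ 2)).
  have i2 := square_integrable_normc2 f2.
  have := integrable_prodM i2 (integrable_prodM i2 i2).
  by apply: eq_integrable => // X _; rewrite /prod3 /= !Normc.normcM !exprMn.
set N3 := (\int[nu3]_X (nrm (prod3 f X) ^+ 2)%:E)%E.
have N3fin : N3 \is a fin_num by exact: (integrable_fin_num measurableT iq).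
have N30 : (0 <= N3)%E by apply: integral_ge0 => X _; rewrite lee_fin sqr_ge0.
have fN30 : 0 <= fine N3 by rewrite fine_ge0.
set L := (\int[nu3]_X _)%E.
have B0 : 0 <= B by have /andP[] := psiB 0; exact: le_trans.
have K0 : 0 < (2 * pi) ^+ 2 :> R by rewrite exprn_gt0// mulr_gt0 ?pi_gt0.
apply/lee_addgt0Pr => eta eta0.
(* For small [e] the two error terms together are at most [2 * eps], which makes the total error at
   most [eta]; [fine N3 + 1] keeps the denominator positive when [f] vanishes. *)
pose eps := eta / (2 * ((2 * pi) ^+ 2 * (fine N3 + 1))).
have eps0 : 0 < eps by rewrite divr_gt0// mulr_gt0// mulr_gt0// ltr_wpDl.
have [rho rho0 hrho] := psi_usc eps0.
rewrite monotone_convergence//; last 3 first.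
- by move=> n; apply/measurable_EFinP; exact: measurable_funM.
- by move=> n x _; rewrite lee_fin mulr_ge0.
- move=> x _ m n mn; rewrite lee_fin ler_wpM2r//.
  by rewrite ler_pM ?expR_ge0// expabs_harmonic_le.
have hk : 0 < B * (1 + rho ^- 2) + 1.
  by rewrite ltr_wpDl// mulr_ge0// addr_ge0// invr_ge0 sqr_ge0.
apply: lime_le.
  apply: ereal_nondecreasing_is_cvgn => m n mn; apply: ge0_le_integral => //.
  - by move=> x _; rewrite lee_fin mulr_ge0.
  - by apply/measurable_EFinP; exact: measurable_funM.
  - by apply/measurable_EFinP; exact: measurable_funM.
  - move=> x _; rewrite lee_fin ler_wpM2r//.
    by rewrite ler_pM ?expR_ge0// expabs_harmonic_le.
have ek : 0 < eps / (B * (1 + rho ^- 2) + 1) by rewrite divr_gt0.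
have := near_infty_natSinv_lt (PosNum ek); apply: filterS => n /=; rewrite ltr_pdivlMr// => hn.
have n0 : 0 < n.+1%:R^-1 :> R by rewrite invr_gt0.
apply: (le_trans (weighted_curve_ext_le n0 f2 eps0 rho0 hrho)).
rewrite -/L -/N3 muleDr ?ge0_adde_def ?inE//; last 2 first.
- by apply: integral_ge0 => X _; have /andP[p0 _] := psiB (sum3 G2 X); rewrite lee_fin mulr_ge0 ?sqr_ge0.
- by rewrite mule_ge0// lee_fin addr_ge0 ?(ltW eps0)// mulr_ge0// mulr_ge0 ?(ltW n0)// addr_ge0// invr_ge0 sqr_ge0.
rewrite leeD2l// -(fineK N3fin) -!EFinM lee_fin.
have h1 : eps + B * (n.+1%:R^-1 * (1 + rho ^- 2)) <= 2 * eps.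
  rewrite mulr_natl mulr2n lerD2l; apply: le_trans (ltW hn).
  by rewrite mulrCA ler_wpM2l ?(ltW n0)// lerDl.
have -> : eta = (2 * pi) ^+ 2 * ((2 * eps) * (fine N3 + 1)).
  have pi0 : (pi : R) != 0 by rewrite gt_eqF ?pi_gt0.
  have N1 : fine N3 + 1 != 0 by rewrite gt_eqF ?ltr_wpDl.
  have key (p N t : R) : p != 0 -> N != 0 ->
      t = (2 * p) ^+ 2 * (2 * (t / (2 * ((2 * p) ^+ 2 * N))) * N).
    by move=> p0 Nn0; field; rewrite Nn0 p0.
  exact: key.
rewrite ler_wpM2l ?(ltW K0)//; apply: (@le_trans _ _ (2 * eps * fine N3)).
  by rewrite ler_wpM2r.
by rewrite ler_wpM2l ?lerDl// mulr_ge0// ltW.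
Qed.

End upper_bound.

Local Close Scope complex_scope.

Local Open Scope complex_scope.
Opaque poisson.

(** * Lower bound of the extension for exponential functions *)

Section plane_affine.
Context {R : realType}.
Local Notation leb := (@lebesgue_measure R).
Local Notation leb2 := (sprod leb leb).

Lemma ge0_integral_lebesgue_affine (f : R -> \bar R) (c e : R) : 0 < e ->
  measurable_fun [set: R] f -> (forall x, 0 <= f x)%E ->
  (\int[leb]_x (e%:E * f (c + e * x)%R) = \int[leb]_x f x)%E.
Proof.
move=> e0 mf f0; rewrite -(ge0_integral_lebesgue_shift c mf f0).
rewrite -(@ge0_integral_lebesgue_scale _ (fun x => f (x + c)%R) e)//.
- by apply: eq_integral => x _; rewrite addrC.
- by apply: (measurableT_comp mf); exact: measurable_funD.
Qed.

Lemma ge0_integral_plane_affine (f : plane R -> \bar R) (c : plane R) (e : R) : 0 < e ->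
  measurable_fun setT f -> (forall x, 0 <= f x)%E ->
  (\int[leb2]_z ((e ^+ 2)%:E * f ((c.1 + e * z.1)%R, (c.2 + e * z.2)%R)) = \int[leb2]_x f x)%E.
Proof.
move=> e0 mf f0.
have e2 : (0 <= (e ^+ 2)%:E)%E by rewrite lee_fin sqr_ge0.
have maff (b : R) : measurable_fun [set: R] (fun x => b + e * x).
  by apply: measurable_funD => //; exact: measurable_funM.
rewrite [RHS](fubini_tonelli1 f)//.
pose F (z : plane R) := ((e ^+ 2)%:E * f (c.1 + e * z.1, c.2 + e * z.2)%R)%E.
rewrite [LHS](fubini_tonelli1 F); last 2 first.
- apply: emeasurable_funM => //; apply: (measurableT_comp mf).
  apply: measurable_fun_pair; first exact: (measurableT_comp (maff c.1) (@measurable_fst _ _ _ _)).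
  exact: (measurableT_comp (maff c.2) (@measurable_snd _ _ _ _)).
- by move=> x; rewrite mule_ge0.
rewrite /fubini_F /F/=.
have mF : measurable_fun [set: R] (fun x => \int[leb]_y f (x, y))%E.
  exact: (measurable_fun_fubini_tonelli_F f).
rewrite -(ge0_integral_lebesgue_affine c.1 e0 mF); last first.
  by move=> x; apply: integral_ge0.
apply: eq_integral => x _.
have mf1 : measurable_fun [set: R] (fun y => f (c.1 + e * x, y)).
  exact: (measurableT_comp mf (measurable_pair1 (c.1 + e * x))).
rewrite -(ge0_integral_lebesgue_affine c.2 e0 mf1)//.
rewrite -ge0_integralZl//; [|by apply: emeasurable_funM => //; exact: (measurableT_comp mf1 (maff c.2))|by move=> y _; rewrite mule_ge0// lee_fin ltW|by rewrite lee_fin ltW].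
by apply: eq_integral => y _; rewrite muleA -EFinM expr2.
Qed.

End plane_affine.
Section lower_bound.
Context d (T : measurableType d) (R : realType).
Variables (nu : {finite_measure set T -> \bar R}) (G1 G2 : T -> R).
Hypotheses (mG1 : measurable_fun setT G1) (mG2 : measurable_fun setT G2).
Local Notation Re := (@complex.Re R).
Local Notation Im := (@complex.Im R).
Local Notation nrm := (@Normc.normc R).
Local Notation leb := (@lebesgue_measure R).
Local Notation leb2 := (sprod leb leb).
Local Notation nu3 := (sprod nu (sprod nu nu)).
Variable h : plane R -> R.
Hypothesis mh : measurable_fun setT h.
Hypothesis h_ge0 : forall x, 0 <= h x.
Hypothesis h_density : forall Phi : plane R -> \bar R, measurable_fun setT Phi ->
  (forall x, (0 <= Phi x)%E) ->
  (\int[nu3]_X Phi (sum3 G1 X, sum3 G2 X) = \int[leb2]_x (Phi x * (h x)%:E))%E.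
Variable U : set (plane R).
Hypothesis mU : measurable U.
Hypothesis h_continuous : forall x : R * R, U x -> {for x, continuous (h : R * R -> R)}.

Let mS1 := measurable_sum3 mG1.
Let mS2 := measurable_sum3 mG2.

Section one_function.
Variable k : R.
Hypothesis k_ge0 : 0 <= k.
Hypothesis G2_ge0 : forall y, 0 <= G2 y.

(** The product of three values of [F] depends only on the sum of the heights, so it is constant on
    each fibre of the sum map. Hence [u] below is exactly the density of the push-forward of
    [prod3 f], and nothing is lost in passing to the plane. *)
Let F (y : T) : R := expR (- (k * G2 y)).
Let f (y : T) : R[i] := (F y)%:C.
Let u (x : plane R) : R := expR (- (k * x.2)) * h x.

Let F_le1 y : 0 <= F y <= 1.
Proof. by rewrite expR_ge0 -expR0 ler_expR oppr_le0 mulr_ge0. Qed.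

Let mF : measurable_fun setT F.
Proof. by apply: measurableT_comp => //; apply: measurableT_comp => //; exact: measurable_funM. Qed.

Lemma square_integrable_expR : square_integrable nu f.
Proof.
split; first by split => //; exact: measurable_cst.
apply: (@le_lt_trans _ _ (\int[nu]_y 1)%E).
  apply: ge0_le_integral => //.
  - by move=> y _; rewrite lee_fin sqr_ge0.
  - by apply/measurable_EFinP; rewrite /f /=; under eq_fun do rewrite expr0n addr0 sqrtr_sqr; apply: measurable_funX; exact: measurableT_comp.
  - move=> y _; rewrite lee_fin normc2 /= expr0n addr0 exprn_ile1//; by have /andP[] := F_le1 y.
by rewrite integral_cst// mul1e fin_num_fun_lty// fin_num_measure.
Qed.

Let u_ge0 x : 0 <= u x. Proof. exact: mulr_ge0 (expR_ge0 _) (h_ge0 _). Qed.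

Let mu' : measurable_fun setT u.
Proof.
apply: measurable_funM => //.
by apply: measurableT_comp => //; apply: measurableT_comp => //; exact: measurable_funM.
Qed.

Let prod3F X : prod3 f X = (expR (- (k * sum3 G2 X)))%:C.
Proof.
rewrite /prod3 /f -!rmorphM/=; congr (_%:C).
by rewrite /F -!expRD; congr expR; rewrite /sum3; ring.
Qed.

Let PP e (x y : plane R) := poisson e (x.1 - y.1) * poisson e (x.2 - y.2).

(** The weights [expabs] are at most 1, and both triple integrals of Plancherel's identity turn into
    plane integrals because [prod3 f] is a function of the sums. *)
Let weighted_lower e : 0 < e ->
  (\int[leb2]_x \int[leb2]_y (u x * (PP e x y * u y))%:E <=
   \int[leb2]_x (nrm (curve_ext nu G1 G2 f x) ^+ 6)%:E)%E.
Proof.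
move=> e0.
have sf := square_integrable_expR.
have mE : measurable_fun setT (fun x : plane R => nrm (curve_ext nu G1 G2 f x) ^+ 6).
  apply: measurable_funX; apply: cmeasurable_normc; apply: measurable_curve_ext => //.
  by case: sf.
have E0 x : 0 <= nrm (curve_ext nu G1 G2 f x) ^+ 6 by rewrite exprn_ge0// normc_ge0.
apply: (@le_trans _ _ (\int[leb2]_x (expabs e x.1 * expabs e x.2 *
      nrm (curve_ext nu G1 G2 f x) ^+ 6)%:E)%E); last first.
  apply: ge0_le_integral => //.
  - by move=> x _; rewrite lee_fin; exact: mulr_ge0 (mulr_ge0 (expR_ge0 _) (expR_ge0 _)) (E0 _).
  - apply/measurable_EFinP; apply: measurable_funM => //.
    by apply: measurable_funM; (apply: measurableT_comp => //; apply: continuous_measurable_fun;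
      exact: continuous_expabs).
  - exact/measurable_EFinP.
  - move=> x _; rewrite lee_fin ler_piMl//.
    by rewrite mulr_ile1 ?expR_ge0 ?expabs_le1.
rewrite (curve_ext_plancherel mG1 mG2 e0 (square_integrable_cintegrable sf)).
have pp0 := poisson_ge0 e0; have mp := measurable_poisson e0.
have mPP d' (S' : measurableType d') (x y : S' -> plane R) : measurable_fun setT x ->
    measurable_fun setT y -> measurable_fun setT (fun s => PP e (x s) (y s)).
  move=> mx my; apply: measurable_funM; apply: (measurableT_comp mp); apply: measurable_funB.
  - exact: (measurableT_comp (@measurable_fst _ _ _ _) mx).
  - exact: (measurableT_comp (@measurable_fst _ _ _ _) my).
  - exact: (measurableT_comp (@measurable_snd _ _ _ _) mx).
  - exact: (measurableT_comp (@measurable_snd _ _ _ _) my).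
have PP0 x y : 0 <= PP e x y by exact: mulr_ge0.
pose S X : plane R := (sum3 G1 X, sum3 G2 X).
have mS : measurable_fun setT S by exact: measurable_fun_pair.
pose ex (x : plane R) := expR (- (k * x.2)).
have mex : measurable_fun setT ex.
  by apply: measurableT_comp => //; apply: measurableT_comp => //; exact: measurable_funM.
have ex0 x : 0 <= ex x by exact: expR_ge0.
have -> : (\int[sprod nu3 nu3]_P (poisson e (sum3 G1 P.1 - sum3 G1 P.2) *
      poisson e (sum3 G2 P.1 - sum3 G2 P.2) *
      (Re (prod3 f P.1) * Re (prod3 f P.2) +
       Im (prod3 f P.1) * Im (prod3 f P.2)))%:E =
   \int[sprod nu3 nu3]_P (PP e (S P.1) (S P.2) * (ex (S P.1) * ex (S P.2)))%:E)%E.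
  by apply: eq_integral => P _; rewrite !prod3F /= mulr0 addr0.
rewrite [X in (_ <= X)%E](fubini_tonelli1 (fun P => (PP e (S P.1) (S P.2) * (ex (S P.1) * ex (S P.2)))%:E)); last 2 first.
- apply/measurable_EFinP; apply: measurable_funM.
    by apply: mPP; exact: (measurableT_comp mS).
  apply: measurable_funM; apply: (measurableT_comp mex).
  - exact: (measurableT_comp mS (@measurable_fst _ _ _ _)).
  - exact: (measurableT_comp mS (@measurable_snd _ _ _ _)).
- by move=> P; rewrite lee_fin; exact: mulr_ge0 (PP0 _ _) (mulr_ge0 (ex0 _) (ex0 _)).
rewrite /fubini_F/=.
pose Phi (x : plane R) := (\int[leb2]_y (ex x * (PP e x y * u y))%:E)%E.
have inner x : (\int[nu3]_Y (PP e x (S Y) * (ex x * ex (S Y)))%:E)%E = Phi x.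
  rewrite (h_density (Phi := fun y => (PP e x y * (ex x * ex y))%:E))//=.
  - by apply: eq_integral => y _; rewrite /u -EFinM; congr (_%:E); rewrite /ex; ring.
  - by apply/measurable_EFinP; apply: measurable_funM; [apply: mPP|exact: measurable_funM].
  - by move=> y; rewrite lee_fin; exact: mulr_ge0 (PP0 _ _) (mulr_ge0 (ex0 _) (ex0 _)).
under [X in (_ <= X)%E]eq_integral => X _ do rewrite (inner (S X)).
have mPhi : measurable_fun setT Phi.
  apply: (measurable_fun_fubini_tonelli_F (fun z : plane R * plane R => (ex z.1 * (PP e z.1 z.2 * u z.2))%:E)).
    apply/measurable_EFinP; apply: measurable_funM; first exact: measurableT_comp.
    by apply: measurable_funM; [apply: mPP|exact: measurableT_comp].
  by move=> z; rewrite lee_fin; exact: mulr_ge0 (ex0 _) (mulr_ge0 (PP0 _ _) (u_ge0 _)).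
rewrite h_density//; last first.
  move=> x; apply: integral_ge0 => y _; rewrite lee_fin.
  exact: mulr_ge0 (ex0 _) (mulr_ge0 (PP0 _ _) (u_ge0 _)).
rewrite le_eqVlt; apply/orP; left; apply/eqP; apply: eq_integral => x _.
rewrite -ge0_integralZr//.
- by apply: eq_integral => y _; rewrite -EFinM /u -/(ex x); congr (_%:E); ring.
- apply/measurable_EFinP; apply: measurable_funM => //.
  by apply: measurable_funM => //; apply: mPP.
- by move=> y _; rewrite lee_fin; exact: mulr_ge0 (ex0 _) (mulr_ge0 (PP0 _ _) (u_ge0 _)).
- by rewrite lee_fin.
Qed.

Let q (z : plane R) : R := poisson 1 z.1 * poisson 1 z.2.
Let q_ge0 z : 0 <= q z.
Proof. by have p1 := poisson_ge0 (@ltr01 R); exact: mulr_ge0. Qed.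
Let mq : measurable_fun setT q.
Proof.
have mp := measurable_poisson (@ltr01 R).
by apply: measurable_funM; apply: (measurableT_comp mp).
Qed.

Let aff e (P : plane R * plane R) : plane R := (P.1.1 + e * P.2.1, P.1.2 + e * P.2.2).
Let maff e : measurable_fun setT (aff e).
Proof.
apply: measurable_fun_pair; apply: measurable_funD.
- exact: (measurableT_comp (@measurable_fst _ _ _ _)).
- by apply: measurable_funM => //; apply: (measurableT_comp (@measurable_fst _ _ _ _)).
- exact: (measurableT_comp (@measurable_snd _ _ _ _)).
- by apply: measurable_funM => //; apply: (measurableT_comp (@measurable_snd _ _ _ _)).
Qed.

Let gg e P : R := u P.1 * (q P.2 * u (aff e P)).
Let gg_ge0 e P : 0 <= gg e P.
Proof. exact: mulr_ge0 (u_ge0 _) (mulr_ge0 (q_ge0 _) (u_ge0 _)). Qed.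
Let mgg e : measurable_fun setT (gg e).
Proof.
apply: measurable_funM; first exact: measurableT_comp.
by apply: measurable_funM; [exact: measurableT_comp|exact: (measurableT_comp mu' (maff e))].
Qed.

(** The substitution [y = x + e * z] moves the parameter out of the kernel and into the argument of
    [u]: the kernel [q] is now fixed, as a pointwise passage to the limit requires. *)
Let rescale e : 0 < e ->
  (\int[leb2]_x \int[leb2]_y (u x * (PP e x y * u y))%:E =
   \int[sprod leb2 leb2]_P (gg e P)%:E)%E.
Proof.
move=> e0; have pp0 := poisson_ge0 e0; have mp := measurable_poisson e0.
rewrite [RHS](fubini_tonelli1 (fun P => (gg e P)%:E)); last 2 first.
- exact/measurable_EFinP.
- by move=> P; rewrite lee_fin.
apply: eq_integral => x _; rewrite /fubini_F/=.
rewrite -(ge0_integral_plane_affine x e0); last 2 first.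
- apply/measurable_EFinP; apply: measurable_funM => //; apply: measurable_funM => //.
  by apply: measurable_funM; apply: (measurableT_comp mp); exact: measurable_funB.
- by move=> y; rewrite lee_fin; exact: mulr_ge0 (u_ge0 _) (mulr_ge0 (mulr_ge0 (pp0 _) (pp0 _)) (u_ge0 _)).
apply: eq_integral => z _; rewrite -EFinM; congr (_%:E).
rewrite /gg /PP /q /aff /= -!(poisson_scale _ e0).
have -> : x.1 - (x.1 + e * z.1) = - (e * z.1) by ring.
have -> : x.2 - (x.2 + e * z.2) = - (e * z.2) by ring.
by rewrite !poissonN; ring.
Qed.

Let gg_cvg P : U P.1 -> gg (n.+1%:R^-1) P @[n --> \oo] --> u P.1 * (q P.2 * u P.1).
Proof.
move=> UP; apply: cvgM; first exact: cvg_cst.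
apply: cvgM; first exact: cvg_cst.
have c1 (a b : R) : a + n.+1%:R^-1 * b @[n --> \oo] --> a.
  rewrite -[X in _ --> X]addr0 -[in X in _ --> X](mul0r b).
  apply: cvgD; first exact: cvg_cst.
  by apply: cvgM; [exact: cvg_harmonic|exact: cvg_cst].
have affcvg : aff (n.+1%:R^-1) P @[n --> \oo] --> (P.1 : R * R).
  rewrite [X in _ --> X](surjective_pairing P.1).
  exact: (cvg_pair (c1 P.1.1 P.2.1) (c1 P.1.2 P.2.2)).
apply: cvgM; last exact: (continuous_cvg _ (h_continuous UP) affcvg).
apply: continuous_cvg; first exact: continuous_expR.
by apply: cvgN; apply: cvgM; [exact: cvg_cst|exact: c1].
Qed.

(** Fatou's lemma asks for no majorant and loses in the right direction. The pointwise limit is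
    taken on [U], where [h] is continuous; discarding the rest only decreases the integral. *)
Lemma curve_ext_ge :
  (((2 * pi) ^+ 2)%:E * \int[leb2]_(x in U) (u x ^+ 2)%:E <=
   \int[leb2]_x (nrm (curve_ext nu G1 G2 f x) ^+ 6)%:E)%E.
Proof.
pose v n P := (gg (n.+1%:R^-1) P)%:E.
have mv n : measurable_fun setT (v n) by exact/measurable_EFinP.
pose D : set (plane R * plane R) := fst @^-1` U.
have mD : measurable D by rewrite -[D]setTI; exact: measurable_fst.
have K2 : 0 <= (2 * pi) ^+ 2 :> R by exact: sqr_ge0.
have p1 := poisson_ge0 (@ltr01 R); have mp := measurable_poisson (@ltr01 R).
have int_q : (\int[leb2]_z (q z)%:E = ((2 * pi) ^+ 2)%:E)%E.
  rewrite [LHS](fubini_tonelli1 (fun z => (q z)%:E)); last 2 first.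
  - exact/measurable_EFinP.
  - by move=> z; rewrite lee_fin.
  rewrite /fubini_F /q; under eq_integral => z1 _.
    under eq_integral do rewrite EFinM /=.
    rewrite ge0_integralZl//; [|exact/measurable_EFinP|by move=> z2 _; rewrite lee_fin|by rewrite lee_fin].
    rewrite integral_poisson//.
    over.
  rewrite ge0_integralZr//; [|exact/measurable_EFinP|by move=> z2 _; rewrite lee_fin|by rewrite lee_fin mulr_ge0 ?pi_ge0].
  by rewrite integral_poisson// -EFinM expr2.
apply: (@le_trans _ _ (\int[sprod leb2 leb2]_(P in D) (u P.1 * (q P.2 * u P.1))%:E)%E).
  rewrite le_eqVlt; apply/orP; left; apply/eqP.
  rewrite [RHS]integral_mkcond [RHS](fubini_tonelli1 (_ \_ D)); last 2 first.
  - apply/(measurable_restrictT _ _).1 => //; apply: measurable_funTS.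
    apply/measurable_EFinP; apply: measurable_funM; first exact: measurableT_comp.
    by apply: measurable_funM; exact: measurableT_comp.
  - move=> P; rewrite patchE; case: ifP => // _; rewrite lee_fin.
    exact: mulr_ge0 (u_ge0 _) (mulr_ge0 (q_ge0 _) (u_ge0 _)).
  rewrite -ge0_integralZl//; last 2 first.
  - by apply: measurable_funTS; apply/measurable_EFinP; exact: measurable_funX.
  - by move=> x _; rewrite lee_fin sqr_ge0.
  rewrite [LHS]integral_mkcond; apply: eq_integral => x _; rewrite /fubini_F patchE.
  have [xU|xU] := boolP (x \in U).
    transitivity (\int[leb2]_z ((u x ^+ 2)%:E * (q z)%:E))%E.
      rewrite ge0_integralZl//; last 3 first.
      - exact/measurable_EFinP.
      - by move=> z _; rewrite lee_fin.
      - by rewrite lee_fin sqr_ge0.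
      by rewrite int_q muleC.
    apply: eq_integral => z _; rewrite patchE mem_set/=; last by rewrite /D/= -in_setE.
    by rewrite -EFinM; congr (_%:E); ring.
  apply/esym/integral0_eq => z _; rewrite patchE memNset// /D/=.
  by move=> /mem_set; rewrite (negbTE xU).
apply: (@le_trans _ _ (\int[sprod leb2 leb2]_(P in D) limn_einf (v ^~ P))%E).
  rewrite le_eqVlt; apply/orP; left; apply/eqP.
  apply: eq_integral => P; rewrite inE => /gg_cvg PU.
  have vl : v ^~ P @ \oo --> (u P.1 * (q P.2 * u P.1))%:E.
    by apply: cvg_EFin => //; exact: nearW.
  by rewrite (cvg_limn_einf_sup vl).1.
apply: (le_trans (fatou (sprod leb2 leb2) mD (fun n => measurable_funTS (mv n)) _)).
  by move=> n P _; rewrite lee_fin.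
rewrite limn_einf_lim; apply: lime_le; first exact: is_cvg_einfs.
apply: nearW => n; apply: (@le_trans _ _ (\int[sprod leb2 leb2]_(P in D) v n P)%E).
  by apply: ereal_inf_lbound; exists n => //=.
have n0 : 0 < n.+1%:R^-1 :> R by rewrite invr_gt0.
apply: (le_trans _ (weighted_lower n0)); rewrite (rescale n0).
by apply: ge0_subset_integral => // P _; rewrite lee_fin.
Qed.

End one_function.

Hypothesis G2_ge0 : forall y, 0 <= G2 y.
Variable h0 : R.
Hypothesis h_near : forall eta, 0 < eta -> exists2 t, 0 < t &
  forall x, U x -> x.2 < t -> h0 - eta <= h x.
Hypothesis h_off : leb2 [set x | ~ U x /\ h x != 0] = 0%E.
Hypothesis nu_pos : forall t, 0 < t -> (0 < nu [set y | (G2 y < t)%R])%E.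

Let nu3T_fin : nu3 setT \is a fin_num.
Proof.
have -> : nu3 setT = (nu setT * (nu setT * nu setT))%E.
  rewrite -setXTT [LHS]product_measure1E//; congr (_ * _)%E.
  by rewrite -setXTT [LHS]product_measure1E.
by rewrite !fin_numM// fin_num_measure.
Qed.

Let nu3_pos t : 0 < t -> (0 < nu3 [set X | (sum3 G2 X < t)%R])%E.
Proof.
move=> t0; pose B := [set y | G2 y < t / 3].
have mB (s : R) : measurable [set y | G2 y < s].
  have := mG2 measurableT (measurable_itv `]-oo, s[); rewrite setTI.
  by congr measurable; apply/seteqP; split => y /=; rewrite in_itv.
have B0 : (0 < nu B)%E by apply: nu_pos; rewrite divr_gt0.
apply: (@lt_le_trans _ _ (nu3 (B `*` (B `*` B)))).
  rewrite [ltRHS]product_measure1E//; [|exact: mB|by apply: measurableX; exact: mB].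
  rewrite mule_gt0// [ltRHS]product_measure1E//; [|exact: mB|exact: mB].
  exact: mule_gt0.
apply: le_measure; rewrite ?inE.
- by apply: measurableX; [exact: mB|apply: measurableX; exact: mB].
- have := mS2 measurableT (measurable_itv `]-oo, t[); rewrite setTI.
  by congr measurable; apply/seteqP; split => y /=; rewrite in_itv.
- by move=> [x [y z]] [/= hx [hy hz]]; rewrite /sum3/=; move: hx hy hz; rewrite /B/=; lra.
Qed.

(** For large [k] the weight [exp (- 2 k s)] sits on heights below [t], where [h] is at least
    [h0 - eta / 2]. The part above [t] contributes at most [exp (- 2 k t) * M], and the part below
    [t / 2] at least [exp (- k t) * m], so their quotient tends to zero. *)
Lemma near_extremizer (eta : R) : 0 < eta -> eta < h0 -> exists k,
  let f := fun y => (expR (- (k * G2 y)))%:C in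
  [/\ square_integrable nu f, (0 < \int[nu]_y (nrm (f y) ^+ 2)%:E)%E &
  (((2 * pi) ^+ 2 * (h0 - eta))%:E * \int[nu3]_X (nrm (prod3 f X) ^+ 2)%:E <=
   \int[leb2]_x (nrm (curve_ext nu G1 G2 f x) ^+ 6)%:E)%E].
Proof.
move=> eta0 etah; have eta2 : 0 < eta / 2 by rewrite divr_gt0.
have [t t0 ht] := h_near eta2.
have h1 : 0 < h0 - eta by rewrite subr_gt0.
have h2 : 0 < h0 - eta / 2 by lra.
pose M := fine (nu3 setT).
pose L := [set X | sum3 G2 X < t / 2].
have mL : measurable L.
  have := mS2 measurableT (measurable_itv `]-oo, t / 2[); rewrite setTI.
  by congr measurable; apply/seteqP; split => y /=; rewrite in_itv.
have m0 : (0 < nu3 L)%E by apply: nu3_pos; rewrite divr_gt0.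
have mfin : nu3 L \is a fin_num.
  rewrite ge0_fin_numE//; apply: (le_lt_trans (le_measure nu3 _ _ (@subsetT _ L))); rewrite ?inE//.
  by rewrite -ge0_fin_numE; [exact: nu3T_fin|exact: measure_ge0].
pose m := fine (nu3 L).
have m0' : 0 < m by rewrite fine_gt0// m0 ltey_eq mfin.
have M0 : 0 <= M by apply: fine_ge0; exact: measure_ge0.
have ME : M%:E = nu3 setT := fineK nu3T_fin.
have mE : m%:E = nu3 L := fineK mfin.
clearbody M m.
(* With [E = exp (- k t)], the loss [(h0 - eta) * E ^+ 2 * M] must be paid by [eta / 2 * E * m],
   that is, [E] must be at most about [c]; the 1 keeps the denominator positive. The choice
   [k * t = 1 / c] does it because [exp (1 / c) >= 1 / c]. *)
pose c := eta / 2 * m / (M * (h0 - eta) + 1).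
have d0 : 0 < M * (h0 - eta) + 1 by rewrite ltr_wpDl// mulr_ge0// ltW.
have c0 : 0 < c := divr_gt0 (mulr_gt0 eta2 m0') d0.
pose k := c^-1 / t.
have ci0 : 0 < c^-1 by rewrite invr_gt0.
have k0 : 0 < k := divr_gt0 ci0 t0.
have kc : expR (- (k * t)) <= c.
  rewrite expRN -[leRHS]invrK lef_pV2 ?posrE ?invr_gt0// ?expR_gt0//.
  have -> : k * t = c^-1 by rewrite /k divfK// gt_eqF.
  by apply: le_trans (expR_ge1Dx _); rewrite lerDr.
exists k => f.
have sf : square_integrable nu f by apply: square_integrable_expR => //; exact: ltW.
have fE y : nrm (f y) ^+ 2 = expR (- (2 * k * G2 y)).
  rewrite normc2 /= expr0n addr0 expr2 -expRD; congr expR; ring.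
have qE X : nrm (prod3 f X) ^+ 2 = expR (- (2 * k * sum3 G2 X)).
  by rewrite /prod3 !Normc.normcM !exprMn !fE -!expRD; congr expR; rewrite /sum3; ring.
have S2_ge0 X : 0 <= sum3 G2 X by rewrite addr_ge0// addr_ge0.
pose a (s : R) := expR (- (2 * k * s)).
have ma : measurable_fun [set: R] a.
  by apply: measurableT_comp => //; apply: measurableT_comp => //; exact: measurable_funM.
have a0 s : 0 <= a s by exact: expR_ge0.
pose b (s : R) := \1_(`]-oo, t[) s : R.
have mb : measurable_fun [set: R] b by apply: measurable_indic; exact: measurable_itv.
have b0 s : 0 <= b s by rewrite /b indicE.
split => //.
  have : (0 < nu [set y | (G2 y < 1)%R])%E by exact: nu_pos.
  have mB : measurable [set y | G2 y < 1].
    have := mG2 measurableT (measurable_itv `]-oo, 1[); rewrite setTI.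
    by congr measurable; apply/seteqP; split => y /=; rewrite in_itv.
  move=> nuB; apply: (@lt_le_trans _ _ (\int[nu]_(y in [set y | (G2 y < 1)%R]) (expR (- (2 * k)))%:E)%E).
    by rewrite integral_cst// mule_gt0// lte_fin expR_gt0.
  have mn : measurable_fun setT (fun y => (nrm (f y) ^+ 2)%:E).
    by apply/measurable_EFinP; apply: measurable_funX; apply: cmeasurable_normc; case: sf.
  apply: (@le_trans _ _ (\int[nu]_(y in [set y | (G2 y < 1)%R]) (nrm (f y) ^+ 2)%:E)%E).
    apply: ge0_le_integral => //.
    - exact: measurable_funTS.
    - move=> y /= y1; rewrite lee_fin fE ler_expR lerN2 ler_piMr ?(ltW y1)//.
      by rewrite mulr_ge0// ltW.
  by apply: ge0_subset_integral => // y _; rewrite lee_fin sqr_ge0.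
have bE s : b s = if s < t then 1 else 0.
  rewrite /b indicE; have [st|st] := ltP s t; first by rewrite mem_set//= in_itv.
  by rewrite memNset//= in_itv/= ltNge st.
have ab0 s : 0 <= a s * b s by exact: mulr_ge0.
have mab : measurable_fun [set: R] (fun s => a s * b s) by exact: measurable_funM.
have mabS : measurable_fun setT (fun X => (a (sum3 G2 X) * b (sum3 G2 X))%:E).
  by apply/measurable_EFinP; exact: (measurableT_comp mab mS2).
pose A := (\int[nu3]_X (a (sum3 G2 X) * b (sum3 G2 X))%:E)%E.
have AE : A = (\int[leb2]_(x in U) (a x.2 * b x.2 * h x)%:E)%E.
  rewrite /A (h_density (Phi := fun x => (a x.2 * b x.2)%:E)); last 2 first.
  - apply/measurable_EFinP; exact: (measurableT_comp mab (@measurable_snd _ _ _ _)).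
  - by move=> x; rewrite lee_fin.
  have mabh : measurable_fun setT (fun x : plane R => (a x.2 * b x.2 * h x)%:E).
    apply/measurable_EFinP; apply: measurable_funM => //.
    exact: (measurableT_comp mab (@measurable_snd _ _ _ _)).
  under eq_integral do rewrite -EFinM.
  rewrite -(setUv U) ge0_integral_setU//=; last 4 first.
  - exact: measurableC.
  - by rewrite setUv.
  - by move=> x _; rewrite lee_fin mulr_ge0.
  - exact/disj_setPCl.
  rewrite [X in (_ + X)%E](_ : _ = 0)%E ?adde0//.
  have mN : measurable [set x | ~ U x /\ h x != 0].
    rewrite (_ : [set x | ~ U x /\ h x != 0] = ~` U `&` (h @^-1` [set~ 0])); last first.
      by apply/seteqP; split => x /= [Ux /eqP hx].
    apply: measurableI; first exact: measurableC.
    rewrite -[X in measurable X]setTI; apply: mh => //.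
    by apply: measurableC; exact: measurable_set1.
  transitivity (\int[leb2]_(x in [set x | ~ U x /\ h x != 0%R]) (a x.2 * b x.2 * h x)%:E)%E.
    rewrite [LHS]integral_mkcond [RHS]integral_mkcond; apply: eq_integral => x _.
    rewrite !patchE; have [xU|xU] := pselect (U x).
      by rewrite !memNset//= => -[].
    rewrite [in LHS]mem_set//; have [hx|hx] := eqVneq (h x) 0.
      by rewrite hx mulr0; case: ifP.
    by rewrite mem_set.
  by apply: null_set_integral => //; exact: measurable_funTS.
have A_ge : ((expR (- (k * t)) * m)%:E <= A)%E.
  have -> : ((expR (- (k * t)) * m)%:E = \int[nu3]_(X in L) (expR (- (k * t)))%:E)%E.
    by rewrite integral_cst// EFinM mE.
  apply: (@le_trans _ _ (\int[nu3]_(X in L) (a (sum3 G2 X) * b (sum3 G2 X))%:E)%E).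
    apply: ge0_le_integral => //.
    - exact: measurable_funTS.
    - move=> X /= XL; rewrite lee_fin bE ifT; last by apply: lt_trans XL _; lra.
      by rewrite mulr1 ler_expR lerN2; move: XL (S2_ge0 X) k0; rewrite /L/=; nra.
  by apply: ge0_subset_integral => // X _; rewrite lee_fin.
have N_le : (\int[nu3]_X (nrm (prod3 f X) ^+ 2)%:E <= A + (expR (- (k * t)) ^+ 2 * M)%:E)%E.
  have -> : ((expR (- (k * t)) ^+ 2 * M)%:E = \int[nu3]_X (expR (- (k * t)) ^+ 2)%:E)%E.
    by rewrite integral_cst; [rewrite EFinM ME|exact: measurableT].
  rewrite -ge0_integralD//; last by move=> X _; rewrite lee_fin.
  apply: ge0_le_integral => //; first by move=> X _; rewrite lee_fin sqr_ge0.
  - by under eq_fun do rewrite qE; apply/measurable_EFinP; exact: (measurableT_comp ma mS2).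
  - by apply: emeasurable_funD.
  - move=> X _; rewrite qE -EFinD lee_fin bE; case: ltP => st.
      by rewrite mulr1 lerDl sqr_ge0.
    by rewrite mulr0 add0r expr2 -expRD ler_expR; move: st k0; nra.
have J_ge : ((h0 - eta / 2)%:E * A <= \int[leb2]_(x in U) ((expR (- (k * x.2)) * h x) ^+ 2)%:E)%E.
  rewrite AE -ge0_integralZl//; last 3 first.
  - apply: measurable_funTS; apply/measurable_EFinP; apply: measurable_funM => //.
    exact: (measurableT_comp mab (@measurable_snd _ _ _ _)).
  - by move=> x _; rewrite lee_fin mulr_ge0.
  - by rewrite lee_fin ltW.
  apply: ge0_le_integral => //.
    by move=> x _; rewrite -EFinM lee_fin; exact: mulr_ge0 (ltW h2) (mulr_ge0 (ab0 _) (h_ge0 _)).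
  - apply: measurable_funTS; apply: emeasurable_funM => //; apply/measurable_EFinP; apply: measurable_funM => //.
    exact: (measurableT_comp mab (@measurable_snd _ _ _ _)).
  - apply: measurable_funTS; apply/measurable_EFinP; apply: measurable_funX; apply: measurable_funM => //.
    by apply: measurableT_comp => //; apply: measurableT_comp => //; exact: measurable_funM.
  - move=> x Ux; rewrite -EFinM lee_fin bE; case: ltP => xt; last first.
      by rewrite mulr0 mul0r mulr0 sqr_ge0.
    have -> : (expR (- (k * x.2)) * h x) ^+ 2 = a x.2 * h x * h x.
      rewrite exprMn -mulrA -expr2; congr (_ * _).
      by rewrite expr2 -expRD /a; congr expR; ring.
    by rewrite mulr1 mulrC ler_wpM2l ?mulr_ge0// ht.
have := curve_ext_ge (ltW k0) G2_ge0; apply: le_trans.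
rewrite EFinM -muleA lee_wpmul2l ?lee_fin ?sqr_ge0//.
apply: le_trans J_ge.
apply: (@le_trans _ _ ((h0 - eta)%:E * (A + (expR (- (k * t)) ^+ 2 * M)%:E)))%E.
  by rewrite lee_wpmul2l ?lee_fin// ltW.
have A0 : (0 <= A)%E by apply: integral_ge0 => X _; rewrite lee_fin mulr_ge0.
move: A_ge A0; case: (A) => [s| |//]; last by move=> _ _; rewrite [leRHS]gt0_muley ?lte_fin// leey.
rewrite !lee_fin => A_ge A0.
have := expR_gt0 (- (k * t)); move: A_ge kc; set E := expR _; rewrite /c ler_pdivlMr// => A_ge kc E0.
have : E * (E * (M * (h0 - eta) + 1)) <= E * (eta / 2 * m) by rewrite ler_wpM2l// ltW.
have sA : 0 <= s - E * m by rewrite subr_ge0.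
have := mulr_ge0 (ltW eta2) sA; have := sqr_ge0 E; lra.
Qed.

End lower_bound.

Local Close Scope complex_scope.

Transparent poisson.

(** * Divided differences of the slope and Taylor bounds for the curve *)

Lemma measurable_inv {R : realType} : measurable_fun [set: R] (@GRing.inv R).
Proof.
rewrite -(setUv [set (0 : R)]).
apply/measurable_funU; [exact: measurable_set1|by apply: measurableC; exact: measurable_set1|split].
  exact: measurable_fun_set1.
apply: open_continuous_measurable_fun; first by rewrite openC; exact: closed_eq.
by move=> x; rewrite inE => /eqP x0; exact: inv_continuous.
Qed.

Section divided_difference.
Context {R : realType}.
Variables g g1 g2 : R -> R.
Hypothesis dg : forall y : R, is_derive y 1 g (g1 y).
Hypothesis dg1 : forall y : R, is_derive y 1 g1 (g2 y).
Hypothesis cg2 : continuous g2.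

(** The value on the diagonal makes this continuous in both variables. It is what allows the
    derivative of the height along a ray to be divided by the radius, the centre included. *)
Definition divdiff (y z : R) : R := if z == y then g2 y else (g1 z - g1 y) / (z - y).

Lemma divdiffE y z : g1 z - g1 y = divdiff y z * (z - y).
Proof.
rewrite /divdiff; case: eqVneq => [->|zy]; first by rewrite !subrr mulr0.
by rewrite divfK// subr_eq0.
Qed.

Lemma continuous_curve : continuous g.
Proof. by move=> x; apply: differentiable_continuous; apply/derivable1_diffP. Qed.

Lemma continuous_curve1 : continuous g1.
Proof. by move=> x; apply: differentiable_continuous; apply/derivable1_diffP. Qed.

Lemma divdiff_mvt y z : exists2 c, `|c - y| <= `|z - y| & divdiff y z = g2 c.
Proof.
rewrite /divdiff; case: eqVneq => [->|]; first by exists y; rewrite ?subrr.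
rewrite neq_lt => /orP[zy|yz].
- have [c] := MVT zy (fun z _ => dg1 z) (continuous_subspaceT continuous_curve1).
  rewrite in_itv/= => /andP[zc cy] E; exists c.
    by rewrite !ltr0_norm ?subr_lt0// lerN2 lerB// ltW.
  by rewrite -[g1 z - _]opprB E -mulrN opprB mulfK// subr_eq0 lt_eqF.
- have [c] := MVT yz (fun z _ => dg1 z) (continuous_subspaceT continuous_curve1).
  rewrite in_itv/= => /andP[zc cy] E; exists c.
    by rewrite !gtr0_norm ?subr_gt0// lerB// ltW.
  by rewrite E mulfK// subr_eq0 gt_eqF.
Qed.

Lemma continuous_divdiff : continuous (fun x : R * R => divdiff x.1 x.2).
Proof.
move=> [y z]; have [zy|zy] := eqVneq z y; last first.
  have E : \forall x \near (y, z), (g1 x.2 - g1 x.1) / (x.2 - x.1) = divdiff x.1 x.2.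
    have o : open [set x : R * R | x.2 - x.1 != 0].
      apply: (@open_comp _ _ (fun x : R * R => x.2 - x.1) [set t | t != 0]); last exact: open_neq.
      by move=> x _; apply: cvgB; [exact: cvg_snd|exact: cvg_fst].
    apply: filterS (open_nbhs_nbhs (conj o (_ : [set x : R * R | x.2 - x.1 != 0] (y, z)))).
      by move=> x /=; rewrite subr_eq0 /divdiff => /negbTE ->.
    by rewrite /= subr_eq0.
  apply: cvg_trans (near_eq_cvg E) _; rewrite /divdiff /= (negbTE zy).
  have c1 : (x.1 @[x --> (y, z)]) --> y by exact: cvg_fst.
  have c2 : (x.2 @[x --> (y, z)]) --> z by exact: cvg_snd.
  apply: cvgM; first by apply: cvgB; apply: continuous_cvg => //; exact: continuous_curve1.
  by apply: cvgV; [rewrite subr_eq0|exact: cvgB].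
rewrite zy {z zy}; apply/cvgrPdist_lt => e e0.
have cy : \forall x \near y, `|g2 y - g2 x| < e.
  have cy : g2 x @[x --> y] --> g2 y by exact: cg2.
  have h := (@cvgrPdist_lt _ _ _ _ _ _ _).1 cy.
  exact: h e0.
case/nbhs_ballP: cy => d /= d0 hd.
(* The mean value point [c] is no farther from [u] than [w] is, so [|y - c| <= |y - u| + |w - u|],
   which is less than three times [d / 3]. *)
have d2 : 0 < d / 3 by rewrite divr_gt0.
exists (ball y (d / 3), ball y (d / 3)) => /= [|[u w] [/=]].
  by split; exact: nbhsx_ballx.
rewrite /ball/= => yu yw; rewrite {1}/divdiff eqxx.
have [c cu ->] := divdiff_mvt u w; apply: hd; rewrite /ball/=.
have := ler_distD u y c; have := ler_distD y w u; move: cu yu yw.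
rewrite (distrC c u) (distrC w y); lra.
Qed.

Lemma measurable_divdiff d (T : measurableType d) (a b : T -> R) :
  measurable_fun setT a -> measurable_fun setT b ->
  measurable_fun setT (fun t => divdiff (a t) (b t)).
Proof.
move=> ma mb; rewrite /divdiff.
have mg1 : measurable_fun setT g1 by apply: continuous_measurable_fun; exact: continuous_curve1.
apply: measurable_fun_ifT.
- exact: measurable_fun_eqr.
- by apply: (measurableT_comp (continuous_measurable_fun cg2)).
- apply: measurable_funM.
    by apply: measurable_funB; exact: (measurableT_comp mg1).
  by apply: (measurableT_comp measurable_inv); exact: measurable_funB.
Qed.

Lemma divdiff_lo lo y z : (forall y, lo <= g2 y) -> lo <= divdiff y z.
Proof. by move=> lo_le; have [c _ ->] := divdiff_mvt y z. Qed.

Lemma divdiff_hi hi y z : (forall y, g2 y <= hi) -> divdiff y z <= hi.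
Proof. by move=> le_hi; have [c _ ->] := divdiff_mvt y z. Qed.

(** The function [F] below has derivative [(divdiff - lo) * (t - y)], which changes sign at [y], so
    [F] has its minimum there. *)
Lemma taylor_lo (lo y z : R) : (forall y, lo <= g2 y) ->
  lo / 2 * (z - y) ^+ 2 <= g z - g y - g1 y * (z - y).
Proof.
move=> lo_le; pose F t := g t - g1 y * t - lo / 2 * (t - y) ^+ 2.
have dF (t : R) : is_derive t 1 F ((divdiff y t - lo) * (t - y)).
  apply: is_derive_eq; have := divdiffE y t; rewrite /GRing.scale/=; lra.
have cF : continuous F.
  by move=> x; apply: differentiable_continuous; apply/derivable1_diffP.
have : F y <= F z.
  have dl t := divdiff_lo y t lo_le.
  rewrite -subr_ge0; have [zy|yz|->] := ltgtP z y; last by rewrite subrr.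
  - have [c] := MVT zy (fun z _ => dF z) (continuous_subspaceT cF).
    rewrite in_itv/= => /andP[zc cy] E; rewrite -[F z - _]opprB oppr_ge0 E.
    apply: mulr_le0_ge0; last by rewrite subr_ge0 ltW.
    by apply: mulr_ge0_le0; [rewrite subr_ge0 dl|rewrite subr_le0 ltW].
  - have [c] := MVT yz (fun z _ => dF z) (continuous_subspaceT cF).
    rewrite in_itv/= => /andP[zc cy] ->; apply: mulr_ge0; last by rewrite subr_ge0 ltW.
    by apply: mulr_ge0; rewrite subr_ge0 ?dl// ltW.
rewrite /F; lra.
Qed.

End divided_difference.

Lemma taylor_hi {R : realType} (g g1 g2 : R -> R) (hi y z : R) :
  (forall y : R, is_derive y 1 g (g1 y)) -> (forall y : R, is_derive y 1 g1 (g2 y)) ->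
  (forall y, g2 y <= hi) ->
  g z - g y - g1 y * (z - y) <= hi / 2 * (z - y) ^+ 2.
Proof.
move=> dg dg1 le_hi.
have := @taylor_lo _ (- g) (- g1) (- g2) (fun y => is_deriveN (dg y)) (fun y => is_deriveN (dg1 y)) (- hi) y z.
rewrite (_ : (- g) z = - g z)// (_ : (- g) y = - g y)// (_ : (- g1) y = - g1 y)//.
have h u : - hi <= (- g2) u by rewrite [leRHS](_ : _ = - g2 u)// lerN2.
by move=> /(_ h); lra.
Qed.

(** * The height along the rays of a fibre, and its inverse *)

Section ray.
Context {R : realType}.
Variables (g g1 g2 : R -> R) (lo hi : R).
Hypothesis dg : forall y : R, is_derive y 1 g (g1 y).
Hypothesis dg1 : forall y : R, is_derive y 1 g1 (g2 y).
Hypothesis cg2 : continuous g2.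
Hypothesis lo_gt0 : 0 < lo.
Hypothesis lo_le : forall y, lo <= g2 y.
Hypothesis le_hi : forall y, g2 y <= hi.

(** The squared Euclidean length of the direction [(v, w, - (v + w))] in the plane of triples of sum
    zero. *)
Definition dirsq (v w : R) : R := v ^+ 2 + w ^+ 2 + (v + w) ^+ 2.

(** The total height of the triple at radius [p] on the ray that leaves the diagonal point
    [(eta, eta, eta)]; the sum of the triple stays [3 * eta] along the ray. *)
Definition ray (eta v w p : R) : R :=
  g (eta + p * v) + (g (eta + p * w) + g (eta - p * (v + w))).

(** The derivative of [ray] divided by [p]. The terms in [g1 eta] cancel because the direction has
    sum zero, and what remains is pinched between [lo * dirsq] and [hi * dirsq], also at the
    centre. *)
Definition slope (eta v w p : R) : R :=
  v ^+ 2 * divdiff g1 g2 eta (eta + p * v) + w ^+ 2 * divdiff g1 g2 eta (eta + p * w) +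
  (v + w) ^+ 2 * divdiff g1 g2 eta (eta - p * (v + w)).

Lemma slope_lo eta v w p : lo * dirsq v w <= slope eta v w p.
Proof.
rewrite /slope /dirsq !mulrDr; do !apply: lerD; rewrite mulrC ler_wpM2l ?sqr_ge0//;
  exact: (divdiff_lo dg1).
Qed.

Lemma slope_hi eta v w p : slope eta v w p <= hi * dirsq v w.
Proof.
rewrite /slope /dirsq !mulrDr; do !apply: lerD; rewrite [leRHS]mulrC ler_wpM2l ?sqr_ge0//;
  exact: (divdiff_hi dg1).
Qed.

Lemma is_derive_ray (eta v w p : R) : is_derive p 1 (ray eta v w) (p * slope eta v w p).
Proof.
have D u : is_derive p 1 (fun p => g (eta + p * u)) (g1 (eta + p * u) * u).
  apply: is_derive1_comp; apply: is_derive_eq; rewrite /GRing.scale/=; ring.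
have E : ray eta v w = (fun p => g (eta + p * v)) + ((fun p => g (eta + p * w)) +
    (fun p => g (eta + p * - (v + w)))).
  by apply/funext => q; rewrite /ray/= -mulrN.
rewrite E; apply: (is_derive_eq (is_deriveD (D v) (is_deriveD (D w) (D (- (v + w)))))).
rewrite /slope -mulrN.
have := divdiffE g1 g2 eta (eta + p * v).
have := divdiffE g1 g2 eta (eta + p * w).
have := divdiffE g1 g2 eta (eta + p * - (v + w)).
set a := divdiff _ _ _ _; set b := divdiff _ _ _ _; set c := divdiff _ _ _ _.
move=> h1 h2 h3.
have e1 : g1 (eta + p * v) = g1 eta + c * (p * v).
  by have := h3; rewrite (_ : eta + p * v - eta = p * v); [move=> <-; ring|ring].
have e2 : g1 (eta + p * w) = g1 eta + b * (p * w).
  by have := h2; rewrite (_ : eta + p * w - eta = p * w); [move=> <-; ring|ring].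
have e3 : g1 (eta + p * - (v + w)) = g1 eta + a * (p * - (v + w)).
  by have := h1; rewrite (_ : eta + p * - (v + w) - eta = p * - (v + w)); [move=> <-; ring|ring].
rewrite e1 e2 e3; ring.
Qed.

Lemma ray0 eta v w : ray eta v w 0 = 3 * g eta.
Proof. by rewrite /ray !mul0r subr0 addr0; ring. Qed.

Lemma ray_lo eta v w p : lo / 2 * dirsq v w * p ^+ 2 <= ray eta v w p - 3 * g eta.
Proof.
have := taylor_lo dg dg1 eta (eta + p * v) lo_le.
have := taylor_lo dg dg1 eta (eta + p * w) lo_le.
have := taylor_lo dg dg1 eta (eta - p * (v + w)) lo_le.
rewrite /ray /dirsq; set a := g (_ - _); set b := g _; set c := g (_ + p * v).
rewrite !(addrC eta) !addrK; lra.
Qed.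

Lemma ray_hi eta v w p : ray eta v w p - 3 * g eta <= hi / 2 * dirsq v w * p ^+ 2.
Proof.
have := taylor_hi eta (eta + p * v) dg dg1 le_hi.
have := taylor_hi eta (eta + p * w) dg dg1 le_hi.
have := taylor_hi eta (eta - p * (v + w)) dg dg1 le_hi.
rewrite /ray /dirsq; set a := g (_ - _); set b := g _; set c := g (_ + p * v).
rewrite !(addrC eta) !addrK; lra.
Qed.

Lemma continuous_ray eta v w : continuous (ray eta v w).
Proof.
by move=> x; apply: differentiable_continuous; apply/derivable1_diffP; case: (is_derive_ray eta v w x).
Qed.

Section direction.
Variables v w : R.
Hypothesis vw : 0 < dirsq v w.

Lemma slope_gt0 eta p : 0 < slope eta v w p.
Proof. exact: lt_le_trans (mulr_gt0 lo_gt0 vw) (slope_lo _ _ _ _). Qed.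

Lemma ray_lt eta x y : 0 <= x -> 0 <= y -> (ray eta v w x < ray eta v w y) = (x < y).
Proof.
have lt a b : 0 <= a -> a < b -> ray eta v w a < ray eta v w b.
  move=> a0 ab; rewrite -subr_gt0.
  have [z] := MVT ab (fun z _ => is_derive_ray eta v w z) (continuous_subspaceT (@continuous_ray eta v w)).
  rewrite in_itv/= => /andP[az _] ->; rewrite mulr_gt0 ?subr_gt0//.
  by rewrite mulr_gt0 ?slope_gt0// (le_lt_trans a0).
move=> x0 y0; apply/idP/idP => [|xy]; last exact: lt.
by apply: contraTT; rewrite -!leNgt le_eqVlt => /predU1P[->//|/(lt _ _ y0)/ltW].
Qed.

(** The radius at which the ray reaches height [t]. Heights below the minimum [3 * g eta] are
    clipped to it, so that a solution exists for every [t] and the function is continuous on the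
    whole plane. *)
Definition rayinv (eta t : R) : R :=
  xget 0 [set p | 0 <= p /\ ray eta v w p = Num.max t (3 * g eta)].

Lemma rayinvP eta t :
  0 <= rayinv eta t /\ ray eta v w (rayinv eta t) = Num.max t (3 * g eta).
Proof.
have : 3 * g eta <= Num.max t (3 * g eta) by rewrite le_max lexx orbT.
rewrite /rayinv; move: (Num.max _ _) => s s3.
apply: (@xgetPex _ 0 [set p | 0 <= p /\ ray eta v w p = s]).
(* Since [(1 + q) ^+ 2 >= q], the quadratic lower bound on the ray has passed [s] at radius [b]. *)
pose b := 1 + (s - 3 * g eta) / (lo / 2 * dirsq v w).
have k0 : 0 < lo / 2 * dirsq v w by rewrite !mulr_gt0.
have s0 : 0 <= (s - 3 * g eta) / (lo / 2 * dirsq v w) by rewrite divr_ge0 ?subr_ge0 ?(ltW k0).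
have b0 : 0 <= b by rewrite addr_ge0.
have sb : s <= ray eta v w b.
  have := ray_lo eta v w b.
  have : s - 3 * g eta <= lo / 2 * dirsq v w * b ^+ 2.
    rewrite [leRHS]mulrC -ler_pdivrMr// /b; move: s0; set q := _ / _ => s0; have := sqr_ge0 q; lra.
  lra.
have [|c] := @IVT _ (ray eta v w) 0 b s b0 (continuous_subspaceT (@continuous_ray eta v w)).
  by rewrite ge_min le_max ray0 s3 sb orbT.
by rewrite in_itv/= => /andP[c0 _] cs; exists c.
Qed.

Lemma rayinv_ge0 eta t : 0 <= rayinv eta t.
Proof. by case: (rayinvP eta t). Qed.

Lemma rayinvK eta t : 3 * g eta <= t -> ray eta v w (rayinv eta t) = t.
Proof. by move=> gt; have [_ ->] := rayinvP eta t; exact/max_idPl. Qed.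

Lemma rayK eta p : 0 <= p -> rayinv eta (ray eta v w p) = p.
Proof.
move=> p0; have q0 := rayinv_ge0 eta (ray eta v w p).
have : ray eta v w (rayinv eta (ray eta v w p)) = ray eta v w p.
  apply: rayinvK; rewrite -subr_ge0; apply: le_trans (ray_lo _ _ _ _).
  by rewrite !mulr_ge0 ?sqr_ge0 ?(ltW vw) ?(ltW lo_gt0).
move: q0; set q := rayinv _ _ => q0 E.
have [qp|pq|//] := ltgtP q p.
- by move: qp; rewrite -(ray_lt eta q0 p0) E ltxx.
- by move: pq; rewrite -(ray_lt eta p0 q0) E ltxx.
Qed.

Lemma rayinv_lt eta t c : 0 <= c ->
  (rayinv eta t < c) = (Num.max t (3 * g eta) < ray eta v w c).
Proof. by move=> c0; have [p0 <-] := rayinvP eta t; rewrite ray_lt. Qed.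

Lemma rayinv_gt eta t c : 0 <= c ->
  (c < rayinv eta t) = (ray eta v w c < Num.max t (3 * g eta)).
Proof. by move=> c0; have [p0 <-] := rayinvP eta t; rewrite ray_lt. Qed.

Lemma rayinv_bounds eta t : 3 * g eta <= t ->
  lo / 2 * dirsq v w * rayinv eta t ^+ 2 <= t - 3 * g eta <= hi / 2 * dirsq v w * rayinv eta t ^+ 2.
Proof.
move=> gt; have := ray_lo eta v w (rayinv eta t); have := ray_hi eta v w (rayinv eta t).
by rewrite rayinvK// => -> ->.
Qed.

(** By monotonicity [rayinv < c] and [c < rayinv] are comparisons between [ray] at the fixed radius
    [c] and the clipped height, both continuous in the parameters; the implicit function theorem,
    which fails at radius 0, is avoided. Measurability in [measurable_rayinv] is obtained in the
    same way. *)
Lemma continuous_rayinv : continuous (fun x : R * R => rayinv x.1 x.2).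
Proof.
have cg := continuous_curve dg.
have cm : continuous (fun x : R * R => Num.max x.2 (3 * g x.1)).
  move=> x; apply: continuous_max; first exact: cvg_snd.
  by apply: cvgM; [exact: cvg_cst|apply: continuous_comp; [exact: cvg_fst|exact: cg]].
have cr c : continuous (fun x : R * R => ray x.1 v w c).
  move=> x; rewrite /ray.
  have ce u : (g (y.1 + u) @[y --> x]) --> g (x.1 + u).
    apply: (@continuous_comp _ _ _ (fun y : R * R => y.1 + u) g); last exact: cg.
    by apply: cvgD; [exact: cvg_fst|exact: cvg_cst].
  by apply: cvgD => //; apply: cvgD.
have near_lt (f f' : R * R -> R) x : continuous f -> continuous f' -> f x < f' x ->
    \forall y \near x, f y < f' y.
  move=> cf cf' ff'.
  have c : (f' y - f y) @[y --> x] --> f' x - f x by apply: cvgB; [exact: cf'|exact: cf].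
  have fl : 0 < f' x - f x by rewrite subr_gt0.
  by apply: filterS (@cvgr_gt _ _ _ _ _ _ c _ fl) => y; rewrite subr_gt0.
move=> x; apply/cvgrPdist_lt => e e0.
have p0 := rayinv_ge0 x.1 x.2.
have up : \forall y \near x, rayinv y.1 y.2 < rayinv x.1 x.2 + e.
  have pe : 0 <= rayinv x.1 x.2 + e by rewrite addr_ge0// ltW.
  have : Num.max x.2 (3 * g x.1) < ray x.1 v w (rayinv x.1 x.2 + e).
    by rewrite -rayinv_lt// ltrDl.
  move=> /(near_lt _ _ _ cm (cr _)); apply: filterS => y; by rewrite rayinv_lt.
have down : \forall y \near x, rayinv x.1 x.2 - e < rayinv y.1 y.2.
  have [pe|pe] := ltP (rayinv x.1 x.2 - e) 0.
    by near=> y; exact: lt_le_trans pe (rayinv_ge0 _ _).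
  have : ray x.1 v w (rayinv x.1 x.2 - e) < Num.max x.2 (3 * g x.1).
    by rewrite -rayinv_gt// ltrBlDr ltrDl.
  move=> /(near_lt _ _ _ (cr _) cm); apply: filterS => y; by rewrite rayinv_gt.
near=> y; rewrite ltr_norml ltrBrDl ltrBlDl.
have h1 : rayinv y.1 y.2 < rayinv x.1 x.2 + e by near: y.
have h2 : rayinv x.1 x.2 - e < rayinv y.1 y.2 by near: y.
by apply/andP; split; lra.
Unshelve. all: by end_near.
Qed.

End direction.

Lemma measurable_ray d (T : measurableType d) (eta v w p : T -> R) :
  measurable_fun setT eta -> measurable_fun setT v -> measurable_fun setT w ->
  measurable_fun setT p -> measurable_fun setT (fun x => ray (eta x) (v x) (w x) (p x)).
Proof.
move=> m1 m2 m3 m4.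
have mg : measurable_fun [set: R] g by apply: continuous_measurable_fun; exact: (continuous_curve dg).
rewrite /ray; apply: measurable_funD.
  by apply: (measurableT_comp mg); apply: measurable_funD => //; exact: measurable_funM.
apply: measurable_funD.
  by apply: (measurableT_comp mg); apply: measurable_funD => //; exact: measurable_funM.
apply: (measurableT_comp mg); apply: measurable_funB => //; apply: measurable_funM => //.
exact: measurable_funD.
Qed.

Lemma measurable_slope d (T : measurableType d) (eta v w p : T -> R) :
  measurable_fun setT eta -> measurable_fun setT v -> measurable_fun setT w ->
  measurable_fun setT p -> measurable_fun setT (fun x => slope (eta x) (v x) (w x) (p x)).
Proof.
move=> m1 m2 m3 m4; have mvw := measurable_funD m2 m3.
rewrite /slope; apply: measurable_funD; first apply: measurable_funD.
- apply: measurable_funM; first exact: measurable_funX.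
  by apply: (measurable_divdiff dg1 cg2) => //; apply: measurable_funD => //; exact: measurable_funM.
- apply: measurable_funM; first exact: measurable_funX.
  by apply: (measurable_divdiff dg1 cg2) => //; apply: measurable_funD => //; exact: measurable_funM.
- apply: measurable_funM; first exact: measurable_funX.
  by apply: (measurable_divdiff dg1 cg2) => //; apply: measurable_funB => //; exact: measurable_funM.
Qed.

Lemma measurable_rayinv d (T : measurableType d) (eta v w t : T -> R) :
  (forall x, 0 < dirsq (v x) (w x)) ->
  measurable_fun setT eta -> measurable_fun setT v -> measurable_fun setT w ->
  measurable_fun setT t -> measurable_fun setT (fun x => rayinv (v x) (w x) (eta x) (t x)).
Proof.
move=> vw m1 m2 m3 m4.
have mg : measurable_fun [set: R] g by apply: continuous_measurable_fun; exact: (continuous_curve dg).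
have mm : measurable_fun setT (fun x => Num.max (t x) (3 * g (eta x))).
  by apply: measurable_maxr => //; apply: measurable_funM => //; exact: (measurableT_comp mg).
apply: (measurability (@RGenInftyO.G R)) => [|/= _ [_] [c] -> <-].
  exact: RGenInftyO.measurableE.
rewrite setTI; have [c0|c0] := leP 0 c; last first.
  rewrite (_ : _ @^-1` _ = set0)//; apply/seteqP; split => x //=.
  rewrite in_itv/= => xc; have := rayinv_ge0 (vw x) (eta x) (t x).
  by rewrite leNgt (lt_trans xc).
rewrite (_ : _ @^-1` _ = [set x | Num.max (t x) (3 * g (eta x)) < ray (eta x) (v x) (w x) c]); last first.
  by apply/seteqP; split => x /=; rewrite in_itv/= rayinv_lt.
rewrite -[X in measurable X]setTI; apply: measurable_fun_ltr => //.
exact: measurable_ray.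
Qed.

End ray.

Lemma measurable_fun_fst d d1 d2 (T : measurableType d) (T1 : measurableType d1)
    (T2 : measurableType d2) (f : T -> T1 * T2) :
  measurable_fun setT f -> measurable_fun setT (fun x => (f x).1).
Proof. by move=> mf; exact: (measurableT_comp (@measurable_fst _ _ _ _) mf). Qed.

Lemma measurable_fun_snd d d1 d2 (T : measurableType d) (T1 : measurableType d1)
    (T2 : measurableType d2) (f : T -> T1 * T2) :
  measurable_fun setT f -> measurable_fun setT (fun x => (f x).2).
Proof. by move=> mf; exact: (measurableT_comp (@measurable_snd _ _ _ _) mf). Qed.

Lemma measurable_fun_opp d (T : measurableType d) (R : realType) (f : T -> R) :
  measurable_fun setT f -> measurable_fun setT (fun x => - f x).
Proof. by move=> mf; apply: measurableT_comp. Qed.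

Ltac measurability_of_map :=
  repeat first [exact: measurable_id | exact: measurable_cst | assumption
    | apply: measurable_fun_pair | apply: measurable_funD | apply: measurable_fun_opp
    | apply: measurable_funM | apply: measurable_fun_fst | apply: measurable_fun_snd].

(** * Lebesgue measure on triples in centre and ray coordinates *)

Section triple_integral.
Context {R : realType}.
Local Notation M := (measurableTypeR R).
Local Notation leb := (@lebesgue_measure R).

(** With [xi] the sum of the three variables and deviations measured from [xi / 3], each step is a
    shift of a single variable, so the Jacobian is 1. *)
Lemma ge0_integral_sum_coordinates (H : M * (M * M) -> \bar R) :
  measurable_fun setT H -> (forall X, 0 <= H X)%E ->
  (\int[leb]_y1 \int[leb]_y2 \int[leb]_y3 H (y1, (y2, y3)) =
   \int[leb]_xi \int[leb]_p \int[leb]_q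
     H ((xi / 3 + p)%R, ((xi / 3 + q)%R, (xi / 3 - (p + q))%R)))%E.
Proof.
move=> mH H0.
pose H1 (Y : M * (M * M)) := H (Y.1, (Y.2.1, Y.2.2 - (Y.1 + Y.2.1))).
have mH1 : measurable_fun setT H1 by apply: (measurableT_comp mH); measurability_of_map.
have H10 Y : (0 <= H1 Y)%E by exact: H0.
transitivity (\int[leb]_y1 \int[leb]_y2 \int[leb]_xi H1 (y1, (y2, xi)))%E.
  apply: eq_integral => y1 _; apply: eq_integral => y2 _.
  rewrite -(ge0_integral_lebesgue_shift (f := fun y => H (y1, (y2, y))) (- (y1 + y2)))//.
  by apply: (measurableT_comp mH); measurability_of_map.
transitivity (\int[leb]_y1 \int[leb]_xi \int[leb]_y2 H1 (y1, (y2, xi)))%E.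
  apply: eq_integral => y1 _.
  rewrite (fubini_tonelli (fun z => H1 (y1, (z.1, z.2))))//.
  by apply: (measurableT_comp mH1); measurability_of_map.
pose H2 (z : M * M) := (\int[leb]_y2 H1 (z.1, (y2, z.2)))%E.
have mH2 : measurable_fun setT H2.
  apply: (measurable_fun_fubini_tonelli_F (fun Z : (M * M) * M => H1 (Z.1.1, (Z.2, Z.1.2)))) => //.
  by apply: (measurableT_comp mH1); measurability_of_map.
have H20 z : (0 <= H2 z)%E by exact: integral_ge0.
transitivity (\int[leb]_xi \int[leb]_y1 H2 (y1, xi))%E; first exact: (fubini_tonelli H2 mH2 H20).
apply: eq_integral => xi _.
rewrite -(ge0_integral_lebesgue_shift (f := fun y => H2 (y, xi)) (xi / 3)); last 2 first.
- by apply: (measurableT_comp mH2); measurability_of_map.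
- by move=> y; exact: H20.
apply: eq_integral => p _; rewrite /H2/=.
rewrite -(ge0_integral_lebesgue_shift (f := fun y => H1 (p + xi / 3, (y, xi))) (xi / 3))//; last first.
  by apply: (measurableT_comp mH1); measurability_of_map.
apply: eq_integral => q _; rewrite /H1/=; congr (H (_, (_, _))).
- by rewrite addrC.
- by rewrite addrC.
- by field.
Qed.

(** The slope [m] takes the place of the polar angle: [q = p * m] has Jacobian [p]. The half-plane
    [p < 0] is reflected, so that two opposite rays appear under the same [m]; the estimate of the
    density depends on this pairing. *)
Lemma ge0_integral_plane_rays (K : M * M -> \bar R) :
  measurable_fun setT K -> (forall X, 0 <= K X)%E ->
  (\int[leb]_p \int[leb]_q K (p, q) =
   \int[leb]_m \int[leb]_(p in `]0%R, +oo[)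
     ((p%:E * K (p, p * m)%R) + (p%:E * K (- p, - (p * m))%R)))%E.
Proof.
move=> mK K0.
pose F p := (\int[leb]_q K (p, q))%E.
have mF : measurable_fun [set: R] F.
  by apply: (measurable_fun_fubini_tonelli_F (fun z : M * M => K (z.1, z.2))) => //; apply: (measurableT_comp mK); measurability_of_map.
have F0 p : (0 <= F p)%E by exact: integral_ge0.
have half (G : R -> \bar R) : measurable_fun [set: R] G -> (forall x, (0 <= G x)%E) ->
    (\int[leb]_p G p = \int[leb]_(p in `]0%R, +oo[) (G p + G (- p)%R))%E.
  move=> mG G0.
  have mGN : measurable_fun [set: R] (fun x => G (- x)).
    by apply: (measurableT_comp mG); measurability_of_map.
  pose A : set R := `]0, +oo[%classic.
  have mA : measurable (A : set M) by exact: measurable_itv.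
  rewrite -(setUv A) ge0_integral_setU//=; last 3 first.
  - exact: measurableC.
  - exact: measurable_funTS.
  - exact/disj_setPCl.
  rewrite ge0_integralD//; last 2 first.
  - exact: measurable_funTS.
  - exact: measurable_funTS.
  congr (_ + _)%E; rewrite [RHS]integral_itv_obnd_cbnd; last exact: measurable_funTS.
  have mC : measurable_fun [set: R] (G \_ (~` A)).
    by apply/(measurable_restrictT _ _).1; [exact: measurableC|exact: measurable_funTS].
  rewrite [LHS]integral_mkcond [RHS]integral_mkcond -(ge0_integral_lebesgue_opp mC); last first.
    by move=> x; rewrite patchE; case: ifP.
  apply: eq_integral => x _; rewrite !patchE.
  have -> : (- x \in ~` A) = (x \in (`[0, +oo[%classic : set R)).
    apply/idP/idP; rewrite !inE/= /A/= !in_itv/= !andbT oppr_gt0.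
      by move/negP; rewrite -leNgt.
    by move=> x0; apply/negP; rewrite -leNgt.
  by [].
transitivity (\int[leb]_(p in `]0%R, +oo[) (F p + F (- p)%R))%E; first exact: half.
pose f (z : M * M) := (z.1%:E * K (z.1, z.1 * z.2)%R + z.1%:E * K (- z.1, - (z.1 * z.2))%R)%E.
have mf : measurable_fun setT f.
  have m1 : measurable_fun setT (fun z : M * M => (z.1 : R)%:E).
    by apply/measurable_EFinP; exact: measurable_fst.
  apply: emeasurable_funD; apply: emeasurable_funM => //; apply: (measurableT_comp mK); measurability_of_map.
pose D : set (M * M) := fst @^-1` (`]0, +oo[%classic : set R).
have mD : measurable D by rewrite -[D]setTI; apply: measurable_fst => //; exact: measurable_itv.
have mL : measurable_fun setT (f \_ D).
  by apply/(measurable_restrictT _ _).1 => //; exact: measurable_funTS.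
have inD p m : ((p, m) \in D) = (p \in (`]0, +oo[%classic : set R)) by apply/idP/idP; rewrite !inE.
have L0 z : (0 <= (f \_ D) z)%E.
  case: z => p m; rewrite patchE inD; case: ifP => //; rewrite inE/= in_itv/= andbT => p0.
  by rewrite /f/= adde_ge0// mule_ge0// lee_fin ltW.
transitivity (\int[leb]_p \int[leb]_m (f \_ D) (p, m))%E.
  rewrite [LHS]integral_mkcond; apply: eq_integral => p _; rewrite patchE.
  have [pA|pA] := boolP (p \in _); last first.
    by apply/esym/integral0_eq => m _; rewrite patchE inD (negbTE pA).
  have p0 : 0 < p by move: pA; rewrite inE/= in_itv/= andbT.
  have p0' : (0 <= p%:E)%E by rewrite lee_fin ltW.
  have mKp (u : R) : measurable_fun [set: R] (fun q => K (u, q)).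
    by apply: (measurableT_comp mK); measurability_of_map.
  have mKN (u : R) : measurable_fun [set: R] (fun q => K (u, - q)).
    by apply: (measurableT_comp mK); measurability_of_map.
  transitivity (\int[leb]_m (p%:E * K (p, p * m)%R + p%:E * K (- p, - (p * m))%R))%E; last first.
    by apply: eq_integral => m _; rewrite patchE inD pA.
  have mKs (u : R) : measurable_fun [set: R] (fun q => K (u, p * q)).
    by apply: (measurableT_comp mK); measurability_of_map.
  have mKNs (u : R) : measurable_fun [set: R] (fun q => K (u, - (p * q))).
    by apply: (measurableT_comp mK); measurability_of_map.
  rewrite ge0_integralD//; last 4 first.
  - by move=> m _; rewrite mule_ge0.
  - by apply: emeasurable_funM; [exact: measurable_cst|exact: mKs].
  - by move=> m _; rewrite mule_ge0.
  - by apply: emeasurable_funM; [exact: measurable_cst|exact: mKNs].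
  congr (_ + _)%E; first by rewrite (ge0_integral_lebesgue_scale (f := fun q => K (p, q)) p0).
  rewrite /F -(ge0_integral_lebesgue_opp (f := fun q => K (- p, q)))//.
  by rewrite (ge0_integral_lebesgue_scale (f := fun q => K (- p, - q)) p0).
transitivity (\int[leb]_m \int[leb]_p (f \_ D) (p, m))%E; first exact: (fubini_tonelli _ mL L0).
apply: eq_integral => m _; rewrite [RHS]integral_mkcond; apply: eq_integral => p _.
by rewrite !patchE inD.
Qed.

End triple_integral.

(** * The density of the triple convolution as an integral over slopes *)

Section density.
Context {R : realType}.
Local Notation M := (measurableTypeR R).
Local Notation leb := (@lebesgue_measure R).
Variables (g g1 g2 : R -> R) (lo hi : R).
Hypothesis dg : forall y : R, is_derive y 1 g (g1 y).
Hypothesis dg1 : forall y : R, is_derive y 1 g1 (g2 y).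
Hypothesis cg2 : continuous g2.
Hypothesis lo_gt0 : 0 < lo.
Hypothesis lo_le : forall y, lo <= g2 y.
Hypothesis le_hi : forall y, g2 y <= hi.
Variables (W : R -> R) (C r : R).
Hypothesis mW : measurable_fun [set: R] W.
Hypothesis W_ge0 : forall y, 0 <= W y.
Hypothesis W_le : forall y, W y <= C.
Hypothesis W_off : forall y, r <= `|y| -> W y = 0.

Definition weight3 (eta v w p : R) : R :=
  W (eta + p * v) * (W (eta + p * w) * W (eta - p * (v + w))).

(** Along a ray the substitution [t = ray p] has Jacobian [p * slope], and its factor [p] cancels
    the one from polar coordinates. Nothing blows up where the ray starts. *)
Definition ray_density (v w : R) (x : R * R) : R :=
  let p := rayinv g v w (x.1 / 3) x.2 in
  weight3 (x.1 / 3) v w p / slope g1 g2 (x.1 / 3) v w p.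

Definition ray_density2 (x : R * R) (m : R) : R :=
  ray_density 1 m x + ray_density (- 1) (- m) x.

(** The test on the height cannot be left to the integrand: below the boundary [rayinv] is 0 and
    [ray_density2] keeps its boundary value. *)
Definition conv3 (x : R * R) : R :=
  if (`|x.1| < 3 * r) && (3 * g (x.1 / 3) <= x.2)
  then \int[leb]_m ray_density2 x m else 0.

Lemma integrable_poisson (e : R) : 0 < e -> leb.-integrable setT (EFin \o poisson e).
Proof.
move=> e0; apply/integrableP; split.
  by apply/measurable_EFinP; exact: measurable_poisson.
under eq_integral => z _ do rewrite /= ger0_norm ?poisson_ge0//.
by rewrite integral_poisson// ltry.
Qed.

Lemma dirsq1 (m : R) : 1 + m ^+ 2 <= dirsq 1 m.
Proof. by rewrite /dirsq expr1n lerDl sqr_ge0. Qed.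

Lemma dirsqN (v w : R) : dirsq (- v) (- w) = dirsq v w.
Proof. by rewrite /dirsq -opprD !sqrrN. Qed.

Lemma dirsq1_gt0 (m : R) : 0 < dirsq 1 m.
Proof. by apply: lt_le_trans (dirsq1 m); rewrite ltr_wpDr ?sqr_ge0. Qed.

Let vwN (m : R) : 0 < dirsq (- 1) (- m).
Proof. by rewrite dirsqN dirsq1_gt0. Qed.

Let C_ge0 : 0 <= C.
Proof. exact: le_trans (W_ge0 0) (W_le 0). Qed.

Lemma weight3_ge0 eta v w p : 0 <= weight3 eta v w p.
Proof. exact: mulr_ge0 (W_ge0 _) (mulr_ge0 (W_ge0 _) (W_ge0 _)). Qed.

Lemma weight3_le eta v w p : weight3 eta v w p <= C ^+ 3.
Proof.
rewrite !exprS expr0 mulr1; apply: ler_pM => //; first exact: mulr_ge0.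
exact: ler_pM.
Qed.

(** The three points have mean [eta], so one of them is at least as far from 0 as [eta]. *)
Lemma weight3_off eta v w p : r <= `|eta| -> weight3 eta v w p = 0.
Proof.
move=> re; suff : [|| r <= `|eta + p * v|, r <= `|eta + p * w| | r <= `|eta - p * (v + w)|].
  by rewrite /weight3 => /or3P[] /W_off ->; rewrite ?(mul0r, mulr0).
apply/negPn; rewrite !negb_or -!ltNge; apply/negP => /and3P[h1 h2 h3].
have E : eta + p * v + (eta + p * w) + (eta - p * (v + w)) = 3 * eta by ring.
have := ler_normD (eta + p * v + (eta + p * w)) (eta - p * (v + w)).
have := ler_normD (eta + p * v) (eta + p * w).
rewrite E normrM (@ger0_norm _ 3)//; lra.
Qed.

Lemma ray_density_ge0 v w x : 0 < dirsq v w -> 0 <= ray_density v w x.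
Proof.
move=> vw; rewrite /ray_density divr_ge0 ?weight3_ge0// ltW//.
exact: (slope_gt0 dg1 lo_gt0 lo_le vw).
Qed.

Lemma ray_density_le v w x : 0 < dirsq v w -> ray_density v w x <= C ^+ 3 / (lo * dirsq v w).
Proof.
move=> vw; have s0 := slope_gt0 dg1 lo_gt0 lo_le vw.
apply: ler_pM; rewrite ?weight3_ge0 ?weight3_le ?invr_ge0//; first exact/ltW/s0.
by rewrite lef_pV2 ?posrE ?mulr_gt0// (slope_lo dg1 lo_le).
Qed.

Lemma ray_density2_ge0 x m : 0 <= ray_density2 x m.
Proof. by apply: addr_ge0; apply: ray_density_ge0; [exact: dirsq1_gt0|exact: vwN]. Qed.

(** An integrable majorant in the slope that is uniform in [x]. Each of the two opposite rays
    contributes at most half of [poisson 1 m = 2 / (1 + m ^+ 2)], up to the constant. *)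
Lemma ray_density2_le x m : ray_density2 x m <= C ^+ 3 / lo * poisson 1 m.
Proof.
have h1 := ray_density_le x (dirsq1_gt0 m); have := ray_density_le x (vwN m).
rewrite dirsqN => h2; apply: (le_trans (lerD h1 h2)).
have C3 : 0 <= C ^+ 3 / lo by rewrite divr_ge0 ?exprn_ge0// ltW.
have -> : C ^+ 3 / (lo * dirsq 1 m) = C ^+ 3 / lo * (dirsq 1 m)^-1 by rewrite invfM mulrA.
rewrite -mulrDr; apply: ler_wpM2l => //.
have m1 : 0 < 1 + m ^+ 2 :> R by rewrite ltr_wpDr ?sqr_ge0.
have : (dirsq 1 m)^-1 <= (1 + m ^+ 2)^-1 by rewrite lef_pV2 ?posrE ?dirsq1_gt0// dirsq1.
rewrite /poisson expr1n; lra.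
Qed.

Lemma measurable_ray_density d (T : measurableType d) (v w : T -> R) (x : T -> plane R) :
  (forall t, 0 < dirsq (v t) (w t)) ->
  measurable_fun setT v -> measurable_fun setT w -> measurable_fun setT x ->
  measurable_fun setT (fun t => ray_density (v t) (w t) (x t)).
Proof.
move=> vw mv mw mx; rewrite /ray_density.
have me : measurable_fun setT (fun t => (x t).1 / 3).
  by apply: measurable_funM => //; exact: measurable_fun_fst.
have mx2 := measurable_fun_snd mx.
have mp := measurable_rayinv dg dg1 lo_gt0 lo_le vw me mv mw mx2.
apply: measurable_funM; last first.
  by apply: (measurableT_comp measurable_inv); exact: (measurable_slope dg1 cg2).
have mWW (a : T -> R) : measurable_fun setT a -> measurable_fun setT (fun t => W (a t)).
  by move=> ma; exact: (measurableT_comp mW ma).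
by apply: measurable_funM; [|apply: measurable_funM]; apply: mWW; measurability_of_map.
Qed.

Lemma measurable_ray_density2 d (T : measurableType d) (x : T -> plane R) (m : T -> R) :
  measurable_fun setT x -> measurable_fun setT m ->
  measurable_fun setT (fun t => ray_density2 (x t) (m t)).
Proof.
move=> mx mm; apply: measurable_funD; apply: measurable_ray_density => //.
- by move=> t; exact: dirsq1_gt0.
- exact: measurable_fun_opp.
Qed.

Lemma integrable_ray_density2 x : leb.-integrable setT (EFin \o ray_density2 x).
Proof.
apply: (@le_integrable _ _ _ leb _ measurableT _ (EFin \o (fun m => C ^+ 3 / lo * poisson 1 m))).
- apply/measurable_EFinP; apply: measurable_ray_density2 => //.
- move=> m _ /=; rewrite lee_fin ger0_norm ?ray_density2_ge0//.
  by apply: le_trans (ray_density2_le x m) (ler_norm _).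
- have -> : EFin \o (fun m => C ^+ 3 / lo * poisson 1 m) =
     (fun m => ((C ^+ 3 / lo)%:E * (EFin \o poisson 1) m)%E) by apply/funext => m.
  by apply: integrableZl => //; exact: integrable_poisson.
Qed.

Lemma conv3_ge0 x : 0 <= conv3 x.
Proof.
rewrite /conv3; case: ifP => // _; apply: fine_ge0; apply: integral_ge0 => m _.
by rewrite lee_fin ray_density2_ge0.
Qed.

Lemma conv3_off x : ~ conv3_region g r x -> conv3 x = 0.
Proof. by move=> nx; rewrite /conv3 ifF//; apply/negP => /andP[h1 h2]; exact: nx. Qed.

Lemma integral_ray_density2 (x : R * R) : 3 * g (x.1 / 3) <= x.2 ->
  (\int[leb]_m (ray_density2 x m)%:E = (conv3 x)%:E)%E.
Proof.
move=> gx; rewrite /conv3 gx andbT; case: ifPn => [_|].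
  by rewrite /Rintegral fineK//; exact: (integrable_fin_num measurableT (integrable_ray_density2 x)).
rewrite -leNgt => rx; apply: integral0_eq => m _.
rewrite /ray_density2 /ray_density !weight3_off ?mul0r ?addr0//;
  by rewrite normrM [X in _ * X]ger0_norm// ler_pdivlMr// mulrC.
Qed.

Lemma measurable_conv3 : measurable_fun [set: plane R] conv3.
Proof.
have mg : measurable_fun [set: R] g by apply: continuous_measurable_fun; exact: (continuous_curve dg).
apply: measurable_fun_ifT; last exact: measurable_cst.
- apply: measurable_and.
    apply: measurable_fun_ltr => //; apply: measurableT_comp => //; exact: measurable_fst.
  apply: measurable_fun_ler; last exact: measurable_snd.
  apply: measurable_funM => //; apply: (measurableT_comp mg); exact: measurable_funM.
- rewrite /Rintegral; apply: measurableT_comp; first exact: fine_measurable.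
  apply: (measurable_fun_fubini_tonelli_F (fun z : plane R * M => (ray_density2 z.1 z.2)%:E)).
    apply/measurable_EFinP; apply: measurable_ray_density2; [exact: measurable_fst|exact: measurable_snd].
  by move=> z; rewrite lee_fin ray_density2_ge0.
Qed.

Section identity.
Variable nu : {finite_measure set M -> \bar R}.
Hypothesis nuE : forall f : R -> \bar R, measurable_fun [set: R] f -> (forall x, 0 <= f x)%E ->
  (\int[nu]_x f x = \int[leb]_x (f x * (W x)%:E))%E.
Local Notation nu3 := (sprod nu (sprod nu nu)).

Let mWe : measurable_fun [set: R] (fun y => (W y)%:E).
Proof. exact/measurable_EFinP. Qed.

Let We_ge0 y : (0 <= (W y)%:E)%E.
Proof. by rewrite lee_fin. Qed.

Lemma ge0_integral_triple (F : M * (M * M) -> \bar R) :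
  measurable_fun setT F -> (forall X, 0 <= F X)%E ->
  (\int[nu3]_X F X = \int[leb]_y1 \int[leb]_y2 \int[leb]_y3
     (F (y1, (y2, y3)) * (W y1 * (W y2 * W y3))%:E))%E.
Proof.
move=> mF F0.
have mF1 y1 : measurable_fun setT (fun Z : M * M => F (y1, Z)).
  by apply: (measurableT_comp mF); measurability_of_map.
have mF2 y1 y2 : measurable_fun setT (fun y : M => F (y1, (y2, y))).
  by apply: (measurableT_comp mF); measurability_of_map.
have mI1 y1 : measurable_fun setT (fun y2 : M => \int[nu]_y3 F (y1, (y2, y3)))%E.
  exact: (measurable_fun_fubini_tonelli_F (fun Z : M * M => F (y1, Z)) (mF1 y1)).
have mI : measurable_fun setT (fun y1 : M => \int[sprod nu nu]_Z F (y1, Z))%E.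
  exact: (measurable_fun_fubini_tonelli_F F mF F0).
rewrite [LHS](fubini_tonelli1 F mF F0) [LHS]nuE//; last first.
  by move=> y; apply: integral_ge0 => Z _; exact: F0.
apply: eq_integral => y1 _; rewrite /fubini_F.
rewrite (fubini_tonelli1 (fun Z : M * M => F (y1, Z)) (mF1 y1))//.
have mI2 : measurable_fun setT (fun y2 : M => \int[leb]_y3 (F (y1, (y2, y3)) * (W y3)%:E))%E.
  apply: (measurable_fun_fubini_tonelli_F (fun Z : M * M => F (y1, Z) * (W Z.2)%:E)%E).
    apply: emeasurable_funM => //; exact: (measurableT_comp mWe (@measurable_snd _ _ _ _)).
  by move=> Z; exact: mule_ge0.
transitivity ((\int[leb]_y2 ((\int[leb]_y3 (F (y1, (y2, y3)) * (W y3)%:E)) * (W y2)%:E)) * (W y1)%:E)%E.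
  congr (_ * _)%E; rewrite nuE//; last 2 first.
  - exact: mI1.
  - by move=> y2; exact: integral_ge0.
  by apply: eq_integral => y2 _; rewrite /fubini_F (nuE (mF2 y1 y2)).
have I0 y2 : (0 <= \int[leb]_y3 (F (y1, (y2, y3)) * (W y3)%:E))%E.
  by apply: integral_ge0 => y3 _; exact: mule_ge0.
rewrite -ge0_integralZr//; last 2 first.
- exact: emeasurable_funM.
- by move=> y2 _; exact: mule_ge0.
apply: eq_integral => y2 _; rewrite -muleA -ge0_integralZr; last 4 first.
- exact: measurableT.
- by apply: emeasurable_funM; [exact: mF2|exact: mWe].
- by move=> y3 _; exact: mule_ge0.
- exact: mule_ge0.
apply: eq_integral => y3 _; rewrite -muleA; congr (_ * _)%E.
by rewrite -!EFinM; congr (_%:E); ring.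
Qed.

Lemma ge0_integral_ray (Phi : R -> \bar R) (xi v w : R) : 0 < dirsq v w ->
  measurable_fun [set: R] Phi -> (forall t, 0 <= Phi t)%E ->
  (\int[leb]_(p in `]0%R, +oo[)
     (p%:E * (Phi (ray g (xi / 3) v w p) * (weight3 (xi / 3) v w p)%:E)) =
   \int[leb]_(t in `](3 * g (xi / 3))%R, +oo[) (Phi t * (ray_density v w (xi, t))%:E))%E.
Proof.
move=> vw mPhi Phi0; set eta := xi / 3.
pose f t := (Phi t * (ray_density v w (xi, t))%:E)%E.
have mf : measurable_fun [set: R] f.
  apply: emeasurable_funM => //; apply/measurable_EFinP.
  by apply: measurable_ray_density => //; apply: measurable_fun_pair.
have f0 t : (0 <= f t)%E by rewrite mule_ge0// lee_fin ray_density_ge0.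
have cslope : continuous (fun p : R => p * slope g1 g2 eta v w p).
  move=> p; apply: cvgM; first exact: cvg_id.
  have cd (a : R) : (divdiff g1 g2 eta (eta + q * a) @[q --> p]) --> divdiff g1 g2 eta (eta + p * a).
    apply: (@continuous_comp _ _ _ (fun q : R => (eta, eta + q * a)) (fun x => divdiff g1 g2 x.1 x.2)).
      apply: (@cvg_pair _ _ _ (nbhs p) (nbhs eta) (nbhs (eta + p * a)) _ _ _
        (fun=> eta) (fun q => eta + q * a)); first exact: cvg_cst.
      by apply: cvgD; [exact: cvg_cst|apply: cvgM; [exact: cvg_id|exact: cvg_cst]].
    exact: (continuous_divdiff dg1 cg2).
  have cdN : (divdiff g1 g2 eta (eta - q * (v + w)) @[q --> p]) --> divdiff g1 g2 eta (eta - p * (v + w)).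
    by rewrite -mulrN; under eq_cvg do rewrite -mulrN; exact: cd.
  rewrite /slope; by apply: cvgD; [apply: cvgD|]; apply: cvgM; (try exact: cvg_cst); (exact: cdN || exact: cd).
have := ge0_integral_substitution (is_derive_ray g2 dg eta v w) cslope
  (fun p p0 => mulr_gt0 p0 (slope_gt0 dg1 lo_gt0 lo_le vw eta p))
  (rayinv_ge0 dg dg1 lo_gt0 lo_le vw eta) _ mf f0.
rewrite ray0 => <-; last by move=> t; exact: (rayinvK dg dg1 lo_gt0 lo_le vw).
apply: eq_integral => p; rewrite inE/= in_itv/= andbT => p0.
rewrite /f /ray_density /= -/eta (rayK dg dg1 lo_gt0 lo_le vw)//; last exact: ltW.
rewrite muleCA -muleA; congr (_ * _)%E; rewrite -!EFinM; congr (_%:E).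
have s0 := slope_gt0 dg1 lo_gt0 lo_le vw eta p.
by field; rewrite gt_eqF.
Qed.

Lemma conv3_density_identity (Phi : plane R -> \bar R) :
  measurable_fun setT Phi -> (forall x, 0 <= Phi x)%E ->
  (\int[nu3]_X Phi (sum3 (fun y : M => y) X, sum3 g X) =
   \int[sprod leb leb]_x (Phi x * (conv3 x)%:E))%E.
Proof.
move=> mPhi Phi0.
have mg : measurable_fun [set: R] g by apply: continuous_measurable_fun; exact: (continuous_curve dg).
have mid : measurable_fun [set: R] (fun y : M => y) by exact: measurable_id.
have mS1 : measurable_fun setT (sum3 (fun y : M => y)) by exact: (measurable_sum3 mid).
have mS2 : measurable_fun setT (sum3 (g : M -> R)) by exact: (measurable_sum3 mg).
pose F X := Phi (sum3 (fun y : M => y) X, sum3 g X).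
have mF : measurable_fun setT F by apply: (measurableT_comp mPhi); exact: measurable_fun_pair.
have F0 X : (0 <= F X)%E by exact: Phi0.
rewrite (ge0_integral_triple mF F0).
pose H (X : M * (M * M)) := (F X * (W X.1 * (W X.2.1 * W X.2.2))%:E)%E.
have mH : measurable_fun setT H.
  apply: emeasurable_funM => //; apply/measurable_EFinP.
  have mWW (a : M * (M * M) -> R) : measurable_fun setT a -> measurable_fun setT (fun t => W (a t)).
    by move=> ma; exact: (measurableT_comp mW ma).
  by apply: measurable_funM; [|apply: measurable_funM]; apply: mWW; measurability_of_map.
have H0 X : (0 <= H X)%E.
  by apply: mule_ge0 (F0 _) _; rewrite lee_fin; exact: mulr_ge0 (W_ge0 _) (mulr_ge0 (W_ge0 _) (W_ge0 _)).
rewrite [LHS](ge0_integral_sum_coordinates mH H0).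
rewrite [RHS](fubini_tonelli1 (fun x : plane R => (Phi x * (conv3 x)%:E)%E)); last 2 first.
- apply: emeasurable_funM => //; apply/measurable_EFinP; exact: measurable_conv3.
- by move=> x; rewrite mule_ge0// lee_fin conv3_ge0.
apply: eq_integral => xi _; rewrite /fubini_F; set eta := xi / 3.
pose K (z : M * M) := H (eta + z.1, (eta + z.2, eta - (z.1 + z.2))).
have mK : measurable_fun setT K by apply: (measurableT_comp mH); measurability_of_map.
have K0 z : (0 <= K z)%E by exact: H0.
rewrite [LHS](ge0_integral_plane_rays mK K0).
have mPx : measurable_fun [set: R] (fun t => Phi (xi, t)).
  by apply: (measurableT_comp mPhi); exact: measurable_fun_pair.
have KE (v w p : R) : (K (p * v, p * w)%R = Phi (xi, ray g eta v w p) * (weight3 eta v w p)%:E)%E.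
  rewrite /K /H /F /sum3/= /weight3 /ray mulrDr; congr (Phi (_, _) * _)%E.
  by rewrite /eta; field.
pose I : set R := `](3 * g eta), +oo[%classic.
have mI : measurable (I : set M) by exact: measurable_itv.
pose L (z : M * M) := (((fun t => Phi (xi, t)) \_ I) z.2 * (ray_density2 (xi, z.2) z.1)%:E)%E.
have mP : measurable_fun [set: R] ((fun t => Phi (xi, t)) \_ I).
  by apply/(measurable_restrictT _ _).1 => //; exact: measurable_funTS.
have P0 t : (0 <= ((fun t => Phi (xi, t)) \_ I) t)%E by rewrite patchE; case: ifP.
have mL : measurable_fun setT L.
  apply: emeasurable_funM; first exact: (measurableT_comp mP (@measurable_snd _ _ _ _)).
  apply/measurable_EFinP; apply: measurable_ray_density2; measurability_of_map.
have L0 z : (0 <= L z)%E by rewrite mule_ge0// lee_fin ray_density2_ge0.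
transitivity (\int[leb]_m \int[leb]_t L (m, t))%E.
  apply: eq_integral => m _.
  have mrd (v w : R) : 0 < dirsq v w ->
      measurable_fun [set: R] (fun t => (Phi (xi, t) * (ray_density v w (xi, t))%:E)%E).
    move=> vw; apply: emeasurable_funM => //; apply/measurable_EFinP.
    by apply: measurable_ray_density => //; apply: measurable_fun_pair.
  have mKr (v w : R) : measurable_fun [set: R] (fun p => (p%:E * K (p * v, p * w)%R)%E).
    apply: emeasurable_funM; first exact/measurable_EFinP.
    by apply: (measurableT_comp mK); measurability_of_map.
  transitivity (\int[leb]_(p in `]0%R, +oo[) (p%:E * K (p * 1, p * m)%R + p%:E * K (p * - 1, p * - m)%R))%E.
    by apply: eq_integral => p _; rewrite mulr1 mulrN1 mulrN.
  rewrite ge0_integralD//; last 4 first.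
  - by move=> p /=; rewrite in_itv/= andbT => p0; rewrite mule_ge0// lee_fin ltW.
  - by apply: measurable_funTS; exact: mKr.
  - by move=> p /=; rewrite in_itv/= andbT => p0; rewrite mule_ge0// lee_fin ltW.
  - by apply: measurable_funTS; exact: mKr.
  transitivity (\int[leb]_(t in I) (Phi (xi, t) * (ray_density2 (xi, t) m)%:E))%E; last first.
    rewrite integral_mkcond; apply: eq_integral => t _; rewrite /L/= !patchE.
    by case: ifP => //; rewrite mul0e.
  under [in RHS]eq_integral do rewrite /ray_density2 EFinD ge0_muleDr ?lee_fin ?ray_density_ge0 ?vwN ?dirsq1_gt0//.
  rewrite [RHS]ge0_integralD//; last 4 first.
  - by move=> t _; rewrite mule_ge0// lee_fin ray_density_ge0// dirsq1_gt0.
  - by apply: measurable_funTS; apply: mrd; exact: dirsq1_gt0.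
  - by move=> t _; rewrite mule_ge0// lee_fin ray_density_ge0.
  - by apply: measurable_funTS; exact: mrd.
  have rE (v w : R) : 0 < dirsq v w ->
      (\int[leb]_(p in `]0%R, +oo[) (p%:E * K (p * v, p * w)%R) =
       \int[leb]_(t in I) (Phi (xi, t) * (ray_density v w (xi, t))%:E))%E.
    move=> vw; rewrite -(ge0_integral_ray xi vw mPx)//.
    by apply: eq_integral => p _; rewrite KE.
  by rewrite !rE// dirsq1_gt0.
transitivity (\int[leb]_t \int[leb]_m L (m, t))%E; first exact: (fubini_tonelli L mL L0).
have mPc : measurable_fun [set: R] (fun t => Phi (xi, t) * (conv3 (xi, t))%:E)%E.
  apply: emeasurable_funM => //; apply/measurable_EFinP.
  by apply: (measurableT_comp measurable_conv3); exact: measurable_fun_pair.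
transitivity (\int[leb]_(t in I) (Phi (xi, t) * (conv3 (xi, t))%:E))%E.
  rewrite [RHS]integral_mkcond; apply: eq_integral => t _; rewrite /L/= !patchE.
  case: ifPn => [tI|_]; last by apply: integral0_eq => m _; rewrite mul0e.
  rewrite ge0_integralZl//; last 2 first.
  - by apply/measurable_EFinP; apply: measurable_ray_density2.
  - by move=> m _; rewrite lee_fin ray_density2_ge0.
  rewrite integral_ray_density2//=; move: tI.
  by rewrite inE/= /I/= in_itv/= andbT => /ltW.
(* The region contains its lower boundary while rays cover heights strictly above it; on a vertical
   line the difference is one point. *)
rewrite [LHS]integral_itv_obnd_cbnd; last exact: measurable_funTS.
rewrite [LHS]integral_mkcond; apply: eq_integral => t _; rewrite patchE.
case: ifPn => //; rewrite notin_setE/= in_itv/= andbT => /negP; rewrite -ltNge => tg.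
by rewrite conv3_off ?mule0// /conv3_region/= -/eta => -[_]; rewrite leNgt tg.
Qed.

End identity.

(** * Continuity of the density on the closed region *)

Section continuity.
Hypothesis cW : forall y, `|y| != r -> W x @[x --> y] --> W y.

(** This is strict convexity. A pair with midpoint [mu] is a point of the ray in direction
    [(1, -1)], whose third component stays at [mu]; injectivity of the height along the ray
    determines [|a - b|]. *)
Lemma equal_pairs (a b a' b' : R) : a + b = a' + b' -> g a + g b = g a' + g b' ->
  (a' = a /\ b' = b) \/ (a' = b /\ b' = a).
Proof.
move=> sab gab; pose mu := (a + b) / 2.
have vw : 0 < dirsq 1 (- 1 : R) by rewrite /dirsq; lra.
have rayE (t : R) : ray g mu 1 (- 1) `|t| = g (mu + t) + g (mu - t) + g mu.
  rewrite /ray subrr mulr0 subr0 mulr1 mulrN1; have [t0|t0] := ger0P t; first by rewrite addrA.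
  by rewrite opprK addrA (addrC (g (mu - t))).
have E : `|(a - b) / 2| = `|(a' - b') / 2|.
  rewrite -[LHS](rayK dg dg1 lo_gt0 lo_le vw mu (normr_ge0 _)).
  rewrite -[RHS](rayK dg dg1 lo_gt0 lo_le vw mu (normr_ge0 _)); congr rayinv; rewrite !rayE.
  rewrite (_ : mu + _ = a); last by rewrite /mu; field.
  rewrite (_ : mu - _ = b); last by rewrite /mu; field.
  rewrite (_ : mu + _ = a'); last by rewrite /mu sab; field.
  by rewrite (_ : mu - _ = b'); [rewrite gab|rewrite /mu sab; field].
have /eqP : ((a - b) / 2) ^+ 2 = ((a' - b') / 2) ^+ 2 by rewrite -[LHS]real_normK ?num_real// E real_normK ?num_real.
rewrite eqf_sqr => /orP[]/eqP h; [left|right]; split; lra.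
Qed.

(** The weight jumps at the ends of the arc, so slopes for which one of the three points is an end
    are exceptional. Once one point is fixed at [c], the other two have known sum and known total
    height, hence are known up to order by [equal_pairs], and [mE] recovers the slope from them: at
    most two slopes for each position of [c]. *)
Lemma finite_ray_hits (e c : R) (x : R * R) : e != 0 -> 3 * g (x.1 / 3) < x.2 ->
  finite_set [set m | let p := rayinv g e (e * m) (x.1 / 3) x.2 in
    [\/ x.1 / 3 + p * e = c, x.1 / 3 + p * (e * m) = c | x.1 / 3 - p * (e + e * m) = c]].
Proof.
move=> e0 gx; set eta := x.1 / 3 in gx *.
have vw m : 0 < dirsq e (e * m).
  have -> : dirsq e (e * m) = e ^+ 2 * dirsq 1 m by rewrite /dirsq; ring.
  by rewrite mulr_gt0 ?dirsq1_gt0// exprn_even_gt0.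
pose P m := rayinv g e (e * m) eta x.2.
pose y1 m := eta + P m * e; pose y2 m := eta + P m * (e * m); pose y3 m := eta - P m * (e + e * m).
have P0 m : P m != 0.
  by rewrite gt_eqF// /P (rayinv_gt dg dg1 lo_gt0 lo_le)// ray0 lt_max gx.
have sy m : y1 m + y2 m + y3 m = 3 * eta by rewrite /y1 /y2 /y3; ring.
have sg m : g (y1 m) + g (y2 m) + g (y3 m) = x.2.
  by rewrite -(rayinvK dg dg1 lo_gt0 lo_le (vw m) (ltW gx)) /ray addrA.
have mE m : m = (y2 m - eta) / (y1 m - eta).
  rewrite /y1 /y2 !(addrC eta) !addrK; field; by rewrite e0 P0.
have fin (S : set R) : (forall m0, S m0 -> exists a b, S `<=` [set a; b]) -> finite_set S.
  move=> h; have [[m0 /h[a [b Sab]]]|nS] := pselect (exists m0, S m0).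
    exact: sub_finite_set Sab (finite_set2 _ _).
  by rewrite (_ : S = set0)//; apply/seteqP; split => m // Sm; apply: nS; exists m.
rewrite (_ : mkset _ = [set m | y1 m = c] `|` [set m | y2 m = c] `|` [set m | y3 m = c]); last first.
  apply/seteqP; split => m /=; first by case; [left; left|left; right|right].
  by move=> [[]|] h; [apply: Or31|apply: Or32|apply: Or33].
rewrite !finite_setU; split; first split; apply: fin => m0 /= h0.
- exists ((y2 m0 - eta) / (c - eta)), ((y3 m0 - eta) / (c - eta)) => m /= h.
  have [||[E _]|[E _]] := @equal_pairs (y2 m0) (y3 m0) (y2 m) (y3 m).
  + by have := sy m; rewrite -(sy m0) h h0; lra.
  + by have := sg m; rewrite -(sg m0) h h0; lra.
  + by left; rewrite [LHS]mE h E.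
  + by right; rewrite [LHS]mE h E.
- exists ((c - eta) / (y1 m0 - eta)), ((c - eta) / (y3 m0 - eta)) => m /= h.
  have [||[E _]|[E _]] := @equal_pairs (y1 m0) (y3 m0) (y1 m) (y3 m).
  + by have := sy m; rewrite -(sy m0) h h0; lra.
  + by have := sg m; rewrite -(sg m0) h h0; lra.
  + by left; rewrite [LHS]mE h E.
  + by right; rewrite [LHS]mE h E.
- exists ((y2 m0 - eta) / (y1 m0 - eta)), ((y1 m0 - eta) / (y2 m0 - eta)) => m /= h.
  have [||[E E']|[E E']] := @equal_pairs (y1 m0) (y2 m0) (y1 m) (y2 m).
  + by have := sy m; rewrite -(sy m0) h h0; lra.
  + by have := sg m; rewrite -(sg m0) h h0; lra.
  + by left; rewrite [LHS]mE E E'.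
  + by right; rewrite [LHS]mE E E'.
Qed.

Lemma continuous_ray_density (v w : R) (x : R * R) : 0 < dirsq v w ->
  let p := rayinv g v w (x.1 / 3) x.2 in
  `|x.1 / 3 + p * v| != r -> `|x.1 / 3 + p * w| != r -> `|x.1 / 3 - p * (v + w)| != r ->
  ray_density v w z @[z --> x] --> ray_density v w x.
Proof.
move=> vw /= h1 h2; rewrite -mulrN => h3.
have c1 : (z.1 / 3 @[z --> x]) --> x.1 / 3 by apply: cvgM; [exact: cvg_fst|exact: cvg_cst].
have c2 : (z.2 @[z --> x]) --> x.2 by exact: cvg_snd.
have cpair (f h : R * R -> R) (a b : R) : f z @[z --> x] --> a -> h z @[z --> x] --> b ->
    (f z, h z) @[z --> x] --> (a, b).
  by move=> cf ch; apply: (@cvg_pair _ _ _ (nbhs x) (nbhs a) (nbhs b)).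
pose p (z : R * R) := rayinv g v w (z.1 / 3) z.2.
have cp : p z @[z --> x] --> p x.
  apply: (cvg_comp (fun z : R * R => (z.1 / 3, z.2)) (fun z => rayinv g v w z.1 z.2) (cpair _ _ _ _ c1 c2)).
  have c := @continuous_rayinv _ g g1 g2 lo dg dg1 lo_gt0 lo_le v w vw; exact: (c (x.1 / 3, x.2)).
have cy (a : R) : (z.1 / 3 + p z * a @[z --> x]) --> x.1 / 3 + p x * a.
  by apply: cvgD => //; apply: cvgM => //; exact: cvg_cst.
have cWy (a : R) : `|x.1 / 3 + p x * a| != r ->
    W (z.1 / 3 + p z * a) @[z --> x] --> W (x.1 / 3 + p x * a).
  by move=> h; exact: (cvg_comp _ _ (cy a) (cW h)).
have cd (a : R) : divdiff g1 g2 (z.1 / 3) (z.1 / 3 + p z * a) @[z --> x] -->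
    divdiff g1 g2 (x.1 / 3) (x.1 / 3 + p x * a).
  apply: (cvg_comp (fun z : R * R => (z.1 / 3, z.1 / 3 + p z * a))
    (fun z => divdiff g1 g2 z.1 z.2) (cpair _ _ _ _ c1 (cy a))).
  have c := @continuous_divdiff _ g1 g2 dg1 cg2; exact: (c (x.1 / 3, x.1 / 3 + p x * a)).
have cs : slope g1 g2 (z.1 / 3) v w (p z) @[z --> x] --> slope g1 g2 (x.1 / 3) v w (p x).
  rewrite /slope -mulrN; under eq_cvg do rewrite -mulrN.
  by apply: cvgD; [apply: cvgD|]; apply: cvgM => //; exact: cvg_cst.
rewrite /ray_density; apply: cvgM; last first.
  by apply: cvgV => //; rewrite gt_eqF// (slope_gt0 dg1 lo_gt0 lo_le).
rewrite /weight3 -mulrN; under eq_cvg do rewrite -mulrN.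
by apply: cvgM; [exact: cWy|apply: cvgM; exact: cWy].
Qed.

Lemma ae_continuous_ray_density2 (x : R * R) : conv3_region g r x ->
  {ae leb, forall m, ray_density2 z m @[z --> x] --> ray_density2 x m}.
Proof.
(* On the lower boundary the radius is 0 and all three points equal [x.1 / 3], which is inside the
   arc, so no slope is exceptional; above it [finite_ray_hits] applies. *)
move=> [xr]; rewrite le_eqVlt => /predU1P[gx|gx].
  apply: aeW => m.
  have pE v w : 0 < dirsq v w -> rayinv g v w (x.1 / 3) x.2 = 0.
    by move=> vw; rewrite -gx -(ray0 g (x.1 / 3) v w) (rayK dg dg1 lo_gt0 lo_le vw).
  have h : `|x.1 / 3| != r.
    by rewrite normrM [X in _ * X]ger0_norm// lt_eqF// ltr_pdivrMr// mulrC.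
  by apply: cvgD; apply: continuous_ray_density; rewrite ?vwN ?dirsq1_gt0// ?pE ?vwN ?dirsq1_gt0// !mul0r ?subr0 ?addr0.
have ae_hits (e : R) : e != 0 -> {ae leb, forall m,
    let p := rayinv g e (e * m) (x.1 / 3) x.2 in
    [/\ `|x.1 / 3 + p * e| != r, `|x.1 / 3 + p * (e * m)| != r & `|x.1 / 3 - p * (e + e * m)| != r]}.
  move=> e0; pose N c := [set m | let p := rayinv g e (e * m) (x.1 / 3) x.2 in
    [\/ x.1 / 3 + p * e = c, x.1 / 3 + p * (e * m) = c | x.1 / 3 - p * (e + e * m) = c]].
  have fN : finite_set (N r `|` N (- r)) by rewrite finite_setU; split; exact: finite_ray_hits.
  have cN := finite_set_countable fN.
  have nr z : `|z| = r -> z = r \/ z = - r.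
    by have [_ ->|_ <-] := ger0P z; [left|right; rewrite opprK].
  exists (N r `|` N (- r)); split.
  - exact: countable_measurable.
  - exact: countable_lebesgue_measure0.
  - move=> m /= nm; apply: contrapT => nS; apply: nm; split; apply/eqP => /nr[] h; apply: nS;
      (by [left; apply: Or31|right; apply: Or31|left; apply: Or32|right; apply: Or32|left; apply: Or33|right; apply: Or33]).
have n1 : - 1 != 0 :> R by rewrite oppr_eq0 oner_eq0.
apply: (@filterS2 _ _ (ae_filter_ringOfSetsType leb) _ _ _ _ (ae_hits _ (@oner_neq0 R)) (ae_hits _ n1)) => m /=.
rewrite mul1r mulN1r => -[h1 h2 h3] [h4 h5 h6].
by apply: cvgD; apply: continuous_ray_density => //; exact: dirsq1_gt0.
Qed.

(** A failure of continuity yields a sequence in the region, where [conv3] is the slope integral.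
    Almost everywhere convergence of the integrand and the majorant of [ray_density2_le] then
    contradict it by dominated convergence. *)
Lemma continuous_conv3 : {within conv3_region g r, continuous conv3}.
Proof.
apply/subspace_continuousP => x rx; apply/cvgrPdist_lt => e e0; apply: contrapT => nn.
have H n : exists u, [/\ conv3_region g r u, ball x n.+1%:R^-1 u & e <= `|conv3 x - conv3 u|].
  apply: contrapT => Hn; apply: nn; apply/nbhs_ballP; exists n.+1%:R^-1; first by rewrite /= invr_gt0.
  move=> u xu ru; rewrite ltNge; apply/negP => eu; apply: Hn; exists u; split => //.
have [u hu] := choice H.
have ux : u n @[n --> \oo] --> x.
  apply/cvg_ballP => d d0; near=> n; have [_ b _] := hu n; apply: le_ball b.
  by apply: ltW; near: n; exact: (near_infty_natSinv_lt (PosNum d0)).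
have K0 m : 0 <= C ^+ 3 / lo * poisson 1 m by exact: le_trans (ray_density2_ge0 x m) (ray_density2_le x m).
have [|||||_ _] := @dominated_convergence _ _ _ leb _ measurableT
  (fun n m => (ray_density2 (u n) m)%:E) (fun m => (ray_density2 x m)%:E)
  (fun m => (C ^+ 3 / lo * poisson 1 m)%:E).
- by move=> n; apply/measurable_EFinP; apply: measurable_ray_density2.
- by apply/measurable_EFinP; apply: measurable_ray_density2.
- apply: (@filterS _ _ (ae_filter_ringOfSetsType leb) _ _ _ (ae_continuous_ray_density2 rx)) => m cm _.
  by apply: cvg_EFin; [exact: nearW|exact: (cvg_comp u (fun z => ray_density2 z m) ux cm)].
- have -> : (fun m => (C ^+ 3 / lo * poisson 1 m)%:E) =
     (fun m => ((C ^+ 3 / lo)%:E * (EFin \o poisson 1) m)%E) by apply/funext => m.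
  by apply: integrableZl => //; exact: integrable_poisson.
- by apply: aeW => m n _; rewrite /= ger0_norm ?ray_density2_ge0// lee_fin ray_density2_le.
have -> : [sequence (\int[leb]_m (ray_density2 (u n) m)%:E)%E]_n = (fun n => (conv3 (u n))%:E).
  by apply/funext => n; rewrite /= integral_ray_density2//; have [[]] := hu n.
rewrite integral_ray_density2; last by case: rx.
move=> /fine_cvgP[_ cv]; have /cvgrPdist_lt/(_ _ e0) : conv3 (u n) @[n --> \oo] --> conv3 x := cv.
move=> [n0 _ hn]; have [_ _] := hu n0; rewrite leNgt => /negP; apply.
exact: (hn n0 (leqnn n0)).
Unshelve. all: by end_near.
Qed.

Lemma continuous_conv3_interior (x : R * R) : `|x.1| < 3 * r -> 3 * g (x.1 / 3) < x.2 ->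
  {for x, continuous conv3}.
Proof.
move=> xr gx; have rx : conv3_region g r x by split => //; exact: ltW.
have := (subspace_continuousP _ _).1 continuous_conv3 x rx; rewrite within_interior//.
have cg := continuous_curve dg.
have o : open ([set x : R * R | `|x.1| < 3 * r] `&` [set x : R * R | 3 * g (x.1 / 3) < x.2]).
  apply: openI.
    apply: (@open_comp _ _ (fun x : R * R => `|x.1|) [set t | t < 3 * r]); last exact: open_lt.
    by move=> y _; apply: cvg_norm; exact: cvg_fst.
  rewrite (_ : mkset _ = (fun x : R * R => x.2 - 3 * g (x.1 / 3)) @^-1` [set t | 0 < t]).
    apply: open_comp; last exact: open_gt.
    move=> y _; apply: cvgB; first exact: cvg_snd.
    apply: cvgM; first exact: cvg_cst.
    apply: (cvg_comp (fun x : R * R => x.1 / 3) g _ (cg _)).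
    by apply: cvgM; [exact: cvg_fst|exact: cvg_cst].
  by apply/seteqP; split => y /=; rewrite subr_gt0.
apply: filterS (open_nbhs_nbhs (conj o (conj xr gx))) => y [/= h1 h2].
by split => //; exact: ltW.
Qed.

End continuity.

End density.

(** * Second-order comparison of the density with its value at the origin *)

Section pointwise_estimate.
Context {R : realType}.
Variables lam a kap : R.
Hypotheses (lam_gt0 : 0 < lam) (a_gt0 : 0 < a).
Hypotheses (kap_gt0 : 0 < kap) (kap_le1 : kap <= 1) (kap_a : kap <= a) (kap_lam : 6 * a * kap <= lam).

(** The factor of [kap] in the errors: [lam^-1] from the error of the divided differences,
    [(6 * a / lam) ^+ 2] from expanding the reciprocal, and [1 + L ^+ 2 + L ^+ 3] with
    [L = lam ^+ 2 / 2 + 1] from the product of the three weights. *)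
Definition error_const : R :=
  lam^-1 + (6 * a / lam) ^+ 2 + 1 + (lam ^+ 2 / 2 + 1) ^+ 2 + (lam ^+ 2 / 2 + 1) ^+ 3.

(** Here [V] is [dirsq], [q] the squared distance from the diagonal, [z] the cubic moment of the
    deviations divided by [q], [B] the slope, and [w1], [w2], [w3] are weights at points with
    squares [s1], [s2], [s3]. The slope in the denominator produces the negative term, the arclength
    weights the term in [lam ^+ 2 / 2]; all the rest is of size [kap * (3 * eta ^+ 2 + q)]. *)
Lemma ray_density_le_taylor (eta q z V B w1 w2 w3 s1 s2 s3 : R) :
  0 < V -> 0 <= q -> 6 * z ^+ 2 <= q -> 3 * eta ^+ 2 + q <= kap ->
  0 <= s1 -> 0 <= s2 -> 0 <= s3 -> s1 + s2 + s3 = 3 * eta ^+ 2 + q ->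
  0 <= w1 <= 1 + (lam ^+ 2 / 2 + kap) * s1 -> 0 <= w2 <= 1 + (lam ^+ 2 / 2 + kap) * s2 ->
  0 <= w3 <= 1 + (lam ^+ 2 / 2 + kap) * s3 ->
  V * (lam + 4 * a * (3 * eta ^+ 2 + 3 * (eta * z) + q / 2) - kap * (3 * eta ^+ 2 + q)) <= B ->
  lam * V * (w1 * (w2 * w3) / B) <=
    1 - (12 * a * eta ^+ 2 + 12 * a * (eta * z) + 2 * a * q) / lam +
    (lam ^+ 2 / 2 + error_const * kap) * (3 * eta ^+ 2 + q).
Proof.
move=> V0 q0 zq Sk s10 s20 s30 sS /andP[w10 w1s] /andP[w20 w2s] /andP[w30 w3s] hB.
set S := 3 * eta ^+ 2 + q in Sk sS hB *.
have eta2 := sqr_ge0 eta; have z2 := sqr_ge0 z.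
have S0 : 0 <= S by rewrite /S; lra.
have hz1 : 3 * (eta * z) <= 3 / 2 * eta ^+ 2 + q / 4 by have := sqr_ge0 (eta - z); lra.
have hz2 : - (3 / 2 * eta ^+ 2 + q / 4) <= 3 * (eta * z) by have := sqr_ge0 (eta + z); lra.
(* The excess of the slope over its value [lam * V] at the origin, per unit of [V]. The bound
   [6 * z ^+ 2 <= q] lets the squares absorb the cross term, so that [E] is nonnegative and at most
   [6 * a * S]. *)
pose E := 4 * a * (3 * eta ^+ 2 + 3 * (eta * z) + q / 2) - kap * S.
have E0 : 0 <= E.
  have h1 : a * (3 / 2 * eta ^+ 2 + q / 4) <= a * (3 * eta ^+ 2 + 3 * (eta * z) + q / 2).
    by rewrite ler_wpM2l ?(ltW a_gt0)//; lra.
  have h2 : kap * S <= a * S by rewrite ler_wpM2r.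
  have h3 : 0 <= a * eta ^+ 2 := mulr_ge0 (ltW a_gt0) eta2.
  by rewrite /E; move: h1 h2; rewrite /S; lra.
have E1 : E <= 6 * a * S.
  have h1 : a * (3 * eta ^+ 2 + 3 * (eta * z) + q / 2) <= a * (9 / 2 * eta ^+ 2 + 3 / 4 * q).
    by rewrite ler_wpM2l ?(ltW a_gt0)//; lra.
  have h2 : 0 <= kap * S := mulr_ge0 (ltW kap_gt0) S0.
  have h3 : 0 <= a * q := mulr_ge0 (ltW a_gt0) q0.
  by rewrite /E; move: h1 h2; rewrite /S; lra.
pose e := E / lam.
have e0 : 0 <= e by rewrite divr_ge0// ltW.
have eS : e <= 6 * a / lam * S by rewrite /e ler_pdivrMr// mulrAC divfK ?gt_eqF.
have e1 : e <= 1.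
  rewrite /e ler_pdivrMr// mul1r; apply: le_trans E1 _; apply: le_trans kap_lam.
  by rewrite ler_wpM2l// mulr_ge0// ltW.
have hB' : lam * V * (1 + e) <= B.
  apply: le_trans hB; rewrite le_eqVlt; apply/orP; left; apply/eqP.
  have h : lam * e = E by rewrite /e mulrC divfK// gt_eqF.
  by rewrite mulrDr mulr1 mulrAC h /E; ring.
have lV : 0 < lam * V by rewrite mulr_gt0.
have e1' : 0 < 1 + e by rewrite ltr_pwDl.
have B0 : 0 < B by apply: lt_le_trans hB'; rewrite mulr_gt0.
pose L := lam ^+ 2 / 2 + 1.
have L1 : 1 <= L by rewrite /L lerDr divr_ge0 ?sqr_ge0.
pose l := lam ^+ 2 / 2 + kap.
have l0 : 0 <= l by rewrite /l addr_ge0 ?divr_ge0 ?sqr_ge0// ltW.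
have lL : l <= L by rewrite /l /L lerD2l.
pose w := w1 * (w2 * w3).
have w0 : 0 <= w by exact: mulr_ge0 w10 (mulr_ge0 w20 w30).
have lS : 0 <= l * S := mulr_ge0 l0 S0.
(* The numbers [l * s1], [l * s2], [l * s3] are nonnegative, so their elementary symmetric functions
   are bounded by the powers of their sum [l * S]. *)
have wle : w <= 1 + l * S + (l * S) ^+ 2 + (l * S) ^+ 3.
  have a1 : 0 <= l * s1 := mulr_ge0 l0 s10.
  have a2 : 0 <= l * s2 := mulr_ge0 l0 s20.
  have a3 : 0 <= l * s3 := mulr_ge0 l0 s30.
  have : w <= (1 + l * s1) * ((1 + l * s2) * (1 + l * s3)).
    by apply: ler_pM => //; [exact: mulr_ge0|exact: ler_pM].
  have -> : l * S = l * s1 + l * s2 + l * s3 by rewrite -sS; ring.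
  move: a1 a2 a3; move: (l * s1) (l * s2) (l * s3) => u1 u2 u3 a1 a2 a3 h.
  apply: (le_trans h); rewrite -subr_ge0.
  have p12 := mulr_ge0 a1 a2; have p13 := mulr_ge0 a1 a3; have p23 := mulr_ge0 a2 a3.
  have p123 := mulr_ge0 p12 a3.
  have -> : 1 + (u1 + u2 + u3) + (u1 + u2 + u3) ^+ 2 + (u1 + u2 + u3) ^+ 3 - (1 + u1) * ((1 + u2) * (1 + u3)) =
    u1 ^+ 2 + u2 ^+ 2 + u3 ^+ 2 + u1 * u2 + u1 * u3 + u2 * u3 +
    ((u1 + u2 + u3) ^+ 3 - u1 * u2 * u3) by ring.
  have s0 : 0 <= u1 + u2 + u3 by rewrite !addr_ge0.
  have c3 : u1 * u2 * u3 <= (u1 + u2 + u3) ^+ 3.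
    rewrite !exprS expr0 mulr1 mulrA; apply: ler_pM => //; [|lra].
    by apply: ler_pM => //; lra.
  by have := sqr_ge0 u1; have := sqr_ge0 u2; have := sqr_ge0 u3; lra.
have wle' : w - 1 <= (lam ^+ 2 / 2 + (1 + L ^+ 2 + L ^+ 3) * kap) * S.
  have SL : l * S <= L * S by rewrite ler_wpM2r.
  have h2 : (l * S) ^+ 2 <= L ^+ 2 * kap * S.
    rewrite -mulrA exprMn; apply: ler_pM; rewrite ?sqr_ge0//; first by rewrite ler_pXn2r ?nnegrE// (le_trans l0).
    by rewrite expr2 ler_wpM2r.
  have h3 : (l * S) ^+ 3 <= L ^+ 3 * kap * S.
    rewrite -mulrA exprMn; apply: ler_pM; rewrite ?exprn_ge0//; first by rewrite ler_pXn2r ?nnegrE// (le_trans l0).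
    rewrite exprS mulrC ler_wpM2r//; apply: le_trans (_ : S ^+ 1 <= _); last by rewrite expr1.
    by rewrite ler_wiXn2l// (le_trans Sk).
  have lE : l * S = lam ^+ 2 / 2 * S + kap * S by rewrite /l; ring.
  by move: wle h2 h3 lE; clearbody l w; lra.
pose D := (lam ^+ 2 / 2 + (1 + L ^+ 2 + L ^+ 3) * kap) * S.
have D0 : 0 <= D.
  apply: mulr_ge0 => //; apply: addr_ge0; first by rewrite divr_ge0 ?sqr_ge0.
  by apply: mulr_ge0 (ltW kap_gt0); rewrite !addr_ge0// exprn_ge0// (le_trans ler01).
(* For [e >= 0] one has [1 / (1 + e) <= 1 - e + e ^+ 2], with difference [e ^+ 3 / (1 + e)]. *)
have step : lam * V * (w / B) <= 1 - e + e ^+ 2 + D.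
  apply: (@le_trans _ _ ((1 + D) / (1 + e))).
    have -> : lam * V * (w / B) = lam * V * w / B by rewrite mulrA.
    rewrite ler_pdivlMr// mulrAC ler_pdivrMr//.
    have h1 : lam * V * (1 + e) * w <= B * (1 + D) by apply: ler_pM => //; [exact: mulr_ge0 (ltW lV) (ltW e1')|move: wle'; rewrite -/D; lra].
    by move: h1; lra.
  rewrite ler_pdivrMr//.
  have h2 : 0 <= e * (e * e) := mulr_ge0 e0 (mulr_ge0 e0 e0).
  have h3 : 0 <= D * e := mulr_ge0 D0 e0.
  have -> : (1 - e + e ^+ 2 + D) * (1 + e) = 1 + D + e * (e * e) + D * e by ring.
  lra.
apply: (le_trans step).
have e2 : e ^+ 2 <= (6 * a / lam) ^+ 2 * kap * S.
  have b0 : 0 <= 6 * a / lam by rewrite divr_ge0 ?mulr_ge0// ltW.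
  apply: (@le_trans _ _ ((6 * a / lam * S) ^+ 2)); first by rewrite ler_pXn2r ?nnegrE// mulr_ge0.
  rewrite exprMn -[leRHS]mulrA; apply: ler_wpM2l; first exact: sqr_ge0.
  by rewrite expr2 ler_wpM2r.
have eE : e = (12 * a * eta ^+ 2 + 12 * a * (eta * z) + 2 * a * q) / lam - lam^-1 * kap * S.
  by rewrite /e /E; field; rewrite gt_eqF.
move: e2 eE; rewrite /error_const /D -/L; set b2 := (6 * a / lam) ^+ 2; set u := (_ + 2 * a * q) / lam.
by set X := e ^+ 2; clearbody X e b2 u L; lra.
Qed.

(** The terms in [eta * z1] and [eta * z2] have no sign separately, but on opposite rays [z1 + z2]
    is small and completing a square absorbs [eta * (z1 + z2)] at the cost of a factor [kap]. What
    remains is the gain [2 * a / lam] against the loss [lam ^+ 2 / 2]. *)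
Lemma ray_density_pair_le (eta q1 q2 z1 z2 k1 k2 : R) :
  0 <= q1 -> 0 <= q2 ->
  (z1 + z2) ^+ 2 <= kap ^+ 2 * (q1 + q2) ->
  k1 <= 1 - (12 * a * eta ^+ 2 + 12 * a * (eta * z1) + 2 * a * q1) / lam +
    (lam ^+ 2 / 2 + error_const * kap) * (3 * eta ^+ 2 + q1) ->
  k2 <= 1 - (12 * a * eta ^+ 2 + 12 * a * (eta * z2) + 2 * a * q2) / lam +
    (lam ^+ 2 / 2 + error_const * kap) * (3 * eta ^+ 2 + q2) ->
  k1 + k2 <= 2 - (2 * a / lam - lam ^+ 2 / 2 - (error_const + 6 * a / lam) * kap) *
     (6 * eta ^+ 2 + q1 + q2).
Proof.
move=> q10 q20 zz h1 h2; apply: (le_trans (lerD h1 h2)).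
set K := error_const; pose b := 12 * a / lam.
have b0 : 0 <= b by rewrite divr_ge0 ?mulr_ge0// ltW.
have -> : 2 * a / lam = b / 6 by rewrite /b; field; rewrite gt_eqF.
have -> : 6 * a / lam = b / 2 by rewrite /b; field; rewrite gt_eqF.
have E (q z : R) : (12 * a * eta ^+ 2 + 12 * a * (eta * z) + 2 * a * q) / lam =
    b * eta ^+ 2 + b * (eta * z) + b / 6 * q by rewrite /b; field; rewrite gt_eqF.
rewrite !E.
have cross : - (eta * (z1 + z2)) <= kap * (6 * eta ^+ 2 + q1 + q2) / 2.
  have h : 0 <= (kap * eta + (z1 + z2)) ^+ 2 by exact: sqr_ge0.
  have h' : - (kap * (eta * (z1 + z2))) <= kap * (kap * (eta ^+ 2 + q1 + q2) / 2) by lra.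
  have h3 : - (eta * (z1 + z2)) <= kap * (eta ^+ 2 + q1 + q2) / 2 by rewrite -(ler_pM2l kap_gt0) mulrN.
  have := mulr_ge0 (ltW kap_gt0) (sqr_ge0 eta); lra.
have bc := ler_wpM2l b0 cross.
have := mulr_ge0 b0 (sqr_ge0 eta); lra.
Qed.

End pointwise_estimate.

Section estimate.
Context {R : realType}.
Local Notation leb := (@lebesgue_measure R).
Variables (g g1 g2 W : R -> R) (lam a kap r : R).
Hypotheses (lam_gt0 : 0 < lam) (a_gt0 : 0 < a).
Hypotheses (kap_gt0 : 0 < kap) (kap_le : kap <= 1 / 3) (kap_a : kap <= a) (kap_lam : 6 * a * kap <= lam).
Let eps := 2 * a / lam - lam ^+ 2 / 2.
Hypothesis eps_gt0 : 0 < eps.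
Hypothesis kap_eps : (error_const lam a + 6 * a / lam) * kap <= eps / 2.
Hypothesis kap_W : (lam ^+ 2 / 2 + 1) * kap <= 1 / 20.
Hypothesis dg : forall y : R, is_derive y 1 g (g1 y).
Hypothesis dg1 : forall y : R, is_derive y 1 g1 (g2 y).
Hypothesis cg2 : continuous g2.
Let lo := lam * (1 - kap ^+ 2).
Let hi := lam * (1 + kap ^+ 2).
Hypothesis lo_le : forall y, lo <= g2 y.
Hypothesis le_hi : forall y, g2 y <= hi.
Hypotheses (g_0 : g 0 = 0) (g1_0 : g1 0 = 0) (g2_0 : g2 0 = lam).
Hypotheses (r_gt0 : 0 < r) (r_kap : 3 * r ^+ 2 <= kap).
Hypothesis mW : measurable_fun [set: R] W.
Hypothesis W_ge0 : forall y, 0 <= W y.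
Hypothesis W_le : forall y, W y <= 1 + (lam ^+ 2 / 2 + kap) * y ^+ 2.
Hypothesis W_off : forall y, r <= `|y| -> W y = 0.
Hypothesis W_0 : W 0 = 1.
Hypothesis divdiff_ge : forall eta y, `|eta| < r -> `|y| < r ->
  lam + 4 * a * (eta ^+ 2 + eta * y + y ^+ 2) - kap * (eta ^+ 2 + y ^+ 2) <= divdiff g1 g2 eta y.

Let C := 1 + (lam ^+ 2 / 2 + 1) * kap.

Let kap1 : kap <= 1. Proof. by have := kap_le; lra. Qed.

Let kap2 : kap ^+ 2 <= 1 / 9.
Proof. by have := ler_pM (ltW kap_gt0) (ltW kap_gt0) kap_le kap_le; rewrite expr2; lra. Qed.

Let lo_gt0 : 0 < lo.
Proof. by rewrite mulr_gt0//; have := kap2; lra. Qed.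

Let hi_le : hi <= 2 * lam.
Proof. by rewrite /hi mulrC ler_wpM2r ?(ltW lam_gt0)//; have := kap2; lra. Qed.

Let sqr_lt (y : R) : `|y| < r -> y ^+ 2 <= kap / 3.
Proof.
move=> yr; have : y ^+ 2 <= r ^+ 2 by rewrite -real_normK ?num_real// ler_pXn2r ?nnegrE ?(ltW yr)// ltW.
have := r_kap; lra.
Qed.

Let W_leC y : W y <= C.
Proof.
have [ry|yr] := leP r `|y|.
  by rewrite W_off// /C addr_ge0// mulr_ge0 ?(ltW kap_gt0)// addr_ge0// divr_ge0// sqr_ge0.
apply: (le_trans (W_le y)); rewrite /C lerD2l; apply: ler_pM.
- by rewrite addr_ge0 ?(ltW kap_gt0)// divr_ge0// sqr_ge0.
- exact: sqr_ge0.
- by rewrite lerD2l.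
- by have := sqr_lt yr; have := kap_gt0; lra.
Qed.

Let g_ge0 y : 0 <= g y.
Proof.
have := taylor_lo dg dg1 0 y lo_le; rewrite g_0 g1_0 mul0r !subr0; apply: le_trans.
by rewrite mulr_ge0 ?sqr_ge0// divr_ge0// ltW.
Qed.

Let g_le y : g y <= hi / 2 * y ^+ 2.
Proof. by have := taylor_hi 0 y dg dg1 le_hi; rewrite g_0 g1_0 mul0r !subr0. Qed.

(** The sum of the cubes of the direction divided by the sum of its squares. It is odd in the
    direction, which is why opposite rays cancel. *)
Let skew (v w : R) : R := (v ^+ 3 + w ^+ 3 - (v + w) ^+ 3) / dirsq v w.

(** The cube of [dirsq] exceeds six times the squared sum of cubes by twice the discriminant of the
    cubic with roots [v], [w], [- (v + w)]; the product of linear factors below is the product of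
    the root differences. *)
Let skew_le v w : 0 < dirsq v w -> 6 * skew v w ^+ 2 <= dirsq v w.
Proof.
move=> V0; rewrite /skew expr_div_n mulrA ler_pdivrMr ?exprn_gt0//.
have := sqr_ge0 ((v - w) * (2 * v + w) * (v + 2 * w)).
have -> : dirsq v w * dirsq v w ^+ 2 = 6 * (v ^+ 3 + w ^+ 3 - (v + w) ^+ 3) ^+ 2 +
  2 * ((v - w) * (2 * v + w) * (v + 2 * w)) ^+ 2 by rewrite /dirsq; ring.
lra.
Qed.

Let one_direction (eta v w p : R) : 0 < dirsq v w -> `|eta| < r -> weight3 W eta v w p != 0 ->
  lam * dirsq v w * (weight3 W eta v w p / slope g1 g2 eta v w p) <=
    1 - (12 * a * eta ^+ 2 + 12 * a * (eta * (p * skew v w)) + 2 * a * (p ^+ 2 * dirsq v w)) / lam +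
    (lam ^+ 2 / 2 + error_const lam a * kap) * (3 * eta ^+ 2 + p ^+ 2 * dirsq v w).
Proof.
move=> V0 er; rewrite /weight3 !mulf_eq0 !negb_or => /and3P[n1 n2 n3].
have lt y : W y != 0 -> `|y| < r by move=> Wy; rewrite ltNge; apply: contra_neqN Wy; exact: W_off.
have Ws y : 0 <= W y <= 1 + (lam ^+ 2 / 2 + kap) * y ^+ 2 by rewrite W_ge0 W_le.
have sE : (eta + p * v) ^+ 2 + (eta + p * w) ^+ 2 + (eta - p * (v + w)) ^+ 2 =
    3 * eta ^+ 2 + p ^+ 2 * dirsq v w by rewrite /dirsq; ring.
have zq : 6 * (p * skew v w) ^+ 2 <= p ^+ 2 * dirsq v w.
  by rewrite exprMn mulrCA ler_wpM2l ?sqr_ge0// skew_le.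
have q0 : 0 <= p ^+ 2 * dirsq v w by rewrite mulr_ge0 ?sqr_ge0// ltW.
apply: (ray_density_le_taylor lam_gt0 a_gt0 kap_gt0 kap1 kap_a kap_lam V0 q0 zq _
  (sqr_ge0 _) (sqr_ge0 _) (sqr_ge0 _) sE (Ws _) (Ws _) (Ws _)).
  by rewrite -sE; have := sqr_lt (lt _ n1); have := sqr_lt (lt _ n2); have := sqr_lt (lt _ n3); lra.
set V := dirsq v w in V0 q0 zq *; set z := p * skew v w in zq *; set q := p ^+ 2 * V in q0 zq *.
have zE : z * V = p * (v ^+ 3 + w ^+ 3 - (v + w) ^+ 3) by rewrite /z /skew -/V -mulrA divfK// gt_eqF.
(* Three numbers of sum zero have a sum of fourth powers equal to half the square of their sum of
   squares; this is the origin of [q / 2]. *)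
have k1 : v ^+ 2 * (eta ^+ 2 + (eta + p * v) ^+ 2) + w ^+ 2 * (eta ^+ 2 + (eta + p * w) ^+ 2) +
    (v + w) ^+ 2 * (eta ^+ 2 + (eta - p * (v + w)) ^+ 2) <= V * (3 * eta ^+ 2 + q).
  have -> : v ^+ 2 * (eta ^+ 2 + (eta + p * v) ^+ 2) + w ^+ 2 * (eta ^+ 2 + (eta + p * w) ^+ 2) +
    (v + w) ^+ 2 * (eta ^+ 2 + (eta - p * (v + w)) ^+ 2) =
    V * (2 * eta ^+ 2 + q / 2) + 2 * eta * (p * (v ^+ 3 + w ^+ 3 - (v + w) ^+ 3)).
    by rewrite /q /V /dirsq; field.
  rewrite -zE (_ : 2 * eta * (z * V) = V * (2 * eta * z)); last by ring.
  by rewrite -mulrDr ler_wpM2l ?(ltW V0)//; have := sqr_ge0 (eta - z); have := sqr_ge0 z; lra.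
have -> : V * (lam + 4 * a * (3 * eta ^+ 2 + 3 * (eta * z) + q / 2) - kap * (3 * eta ^+ 2 + q)) =
   V * lam + 4 * a * (3 * eta ^+ 2 * V + 3 * eta * (z * V) + q * V / 2) - kap * (V * (3 * eta ^+ 2 + q)) by field.
have d1 := ler_wpM2l (sqr_ge0 v) (divdiff_ge er (lt _ n1)).
have d2 := ler_wpM2l (sqr_ge0 w) (divdiff_ge er (lt _ n2)).
have d3 := ler_wpM2l (sqr_ge0 (v + w)) (divdiff_ge er (lt _ n3)).
apply: le_trans (lerD (lerD d1 d2) d3).
have kk := ler_wpM2l (ltW kap_gt0) k1.
apply: le_trans (_ : V * lam + 4 * a * (3 * eta ^+ 2 * V + 3 * eta * (z * V) + q * V / 2) -
   kap * (v ^+ 2 * (eta ^+ 2 + (eta + p * v) ^+ 2) + w ^+ 2 * (eta ^+ 2 + (eta + p * w) ^+ 2) +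
    (v + w) ^+ 2 * (eta ^+ 2 + (eta - p * (v + w)) ^+ 2)) <= _); first by rewrite lerD2l lerN2.
rewrite zE le_eqVlt; apply/orP; left; apply/eqP.
by rewrite /q /V /dirsq; field.
Qed.

(** The loss is quadratic in the distances, and the height is comparable to the same quadratic
    expression, so it becomes linear in the height. Capping the height at [lam / eps] keeps the
    right side at least [3 / 2] over [lam * dirsq 1 m], which covers the case where a ray has left
    the arc. *)
Lemma ray_density2_le_origin (x : R * R) (m : R) : `|x.1| < 3 * r -> 3 * g (x.1 / 3) <= x.2 ->
  ray_density2 g g1 g2 W x m <=
    (2 - eps / (2 * lam) * Num.min x.2 (lam / eps)) / (lam * dirsq 1 m).
Proof.
move=> xr gx; set eta := x.1 / 3.
have er : `|eta| < r by rewrite normrM [X in _ * X]ger0_norm// ltr_pdivrMr// mulrC.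
have V0 := dirsq1_gt0 m; set V := dirsq 1 m in V0 *.
have VN : dirsq (- 1) (- m) = V by rewrite dirsqN.
have lV : 0 < lam * V by rewrite mulr_gt0.
have e2l : 0 < eps / (2 * lam) by rewrite divr_gt0 ?mulr_gt0.
have min1 : eps / (2 * lam) * Num.min x.2 (lam / eps) <= 1 / 2.
  apply: le_trans (_ : eps / (2 * lam) * (lam / eps) <= _); first by rewrite ler_wpM2l ?(ltW e2l)// ge_min lexx orbT.
  by rewrite le_eqVlt; apply/orP; left; apply/eqP; field; rewrite !gt_eqF.
have single v w : dirsq v w = V -> ray_density g g1 g2 W v w x <= (3 / 2) / (lam * V).
  move=> vV; have vw : 0 < dirsq v w by rewrite vV.
  apply: le_trans (ray_density_le g dg1 lo_gt0 lo_le W_ge0 W_leC x vw) _.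
  rewrite vV ler_pdivrMr; last exact: mulr_gt0.
  (* The condition [kap_W] gives [C <= 21 / 20], and [(21 / 20) ^+ 3] is below [3 / 2 * (8 / 9)]. *)
  have C3 : C ^+ 3 <= 3 / 2 * (1 - kap ^+ 2).
    have C1 : 0 <= C <= 21 / 20.
      rewrite /C; apply/andP; split; last by have := kap_W; lra.
      by rewrite addr_ge0// mulr_ge0 ?(ltW kap_gt0)// addr_ge0// divr_ge0// sqr_ge0.
    case/andP: C1 => C0 C1; apply: le_trans (_ : (21 / 20) ^+ 3 <= _); first by rewrite ler_pXn2r ?nnegrE// divr_ge0.
    by have := kap2; rewrite !exprS !expr0; lra.
  have -> : 3 / 2 / (lam * V) * (lo * V) = 3 / 2 * (1 - kap ^+ 2).
    by rewrite /lo; field; rewrite !gt_eqF.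
  exact: C3.
pose p1 := rayinv g 1 m eta x.2; pose p2 := rayinv g (- 1) (- m) eta x.2.
(* If one of the two rays contributes nothing, the crude bound [3 / 2] for the other is already
   enough, since the capped loss is at most [1 / 2]. *)
have zero_case (k1 k2 : R) : k1 = 0 -> k2 <= 3 / 2 / (lam * V) ->
    k1 + k2 <= (2 - eps / (2 * lam) * Num.min x.2 (lam / eps)) / (lam * V).
  move=> -> h; rewrite add0r; apply: (le_trans h); rewrite ler_wpM2r ?invr_ge0 ?(ltW lV)//; lra.
have [w1|n1] := eqVneq (weight3 W eta 1 m p1) 0.
  by apply: zero_case; [rewrite /ray_density -/eta -/p1 w1 mul0r|exact: single].
have [w2|n2] := eqVneq (weight3 W eta (- 1) (- m) p2) 0.
  by rewrite /ray_density2 addrC; apply: zero_case; [rewrite /ray_density -/eta -/p2 w2 mul0r|exact: single].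
have V0' : 0 < dirsq (- 1) (- m) by rewrite VN.
have h1 := one_direction V0 er n1; have h2 := one_direction V0' er n2.
rewrite VN -/V in h1 h2.
have p10 : 0 <= p1 := rayinv_ge0 dg dg1 lo_gt0 lo_le V0 _ _.
have p20 : 0 <= p2 := rayinv_ge0 dg dg1 lo_gt0 lo_le V0' _ _.
have /andP[b1 b1'] := rayinv_bounds dg dg1 lo_gt0 lo_le le_hi V0 gx.
have /andP[b2 b2'] := rayinv_bounds dg dg1 lo_gt0 lo_le le_hi V0' gx.
rewrite VN -/eta -/p2 in b2 b2'; rewrite -/V -/eta -/p1 in b1 b1'.
set q1 := p1 ^+ 2 * V in h1; set q2 := p2 ^+ 2 * V in h2.
have q10 : 0 <= q1 by rewrite mulr_ge0 ?sqr_ge0// ltW.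
have q20 : 0 <= q2 by rewrite mulr_ge0 ?sqr_ge0// ltW.
(* Both rays reach the same height [x.2], and the two quadratic bounds on the height differ by
   factors [1 - kap ^+ 2] and [1 + kap ^+ 2] only. *)
have qq : `|q1 - q2| <= kap ^+ 2 * (q1 + q2).
  have c1 : lam * ((1 - kap ^+ 2) * q1) <= lam * ((1 + kap ^+ 2) * q2) by move: b1 b2'; rewrite /lo /hi /q1 /q2; lra.
  have c2 : lam * ((1 - kap ^+ 2) * q2) <= lam * ((1 + kap ^+ 2) * q1) by move: b2 b1'; rewrite /lo /hi /q1 /q2; lra.
  rewrite !(ler_pM2l lam_gt0) in c1 c2.
  by rewrite ler_norml; apply/andP; split; lra.
have skN : skew (- 1) (- m) = - skew 1 m by rewrite /skew VN -/V; field; rewrite gt_eqF.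
(* Because [skew] is odd, the sum is [(p1 - p2) * skew 1 m], and [(p1 - p2) ^+ 2] is at most
   [|p1 ^+ 2 - p2 ^+ 2|] for nonnegative radii. *)
have zz : (p1 * skew 1 m + p2 * skew (- 1) (- m)) ^+ 2 <= kap ^+ 2 * (q1 + q2).
  apply: le_trans qq; rewrite skN mulrN -mulrBl exprMn.
  have sV : skew 1 m ^+ 2 <= V by have := skew_le V0; have := sqr_ge0 (skew 1 m); rewrite -/V; lra.
  apply: (@le_trans _ _ ((p1 - p2) ^+ 2 * V)); first by rewrite ler_wpM2l ?sqr_ge0.
  rewrite /q1 /q2 -mulrBl normrM (gtr0_norm V0) ler_wpM2r ?(ltW V0)// subr_sqr normrM.
  rewrite -real_normK ?num_real// expr2 ler_wpM2l// ler_norml; rewrite (ger0_norm (addr_ge0 p10 p20)); apply/andP; split; lra.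
have := ray_density_pair_le lam_gt0 a_gt0 kap_gt0 q10 q20 zz h1 h2.
rewrite -mulrDr -/eps => h.
rewrite ler_pdivlMr// mulrC; apply: (le_trans h).
have S0 : 0 <= 6 * eta ^+ 2 + q1 + q2 by have := sqr_ge0 eta; lra.
have tS : x.2 <= lam * (6 * eta ^+ 2 + q1 + q2).
  have t1 : x.2 <= hi / 2 * (3 * eta ^+ 2 + q1) by move: b1' (g_le eta); rewrite /q1; lra.
  apply: (le_trans t1); apply: ler_pM.
  - by rewrite divr_ge0// /hi mulr_ge0 ?(ltW lam_gt0)// addr_ge0// sqr_ge0.
  - by have := sqr_ge0 eta; lra.
  - by have := hi_le; lra.
  - by have := sqr_ge0 eta; lra.
have hm : Num.min x.2 (lam / eps) <= lam * (6 * eta ^+ 2 + q1 + q2) by rewrite ge_min tS.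
have := ler_wpM2l (ltW e2l) hm.
have -> : eps / (2 * lam) * (lam * (6 * eta ^+ 2 + q1 + q2)) = eps / 2 * (6 * eta ^+ 2 + q1 + q2).
  by field; rewrite gt_eqF.
have := ler_wpM2r S0 kap_eps; lra.
Qed.

Let region0 : 3 * g (((0, 0) : R * R).1 / 3) <= ((0, 0) : R * R).2.
Proof. by rewrite /= mul0r g_0 mulr0. Qed.

Lemma ray_density2_origin m : ray_density2 g g1 g2 W (0, 0) m = 2 / (lam * dirsq 1 m).
Proof.
have one v w : dirsq v w = dirsq 1 m -> ray_density g g1 g2 W v w (0, 0) = 1 / (lam * dirsq 1 m).
  move=> vV; have vw : 0 < dirsq v w by rewrite vV dirsq1_gt0.
  have p0 : rayinv g v w 0 0 = 0.
    have := rayK dg dg1 lo_gt0 lo_le vw 0 (lexx 0); by rewrite ray0 g_0 mulr0.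
  rewrite /ray_density /= mul0r p0 /weight3 /slope /divdiff !mul0r subr0 addr0 W_0 eqxx g2_0 !mul1r.
  by rewrite -vV /dirsq; congr (_^-1); ring.
by rewrite /ray_density2 !one// ?dirsqN//; rewrite -mulrDl.
Qed.

Let integrable_rd := integrable_ray_density2 dg dg1 cg2 lo_gt0 lo_le mW W_ge0 W_leC.
Let integral_rd := integral_ray_density2 dg dg1 cg2 lo_gt0 lo_le mW W_ge0 W_leC W_off.
Let rd_ge0 := ray_density2_ge0 g dg1 lo_gt0 lo_le W_ge0.

Lemma conv3_origin_gt0 : 0 < conv3 g g1 g2 W r (0, 0).
Proof.
rewrite -lte_fin -(integral_rd region0).
have l3 : 0 < (3 * lam)^-1 by rewrite invr_gt0 mulr_gt0.
apply: (@lt_le_trans _ _ (\int[leb]_(m in `[0%R, 1%R]) ((3 * lam)^-1)%:E)%E).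
  by rewrite integral_cst//= lebesgue_measure_itv/= lte01 oppr0 adde0 mule1 lte_fin.
have mrd : measurable_fun setT (fun m => (ray_density2 g g1 g2 W (0, 0) m)%:E).
  by case/integrableP: (integrable_rd (0, 0)).
apply: (@le_trans _ _ (\int[leb]_(m in `[0%R, 1%R]) (ray_density2 g g1 g2 W (0, 0) m)%:E)%E).
  apply: ge0_le_integral => //.
  - by move=> m _; rewrite lee_fin ltW.
  - exact: measurable_funTS.
  - move=> m /=; rewrite in_itv/= => /andP[m0 m1]; rewrite lee_fin ray_density2_origin.
    rewrite ler_pdivlMr ?mulr_gt0 ?dirsq1_gt0// mulrC ler_pdivrMr ?mulr_gt0//.
    have : m * m <= 1 by rewrite mulr_ile1.
    have : dirsq 1 m <= 6 -> lam * dirsq 1 m <= 2 * (3 * lam) by move=> h; have := ler_wpM2l (ltW lam_gt0) h; lra.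
    by move=> h mm; apply: h; rewrite /dirsq !expr2; lra.
by apply: ge0_subset_integral => // m _; rewrite lee_fin rd_ge0.
Qed.

(** The factor in [ray_density2_le_origin] does not depend on the slope, so integrating against the
    exact value at the origin preserves it. The maximum with 0 gives the bound a meaning below
    height 0, where the density vanishes. *)
Lemma conv3_le (x : R * R) : conv3 g g1 g2 W r x <=
  conv3 g g1 g2 W r (0, 0) * (1 - eps / (4 * lam) * Num.min (Num.max x.2 0) (lam / eps)).
Proof.
have e4 : 0 < eps / (4 * lam) by rewrite divr_gt0 ?mulr_gt0.
have le1 : 0 <= 1 - eps / (4 * lam) * Num.min (Num.max x.2 0) (lam / eps).
  rewrite subr_ge0; apply: le_trans (_ : eps / (4 * lam) * (lam / eps) <= _); first by rewrite ler_wpM2l ?(ltW e4)// ge_min lexx orbT.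
  have -> : eps / (4 * lam) * (lam / eps) = 1 / 4 by field; rewrite !gt_eqF.
  lra.
have [[xr gx]|nx] := pselect (conv3_region g r x); last first.
  by rewrite (conv3_off _ _ _ nx); apply: mulr_ge0 => //; exact: ltW conv3_origin_gt0.
have x20 : 0 <= x.2 by apply: le_trans gx; rewrite mulr_ge0.
rewrite (max_idPl x20) in le1 *.
rewrite -lee_fin EFinM -(integral_rd gx) -(integral_rd region0) muleC -ge0_integralZl//; last 2 first.
- by case/integrableP: (integrable_rd (0, 0)).
- by move=> m _; rewrite lee_fin rd_ge0.
apply: ge0_le_integral => //.
- by move=> m _; rewrite lee_fin rd_ge0.
- by case/integrableP: (integrable_rd x).
- by apply: measurable_funeM; case/integrableP: (integrable_rd (0, 0)).
- move=> m _; rewrite -EFinM lee_fin ray_density2_origin; apply: (le_trans (ray_density2_le_origin m xr gx)).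
  rewrite le_eqVlt; apply/orP; left; apply/eqP.
  by field; rewrite !gt_eqF// dirsq1_gt0.
Qed.

End estimate.

(** * Derivatives of a function that is flat to fifth order *)

Lemma is_derive_exprn {R : realType} (n : nat) (x : R) :
  is_derive x 1 (fun t : R => t ^+ n.+1) (n.+1%:R * x ^+ n).
Proof.
by apply: DeriveDef; [exact: exprn_derivable|rewrite exp_derive /GRing.scale/= mulr1].
Qed.

(** A one-sided Taylor bound at nonnegative arguments. Upper bounds and negative arguments are
    obtained by applying it to the opposites and the reflections of the family [D]. *)
Lemma taylor_lower {R : realType} (D : nat -> R -> R) (d : R) :
  (forall i (y : R), 0 <= y <= d -> is_derive y 1 (D i) (D i.+1 y)) ->
  forall n k c, (forall i, (i < n)%N -> D (k + i)%N 0 = 0) ->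
    (forall y : R, 0 <= y <= d -> c <= D (k + n)%N y) ->
    forall y : R, 0 <= y <= d -> c * y ^+ n / n`!%:R <= D k y.
Proof.
move=> dD; elim=> [|n IH] k c D0 cD y /andP[y0 yd].
  by rewrite expr0 mulr1 fact0 divr1; apply: le_trans (cD y _) _; rewrite ?addn0// y0.
have h (t : R) : 0 <= t <= d -> c * t ^+ n / n`!%:R <= D k.+1 t.
  apply: IH => [i im|t' ht']; first by rewrite addSnnS D0.
  by rewrite addSnnS; exact: cD.
move: y0; rewrite le_eqVlt => /predU1P[<-|y0].
  by rewrite expr0n/= mulr0 mul0r; have := D0 0%N isT; rewrite addn0 => ->.
pose F (t : R) := D k t - c / n.+1`!%:R * t ^+ n.+1.
have f0 : n`!%:R != 0 :> R by rewrite pnatr_eq0 -lt0n fact_gt0.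
have dF (t : R) : 0 <= t <= d -> is_derive t 1 F (D k.+1 t - c * t ^+ n / n`!%:R).
  move=> ht; have dk := dD k t ht.
  have dZ := is_deriveZ (c / n.+1`!%:R) (is_derive_exprn n t).
  apply: (is_derive_eq (is_deriveB dk dZ)); rewrite /GRing.scale/= factS natrM; congr (_ - _).
  have n0 : n.+1%:R != 0 :> R by rewrite pnatr_eq0.
  move: (n.+1%:R : R) (n`!%:R : R) (t ^+ n) n0 f0 => u w z u0 w0.
  by field; rewrite u0 w0.
have cF : {within `[0, y], continuous F}.
  apply: derivable_within_continuous => t; rewrite in_itv/= => /andP[t0 ty].
  by case: (dF t _) => //; rewrite t0 (le_trans ty).
have dF' (t : R) : t \in `]0, y[ -> is_derive t 1 F (D k.+1 t - c * t ^+ n / n`!%:R).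
  by rewrite in_itv/= => /andP[t0 ty]; apply: dF; rewrite (ltW t0) (le_trans (ltW ty)).
have [t] := MVT y0 dF' cF.
rewrite in_itv/= => /andP[t0 ty] E.
have : 0 <= F y - F 0.
  rewrite E subr0 mulr_ge0 ?(ltW y0)// subr_ge0; apply: h.
  by rewrite (ltW t0) (le_trans (ltW ty)).
rewrite /F expr0n/= mulr0 subr0; have := D0 0%N isT; rewrite addn0 => ->.
by rewrite subr0 subr_ge0 mulrAC.
Qed.

Section flat_function.
Context {R : realType}.
Variables (D : nat -> R -> R) (e : R).
Hypothesis e_gt0 : 0 < e.
Hypothesis dD : forall i (y : R), `|y| < e -> is_derive y 1 (D i) (D i.+1 y).

Let cD i (y : R) : `|y| < e -> D i z @[z --> y] --> D i y.
Proof. by move=> ye; apply: differentiable_continuous; apply/derivable1_diffP; case: (dD i ye). Qed.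

(** If the derivative of order [i < 5] were the first not to vanish, [taylor_lower] would bound the
    function from below by a multiple of [y ^+ i], against the fifth-order upper bound. Applied to
    [D] and to its opposite, the claim excludes both signs. *)
Lemma flat_derivatives (K : R) :
  (\forall y \near (0 : R), `|D 0%N y| <= K * `|y| ^+ 5) -> forall i, (i < 5)%N -> D i 0 = 0.
Proof.
move=> /nbhs_ballP[e1 /= e10 hK].
suff claim (E : nat -> R -> R) : (forall i (y : R), `|y| < e -> is_derive y 1 (E i) (E i.+1 y)) ->
    (forall y, `|y| < e1 -> E 0%N y <= K * `|y| ^+ 5) ->
    forall i, (i < 5)%N -> (forall j, (j < i)%N -> E j 0 = 0) -> E i 0 <= 0.
  elim/ltn_ind => i IH i5; have h j : (j < i)%N -> D j 0 = 0 by move=> ji; apply: IH => //; exact: ltn_trans ji i5.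
  have hK' y : `|y| < e1 -> `|D 0%N y| <= K * `|y| ^+ 5 by move=> ye; apply: hK; rewrite /ball/= sub0r normrN.
  apply/eqP; rewrite eq_le; apply/andP; split.
    by apply: claim => // y /hK'; apply: le_trans; exact: ler_norm.
  rewrite -oppr_le0; apply: (claim (fun i y => - D i y)) => //.
  - by move=> j y ye; have := dD j ye => dj; exact: is_deriveN.
  - by move=> y /hK'; apply: le_trans; rewrite -normrN ler_norm.
  - by move=> j ji; rewrite h// oppr0.
move=> dE hE i i5 E0; rewrite leNgt; apply/negP => ci; set c := E i 0 in ci.
have cE : E i z @[z --> (0 : R)] --> E i 0.
  by apply: differentiable_continuous; apply/derivable1_diffP; case: (dE i 0 _) => //; rewrite normr0.
have c2 : 0 < c / 2 by rewrite divr_gt0.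
have : \forall z \near (0 : R), `|E i 0 - E i z| < c / 2 by have h := (@cvgrPdist_lt _ _ _ _ _ _ _).1 cE; exact: h c2.
move=> /nbhs_ballP[e2 /= e20 he2].
pose d := Num.min (e / 2) (Num.min (e1 / 2) (e2 / 2)).
have half (u : R) : 0 < u -> u / 2 < u by move=> u0; rewrite ltr_pdivrMr// ltr_pMr// ltr1n.
have d0 : 0 < d by rewrite !lt_min !divr_gt0.
have de : d < e by apply: le_lt_trans (half _ e_gt0); rewrite ge_min lexx.
have de1 : d < e1 by apply: le_lt_trans (half _ e10); rewrite !ge_min lexx orbT.
have de2 : d < e2 by apply: le_lt_trans (half _ e20); rewrite !ge_min lexx !orbT.
clearbody d.
have low (y : R) : 0 <= y <= d -> c / 2 * y ^+ i / i`!%:R <= E 0%N y.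
  apply: (@taylor_lower _ E d _ i 0 (c / 2)) => [j t /andP[t0 td]|j ji|t /andP[t0 td]].
  - by apply: dE; rewrite ger0_norm// (le_lt_trans td).
  - by rewrite add0n E0.
  - have : `|E i 0 - E i t| < c / 2 by apply: he2; rewrite /ball/= sub0r normrN ger0_norm// (le_lt_trans td).
    by rewrite add0n ltr_norml -/c => /andP[_]; lra.
have f0 : 0 < i`!%:R :> R by rewrite ltr0n fact_gt0.
pose K1 : R := `|K| + 1; pose q : R := c / 2 / i`!%:R.
have q0 : 0 < q by rewrite divr_gt0.
have K10 : 0 < K1 by rewrite ltr_wpDl.
(* Small enough that [K1 * y <= q / 2], which contradicts [q * y ^+ i <= K1 * y ^+ 5] since [y <= 1]
   and [i < 5]; [K1] is positive whatever the sign of [K]. *)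
pose y := Num.min d (Num.min 1 (q / (2 * K1))).
have y0 : 0 < y by rewrite !lt_min d0 ltr01 divr_gt0// mulr_gt0.
have yd : y <= d by rewrite ge_min lexx.
have y1 : y <= 1 by rewrite !ge_min lexx orbT.
have yq : y * K1 <= q / 2.
  have : y <= q / (2 * K1) by rewrite !ge_min lexx !orbT.
  by rewrite ler_pdivlMr ?mulr_gt0//; lra.
have := low y; rewrite (ltW y0) yd => /(_ isT) l.
have := hE y; rewrite ger0_norm ?(ltW y0)// => /(_ (le_lt_trans yd de1)) u.
have : q * y ^+ i <= K1 * y ^+ 5.
  apply: le_trans (_ : K * y ^+ 5 <= _).
    by apply: le_trans u; rewrite /q mulrAC.
  by rewrite ler_wpM2r ?exprn_ge0 ?(ltW y0)// /K1 (le_trans (ler_norm K))// lerDl.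
have -> : (5 = i + (4 - i).+1)%N by rewrite -subSn// addnC subnK// ltnW.
rewrite exprD mulrCA [leLHS]mulrC ler_pM2l ?exprn_gt0//.
have : y ^+ (4 - i).+1 <= y by rewrite exprS ler_piMr ?(ltW y0)// exprn_ile1// ltW.
move=> h; have := ler_wpM2l (ltW K10) h; move: yq q0; rewrite (mulrC y).
lra.
Qed.

(** The fourth derivative is continuous and vanishes at 0, so it is below any [k] nearby, and two
    integrations bound the second derivative by [k * y ^+ 2]. The four families [D], its opposite,
    its reflection and the opposite of that give both signs at both sides of 0. *)
Lemma flat_second_derivative (k : R) : 0 < k -> (forall i, (i < 5)%N -> D i 0 = 0) ->
  exists2 d, 0 < d & forall y, `|y| < d -> `|D 2 y| <= k * y ^+ 2.
Proof.
move=> k0 D0.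
have cE : D 4 z @[z --> (0 : R)] --> D 4 0 by apply: cD; rewrite normr0.
have : \forall z \near (0 : R), `|D 4 0 - D 4 z| < k by have h := (@cvgrPdist_lt _ _ _ _ _ _ _).1 cE; exact: h k0.
move=> /nbhs_ballP[e2 /= e20 he2]; pose d := Num.min e e2 / 2.
have m0 : 0 < Num.min e e2 by rewrite lt_min e_gt0.
have d0 : 0 < d by rewrite divr_gt0.
have dm : d < Num.min e e2 by rewrite ltr_pdivrMr// ltr_pMr// ltr1n.
have de : d < e by apply: lt_le_trans dm _; rewrite ge_min lexx.
have de2 : d < e2 by apply: lt_le_trans dm _; rewrite ge_min lexx orbT.
have D4 (y : R) : `|y| < e2 -> `|D 4 y| < k.
  by move=> ye; have := he2 y; rewrite /ball/= !sub0r normrN => /(_ ye); rewrite (D0 4)// sub0r normrN.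
have claim (E : nat -> R -> R) : (forall i (y : R), `|y| < e -> is_derive y 1 (E i) (E i.+1 y)) ->
    (forall i, (i < 5)%N -> E i 0 = 0) -> (forall y, `|y| < e2 -> - k <= E 4 y) ->
    forall y, 0 <= y < d -> - (k * y ^+ 2) <= E 2 y.
  move=> dE E0 E4 y /andP[y0 yd].
  apply: le_trans (@taylor_lower _ E d _ 2 2 (- k) _ _ y _).
  - rewrite !mulNr lerN2 ler_pdivrMr// ler_peMr ?ler1n// mulr_ge0 ?sqr_ge0 ?ltW//.
  - by move=> i t /andP[t0 td]; apply: dE; rewrite ger0_norm// (le_lt_trans td).
  - by case=> [|[|]] // _; exact: E0.
  - by move=> t /andP[t0 td]; apply: E4; rewrite ger0_norm// (le_lt_trans td).
  - by rewrite y0 ltW.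
exists d => // y yd.
have D4' y' : `|y'| < e2 -> - k <= D 4 y' <= k by move/D4; rewrite ltr_norml => /andP[/ltW -> /ltW ->].
have dN i (y' : R) : `|y'| < e -> is_derive y' 1 (fun y => - D i y) (- D i.+1 y').
  by move=> ye; have di := dD i ye; exact: is_deriveN.
have dR i (y' : R) : `|y'| < e -> is_derive y' 1 (fun y => (-1) ^+ i * D i (- y)) ((-1) ^+ i.+1 * D i.+1 (- y')).
  move=> ye; have di : is_derive (- y') 1 (D i) (D i.+1 (- y')) by apply: dD; rewrite normrN.
  have h := @is_derive1_comp _ (D i) -%R y' _ _ di _.
  apply: is_derive_eq; last by rewrite exprS mulN1r /GRing.scale/= mulrN1 mulrN mulNr.
have dRN i (y' : R) : `|y'| < e -> is_derive y' 1 (fun y => - ((-1) ^+ i * D i (- y))) (- ((-1) ^+ i.+1 * D i.+1 (- y'))).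
  by move=> ye; have di := dR i _ ye; exact: is_deriveN.
rewrite ler_norml; have [y0|y0] := leP 0 y.
  rewrite ger0_norm// in yd.
  apply/andP; split.
    by apply: (claim D) => //; [move=> t /D4'/andP[]|rewrite y0].
  have := claim _ dN _ _ y; rewrite lerN2; apply.
  - by move=> i i5; rewrite D0// oppr0.
  - by move=> t /D4'/andP[_]; rewrite lerN2.
  - by rewrite y0.
rewrite ltr0_norm// in yd.
have y0' : 0 <= - y < d by rewrite yd oppr_ge0 ltW.
have S2 : (-1) ^+ 2 = 1 :> R by rewrite sqrrN expr1n.
have S4 : (-1) ^+ 4 = 1 :> R by rewrite -signr_odd.
have h1 i : (i < 5)%N -> (-1) ^+ i * D i (- 0) = 0 by move=> i5; rewrite oppr0 D0// mulr0.
have h2 t : `|t| < e2 -> - k <= (-1) ^+ 4 * D 4 (- t) <= k.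
  by move=> te; rewrite S4 mul1r D4'// normrN.
apply/andP; split.
  have := claim _ dR h1 (fun t te => (andP (h2 t te)).1) _ y0'.
  by rewrite S2 mul1r opprK sqrrN.
have h3 i : (i < 5)%N -> - ((-1) ^+ i * D i (- 0)) = 0 by move=> i5; rewrite h1// oppr0.
have h4 t : `|t| < e2 -> - k <= - ((-1) ^+ 4 * D 4 (- t)) by move=> te; rewrite lerN2; case/andP: (h2 t te).
have := claim _ dRN h3 h4 _ y0'.
by rewrite S2 mul1r opprK sqrrN lerN2.
Qed.

End flat_function.

(** * Extension of the curve to the whole line *)

Lemma is_derive_glue {R : realType} (f f1 f2 : R -> R) (c y d : R) :
  (forall t, t <= c -> f t = f1 t) -> (forall t, c <= t -> f t = f2 t) ->
  (y <= c -> is_derive y 1 f1 d) -> (c <= y -> is_derive y 1 f2 d) ->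
  is_derive y 1 f d.
Proof.
move=> ff1 ff2 d1 d2.
pose q (u : R -> R) (h : R) := h^-1 *: ((u \o shift y) (h *: 1) - u y).
have qd u : is_derive y 1 u d -> q u h @[h --> (0 : R)^'] --> d.
  by move=> [du <-]; exact: du.
suff cq : q f h @[h --> (0 : R)^'] --> d by apply: DeriveDef; [exact: cvgP cq|exact: cvg_lim cq].
apply/cvgrPdist_lt => e e0.
have F0 : Filter ((0 : R)^') by exact: filter_filter.
have n1 : \forall h \near (0 : R)^', y <= c -> `|d - q f1 h| < e.
  have [yc|yc] := leP y c; last by apply: (@nearW _ _ _ F0) => h.
  have h1 := (@cvgrPdist_lt _ _ _ _ _ _ _).1 (qd _ (d1 yc)).
  by apply: (@filterS _ _ F0 _ _ _ (h1 _ e e0)) => h hh _.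
have n2 : \forall h \near (0 : R)^', c <= y -> `|d - q f2 h| < e.
  have [yc|yc] := leP c y; last by apply: (@nearW _ _ _ F0) => h.
  have h1 := (@cvgrPdist_lt _ _ _ _ _ _ _).1 (qd _ (d2 yc)).
  by apply: (@filterS _ _ F0 _ _ _ (h1 _ e e0)) => h hh _.
(* Below this radius [y + h] stays on the side of [c] on which [y] lies. At the junction [y = c] any
   radius will do, because both one-sided descriptions have derivative [d]. *)
pose rho : R := if y == c then 1 else `|y - c|.
have rho0 : 0 < rho by rewrite /rho; case: eqVneq => // yc; rewrite normr_gt0 subr_eq0.
near=> h.
have hr : `|h| < rho by near: h; exact: dnbhs0_lt.
have q1 : y <= c -> y + h <= c -> q f h = q f1 h.
  by move=> yc hc; rewrite /q/= /shift/= ff1// ?ff1//; rewrite /GRing.scale/= mulr1 addrC.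
have q2 : c <= y -> c <= y + h -> q f h = q f2 h.
  by move=> yc hc; rewrite /q/= /shift/= ff2// ?ff2//; rewrite /GRing.scale/= mulr1 addrC.
have N1 : y <= c -> `|d - q f1 h| < e by near: h.
have N2 : c <= y -> `|d - q f2 h| < e by near: h.
move: hr; rewrite /rho ltr_norml; have [yc|yc|yc] := ltgtP y c.
- rewrite ltr0_norm ?subr_lt0// => /andP[_ hr]; rewrite q1 ?N1// ?ltW//; lra.
- rewrite gtr0_norm ?subr_gt0// => /andP[hr _]; rewrite q2 ?N2// ?ltW//; lra.
- move=> _; have [h0|h0] := leP h 0.
    by rewrite q1 ?N1 ?yc//; lra.
  by rewrite q2 ?N2 ?yc//; lra.
Unshelve. all: by end_near.
Qed.

Section extension.
Context {R : realType}.
Variable rho : R.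
Hypothesis rho_gt0 : 0 < rho.

Definition extend (L f U : R -> R) (y : R) : R :=
  if y <= - rho then L y else if y <= rho then f y else U y.

Lemma extendE L f U y : L (- rho) = f (- rho) -> `|y| <= rho -> extend L f U y = f y.
Proof.
move=> Lf; rewrite ler_norml /extend => /andP[y1 ->]; have [y2|//] := leP y (- rho).
by have -> : y = - rho by apply/eqP; rewrite eq_le y2.
Qed.

Lemma is_derive_extend (L L1 f f1 U U1 : R -> R) :
  (forall y : R, `|y| <= rho -> is_derive y 1 f (f1 y)) ->
  (forall y : R, is_derive y 1 L (L1 y)) -> (forall y : R, is_derive y 1 U (U1 y)) ->
  L (- rho) = f (- rho) -> L1 (- rho) = f1 (- rho) -> U rho = f rho -> U1 rho = f1 rho ->
  forall y : R, is_derive y 1 (extend L f U) (extend L1 f1 U1 y).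
Proof.
move=> df dL dU Lf Lf1 Uf Uf1 y.
have rr : - rho < rho by have := rho_gt0; lra.
apply: (@is_derive_glue _ _ L (fun t => if t <= rho then f t else U t) (- rho)).
- by move=> t tr; rewrite /extend tr.
- move=> t tr; rewrite /extend; have [t2|//] := leP t (- rho).
  have -> : t = - rho by apply/eqP; rewrite eq_le t2.
  by rewrite (ltW rr).
- by move=> yr; rewrite /extend yr.
- move=> yr; apply: (@is_derive_glue _ _ f U rho).
  + by move=> t ->.
  + move=> t tr; have [t2|//] := leP t rho.
    by have -> : t = rho by apply/eqP; rewrite eq_le t2.
  + move=> yr'; rewrite extendE//; last by rewrite ler_norml yr.
    by apply: df; rewrite ler_norml yr.
  + move=> yr'; have -> : extend L1 f1 U1 y = U1 y; last exact: dU.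
    rewrite /extend [y <= - rho]leNgt (lt_le_trans rr yr')/=; have [t2|//] := leP y rho.
    by have -> : y = rho by apply/eqP; rewrite eq_le t2.
Qed.

(** The second derivative is continued by its values at the ends, hence the curve by parabolas.
    Every value of [G2] is a value of [h2] on the original interval, so bounds on the second
    derivative become global and rays never leave the domain. *)
Lemma extend_curve (h h1 h2 : R -> R) :
  (forall y : R, `|y| <= rho -> is_derive y 1 h (h1 y)) ->
  (forall y : R, `|y| <= rho -> is_derive y 1 h1 (h2 y)) ->
  (forall y : R, `|y| <= rho -> h2 z @[z --> y] --> h2 y) ->
  exists G G1 G2 : R -> R,
    [/\ forall y : R, is_derive y 1 G (G1 y), forall y : R, is_derive y 1 G1 (G2 y), continuous G2,
        forall y, `|y| <= rho -> [/\ G y = h y, G1 y = h1 y & G2 y = h2 y] &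
        forall y, exists2 c, `|c| <= rho & G2 y = h2 c].
Proof.
move=> dh dh1 ch2.
pose lin (c y : R) := h1 c + h2 c * (y - c).
pose quad (c y : R) := h c + h1 c * (y - c) + h2 c / 2 * (y - c) ^+ 2.
have dlin (c y : R) : is_derive y 1 (lin c) (h2 c).
  by apply: is_derive_eq; rewrite /GRing.scale/=; ring.
have dquad (c y : R) : is_derive y 1 (quad c) (lin c y).
  by apply: is_derive_eq; rewrite /GRing.scale/= /lin; field.
pose G2 := extend (fun=> h2 (- rho)) h2 (fun=> h2 rho).
have rN : `|- rho| <= rho by rewrite normrN gtr0_norm.
have rP : `|rho| <= rho by rewrite gtr0_norm.
pose clamp (y : R) := Num.max (- rho) (Num.min y rho).
have clampP y : `|clamp y| <= rho.
  by rewrite ler_norml /clamp le_max lexx ge_max ge_min lexx orbT andbT; have := rho_gt0; lra.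
have G2E y : G2 y = h2 (clamp y).
  rewrite /G2 /extend /clamp; have rr : - rho <= rho by have := rho_gt0; lra.
  have [yr|yr] := leP y (- rho).
    by rewrite (min_idPl (le_trans yr rr)) (max_idPl yr).
  have [yr'|yr'] := leP y rho; first by rewrite (max_idPr (ltW yr)).
  by rewrite (max_idPr rr).
exists (extend (quad (- rho)) h (quad rho)), (extend (lin (- rho)) h1 (lin rho)), G2; split.
- by apply: is_derive_extend => //; rewrite /quad /lin ?subrr; ring.
- by apply: is_derive_extend => //; rewrite /lin ?subrr; ring.
- have -> : G2 = h2 \o clamp by apply/funext => y; exact: G2E.
  move=> y; apply: (@cvg_comp _ _ _ clamp h2 (nbhs y) (nbhs (clamp y))); last exact: ch2.
  have cc : continuous (fun y : R => Num.max (- rho) (Num.min y rho)); last exact: cc.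
  move=> z; apply: (@continuous_max _ _ (fun=> - rho) (fun y : R => Num.min y rho) z); first exact: cvg_cst.
  by apply: (@continuous_min _ _ idfun (fun=> rho) z); [exact: cvg_id|exact: cvg_cst].
- move=> y yr; split; [| |by rewrite /G2 extendE].
    by rewrite extendE// /quad subrr; ring.
  by rewrite extendE// /lin subrr; ring.
- by move=> y; exists (clamp y).
Qed.

End extension.

(** The quadratic part contributes [lam] to the divided difference of the slope and the quartic part
    [4 * a * (eta ^+ 2 + eta * y + y ^+ 2)], exactly; [phi] only costs [kap * (eta ^+ 2 + y ^+ 2)],
    since its second derivative is at most [kap * c ^+ 2]. *)
Lemma perturbed_curve {R : realType} (lam a : R) (phi : R -> R) (kap : R) :
  0 < lam -> 0 < a -> 0 < kap -> smooth_near phi 0 ->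
  phi =O_ (0 : R) (fun y : R => `|y| ^+ 5) ->
  let g := fun y : R => lam / 2 * y ^+ 2 + a * y ^+ 4 + phi y in
  exists2 rho, 0 < rho & exists G G1 G2 : R -> R,
  [/\ [/\ forall y : R, is_derive y 1 G (G1 y), forall y : R, is_derive y 1 G1 (G2 y) & continuous G2],
      forall y, lam * (1 - kap ^+ 2) <= G2 y <= lam * (1 + kap ^+ 2),
      [/\ G 0 = 0, G1 0 = 0 & G2 0 = lam],
      forall y : R, `|y| <= rho -> G y = g y /\ is_derive y 1 g (G1 y) &
      forall eta y, `|eta| <= rho -> `|y| <= rho ->
        lam + 4 * a * (eta ^+ 2 + eta * y + y ^+ 2) - kap * (eta ^+ 2 + y ^+ 2) <= divdiff G1 G2 eta y].
Proof.
move=> lam0 a0 kap0 /nbhs_ballP[e /= e0 he] /eqOP[k0 [_ hk]].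
pose g := fun y : R => lam / 2 * y ^+ 2 + a * y ^+ 4 + phi y.
pose D i := derive1n i phi.
have dD i (y : R) : `|y| < e -> is_derive y 1 (D i) (D i.+1 y).
  move=> ye; have dphi : derivable (derive1n i phi) y 1 by apply: he; rewrite /ball/= sub0r normrN.
  by apply: DeriveDef; [exact: dphi|rewrite /D derive1nS derive1E].
have hK : \forall y \near (0 : R), `|D 0%N y| <= (k0 + 1) * `|y| ^+ 5.
  have := hk (k0 + 1); rewrite ltrDl => /(_ ltr01); apply: filterS => y.
  by rewrite [X in _ <= _ * X]ger0_norm// exprn_ge0.
have D0 := flat_derivatives e0 dD hK.
have [d d0 D2] := flat_second_derivative e0 dD kap0 D0.
have m0 : 0 < 12 * a + kap by rewrite addr_gt0// mulr_gt0.
(* The last entry, with [rho <= 1], makes [12 * a * c ^+ 2 + kap * c ^+ 2] at most [lam * kap ^+ 2]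
   for [|c| <= rho], as the two-sided bound on [G2] requires. *)
pose rho : R := Num.min (Num.min (e / 2) (d / 2)) (Num.min 1 (lam * kap ^+ 2 / (12 * a + kap))).
have rho0 : 0 < rho by rewrite !lt_min !divr_gt0 ?ltr01//= mulr_gt0// exprn_gt0.
have half (u : R) : 0 < u -> u / 2 < u by move=> u0; rewrite ltr_pdivrMr// ltr_pMr// ltr1n.
have re : rho < e by apply: le_lt_trans (half _ e0); rewrite !ge_min lexx.
have rd : rho < d by apply: le_lt_trans (half _ d0); rewrite !ge_min lexx orbT.
have r1 : rho <= 1 by rewrite !ge_min lexx !orbT.
have rk : (12 * a + kap) * rho <= lam * kap ^+ 2.
  by rewrite mulrC -ler_pdivlMr// !ge_min lexx !orbT.
clearbody rho.
pose h1 (y : R) := lam * y + 4 * a * y ^+ 3 + D 1%N y.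
pose h2 (y : R) := lam + 12 * a * y ^+ 2 + D 2%N y.
have dh (y : R) : `|y| <= rho -> is_derive y 1 g (h1 y).
  move=> yr; have dp := dD 0%N y (le_lt_trans yr re).
  apply: (is_derive_eq (is_deriveD (is_deriveD (is_deriveZ (lam / 2) (is_derive_exprn 1 y))
    (is_deriveZ a (is_derive_exprn 3 y))) dp)).
  by rewrite /h1 /GRing.scale/= expr1; congr (_ + _); field.
have dh1 (y : R) : `|y| <= rho -> is_derive y 1 h1 (h2 y).
  move=> yr; have dp := dD 1%N y (le_lt_trans yr re).
  apply: (is_derive_eq (is_deriveD (is_deriveD (is_deriveZ lam (is_derive_id y 1))
    (is_deriveZ (4 * a) (is_derive_exprn 2 y))) dp)).
  by rewrite /h2 /GRing.scale/=; congr (_ + _); ring.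
have ch2 (y : R) : `|y| <= rho -> h2 z @[z --> y] --> h2 y.
  move=> yr; have dp := dD 2%N y (le_lt_trans yr re).
  have [dd _] := is_deriveD (is_deriveD (is_derive_cst lam y 1)
    (is_deriveZ (12 * a) (is_derive_exprn 1 y))) dp.
  by apply: differentiable_continuous; apply/derivable1_diffP.
have [G [G1 [G2 [dG dG1 cG2 GE G2E]]]] := extend_curve rho0 dh dh1 ch2.
exists rho; first exact: rho0.
exists G, G1, G2; split; first by split; [exact: dG|exact: dG1|exact: cG2].
- move=> y; have [c cr ->] := G2E y.
  have := D2 c (le_lt_trans cr rd); rewrite ler_norml => /andP[l u].
  have c2 : c ^+ 2 <= rho.
    rewrite -real_normK ?num_real// expr2; apply: le_trans (_ : rho * 1 <= _); last by rewrite mulr1.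
    by apply: ler_pM => //; exact: le_trans cr r1.
  have := ler_wpM2l (ltW m0) c2; have := mulr_ge0 (ltW a0) (sqr_ge0 c); have := mulr_ge0 (ltW kap0) (sqr_ge0 c).
  by rewrite /h2; move=> *; apply/andP; split; lra.
- have n0 : `|0 : R| <= rho by rewrite normr0 ltW.
  have [-> -> ->] := GE 0 n0; rewrite /g /h1 /h2 -[phi]/(D 0%N) !D0//; split; rewrite ?expr0n/=; ring.
- by move=> y yr; have [-> -> _] := GE y yr; split; [reflexivity|exact: dh].
- move=> eta y er yr; rewrite /divdiff; have [<-|yeta] := eqVneq y eta.
    have [_ _ ->] := GE y yr; have := D2 y (le_lt_trans yr rd); rewrite ler_norml => /andP[l _].
    by have := mulr_ge0 (ltW kap0) (sqr_ge0 y); rewrite /h2; lra.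
  have [_ -> _] := GE y yr; have [_ -> _] := GE eta er.
  (* A point between [eta] and [y] has its square below the square of the endpoint on its own side
     of 0, hence below the sum of the two squares. *)
  have mvt : exists2 c, c ^+ 2 <= eta ^+ 2 + y ^+ 2 /\ `|c| <= rho & D 1%N y - D 1%N eta = D 2%N c * (y - eta).
    have main (u v : R) : `|u| <= rho -> `|v| <= rho -> u < v ->
        exists2 c, c ^+ 2 <= u ^+ 2 + v ^+ 2 /\ `|c| <= rho & D 1%N v - D 1%N u = D 2%N c * (v - u).
      rewrite !ler_norml => /andP[u1 u2] /andP[v1 v2] uv.
      have dI (t : R) : u <= t <= v -> is_derive t 1 (D 1%N) (D 2%N t).
        by move=> /andP[ut tv]; apply: dD; apply: le_lt_trans re; rewrite ler_norml; apply/andP; split; lra.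
      have dI' (t : R) : t \in `]u, v[ -> is_derive t 1 (D 1%N) (D 2%N t).
        by rewrite in_itv/= => /andP[ut tv]; apply: dI; rewrite !ltW.
      have cI : {within `[u, v], continuous (D 1%N)}.
        by apply: derivable_within_continuous => t; rewrite in_itv/= => ht; case: (dI t ht).
      have [c] := MVT uv dI' cI; rewrite in_itv/= => /andP[uc cv] E; exists c => //; split.
        have [c0|c0] := leP 0 c.
          have := sqr_ge0 u; have : c * c <= v * v by apply: ler_pM => //; exact: ltW.
          by rewrite !expr2; lra.
        have := sqr_ge0 v; have : (- c) * (- c) <= (- u) * (- u).
          by apply: ler_pM; rewrite ?oppr_ge0 ?lerN2; exact: ltW.
        by rewrite !expr2; lra.
      by rewrite ler_norml; apply/andP; split; lra.
    move: yeta; rewrite neq_lt => /orP[h|h].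
      have [c [h3 h4] h5] := main _ _ yr er h; exists c; first by rewrite addrC.
      by rewrite -opprB h5; ring.
    exact: main.
  have [c [c2 cr] E] := mvt.
  have := D2 c (le_lt_trans cr rd); rewrite ler_norml => /andP[l _].
  have -> : (h1 y - h1 eta) / (y - eta) = lam + 4 * a * (eta ^+ 2 + eta * y + y ^+ 2) + D 2%N c.
    have -> : h1 y - h1 eta = (lam + 4 * a * (eta ^+ 2 + eta * y + y ^+ 2) + D 2%N c) * (y - eta).
      by rewrite mulrDl -E /h1; ring.
    by rewrite mulfK// subr_eq0.
  by have := ler_wpM2l (ltW kap0) c2; lra.
Qed.

(** * The deficit of mass caused by height above the origin *)

Section saturation.
Context d (T : measurableType d) (R : realType).
Variables (nu : {finite_measure set T -> \bar R}) (G1 G2 : T -> R).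
Hypotheses (mG1 : measurable_fun setT G1) (mG2 : measurable_fun setT G2).
Local Notation leb := (@lebesgue_measure R).
Local Notation leb2 := (sprod leb leb).
Local Notation nrm := (@Normc.normc R).
Local Notation nu3 := (sprod nu (sprod nu nu)).
Variable h : plane R -> R.
Hypothesis mh : measurable_fun setT h.
Hypothesis h_ge0 : forall x, 0 <= h x.
Hypothesis h_density : forall Phi : plane R -> \bar R, measurable_fun setT Phi ->
  (forall x, (0 <= Phi x)%E) ->
  (\int[nu3]_X Phi (sum3 G1 X, sum3 G2 X) = \int[leb2]_x (Phi x * (h x)%:E))%E.
Hypothesis G2_ge0 : forall y, 0 <= G2 y.
Variables c t1 h0 : R.
Hypotheses (c_gt0 : 0 < c) (t1_gt0 : 0 < t1) (ct1 : c * t1 <= 1) (h0_gt0 : 0 < h0).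
Hypothesis h_le : forall x, h x <= h0 * (1 - c * Num.min (Num.max x.2 0) t1).

(** Truncating the height to [[0, t1]] makes this majorant nonincreasing, Lipschitz and confined to
    [[0, h0]]. *)
Let psi (t : R) : R := h0 * (1 - c * Num.min (Num.max t 0) t1).

Let clamp_bounds (t : R) : 0 <= Num.min (Num.max t 0) t1 <= t1.
Proof. by rewrite le_min le_max lexx orbT (ltW t1_gt0) ge_min lexx orbT. Qed.

Let psi_bounds t : 0 <= psi t <= h0.
Proof.
have /andP[u0 u1] := clamp_bounds t.
have cu0 := mulr_ge0 (ltW c_gt0) u0; have cu1 := ler_wpM2l (ltW c_gt0) u1.
rewrite mulr_ge0 ?(ltW h0_gt0)//=; first by rewrite ler_piMr ?(ltW h0_gt0)//; lra.
by have := ct1; lra.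
Qed.

Let mpsi : measurable_fun [set: R] psi.
Proof.
apply: measurable_funM => //; apply: measurable_funB => //; apply: measurable_funM => //.
by apply: measurable_minr => //; exact: measurable_maxr.
Qed.

Let psi_le (s t : R) (u : R) : 0 <= u ->
  Num.min (Num.max t 0) t1 <= Num.min (Num.max s 0) t1 + u -> psi s <= psi t + h0 * c * u.
Proof.
move=> u0 h1; have := ler_wpM2l (ltW (mulr_gt0 h0_gt0 c_gt0)) h1; rewrite /psi; lra.
Qed.

Let psi_usc eps : 0 < eps -> exists2 rho : R, 0 < rho &
  forall t u : R, `|u| < rho -> psi (t + u) <= psi t + eps.
Proof.
move=> e0; have hc := mulr_gt0 h0_gt0 c_gt0.
exists (eps / (h0 * c)); first exact: divr_gt0.
move=> t u; rewrite ltr_pdivlMr// => /ltW ue.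
have h1 : h0 * c * `|u| <= eps by rewrite mulrC.
have h2 : psi (t + u) <= psi t + h0 * c * `|u|; last by lra.
apply: psi_le => //; have := ler_norm u; have := ler_norm (- u); rewrite normrN => n1 n2.
have /andP[b1 b2] := clamp_bounds t; have n0 := normr_ge0 u.
have m1 : Num.max t 0 <= Num.max (t + u) 0 + `|u|.
  rewrite ge_max; apply/andP; split; last by rewrite addr_ge0// le_max lexx orbT.
  have : t + u <= Num.max (t + u) 0 by rewrite le_max lexx.
  lra.
have [m2|m2] := leP (Num.max (t + u) 0) t1; last by have := t1_gt0; rewrite (le_trans b2)// lerDl.
by rewrite ge_min m1.
Qed.

Let psi_anti s t : s <= t -> psi t <= psi s.
Proof.
move=> st; have := @psi_le t s 0 (lexx 0); rewrite mulr0 !addr0; apply.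
have m1 : Num.max s 0 <= Num.max t 0 by rewrite ge_max !le_max st lexx orbT.
by rewrite le_min ge_min m1/= ge_min lexx orbT.
Qed.

Definition mass (f : T -> R[i]) : R := fine (\int[nu]_y (nrm (f y) ^+ 2)%:E)%E.

Definition weighted_mass (f : T -> R[i]) : R := fine (\int[nu]_y (nrm (f y) ^+ 2 * psi (G2 y))%:E)%E.

Section one_function.
Variable f : T -> R[i].
Hypothesis sf : square_integrable nu f.

Let v (y : T) : R := nrm (f y) ^+ 2.
Let u (y : T) : R := v y * psi (G2 y).

Let mv : measurable_fun setT v.
Proof. by apply: measurable_funX; apply: cmeasurable_normc; case: sf. Qed.

Let v_ge0 y : 0 <= v y. Proof. exact: sqr_ge0. Qed.

Let mu : measurable_fun setT u.
Proof. by apply: measurable_funM => //; exact: (measurableT_comp mpsi mG2). Qed.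

Let u_ge0 y : 0 <= u y.
Proof. by apply: mulr_ge0 => //; case/andP: (psi_bounds (G2 y)). Qed.

Let iv : nu.-integrable setT (EFin \o v).
Proof.
apply/integrableP; split; first exact/measurable_EFinP.
by under eq_integral => y _ do rewrite /= ger0_norm//; case: sf.
Qed.

Let ivh : nu.-integrable setT (EFin \o (fun y => h0 * v y)).
Proof.
have -> : EFin \o (fun y => h0 * v y) = (fun y => (h0%:E * (EFin \o v) y)%E) by apply/funext => y.
exact: integrableZl.
Qed.

Let iu : nu.-integrable setT (EFin \o u).
Proof.
apply: (le_integrable measurableT _ _ ivh); first exact/measurable_EFinP.
move=> y _ /=; rewrite lee_fin !ger0_norm//; last exact: mulr_ge0 (ltW h0_gt0) (v_ge0 y).
rewrite /u [leRHS]mulrC; apply: ler_wpM2l; first exact: v_ge0.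
by case/andP: (psi_bounds (G2 y)).
Qed.

Lemma massE : (\int[nu]_y (nrm (f y) ^+ 2)%:E = (mass f)%:E)%E.
Proof. by rewrite fineK//; exact: (integrable_fin_num measurableT iv). Qed.

Let weighted_massE : (\int[nu]_y (u y)%:E = (weighted_mass f)%:E)%E.
Proof. by rewrite fineK//; exact: (integrable_fin_num measurableT iu). Qed.

Lemma mass_ge0 : 0 <= mass f.
Proof. by apply: fine_ge0; apply: integral_ge0 => y _; rewrite lee_fin; exact: sqr_ge0. Qed.

Let prodE (w : T -> R) (P : R) : nu.-integrable setT (EFin \o w) -> (\int[nu]_y (w y)%:E = P%:E)%E ->
  (\int[nu3]_X (w X.1 * (v X.2.1 * v X.2.2))%:E = (P * mass f ^+ 2)%:E)%E.
Proof.
move=> iw wP; have i2 := integrable_prodM iv iv.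
pose v2 (z : T * T) := v z.1 * v z.2.
have i3 := @integrable_prodM _ _ _ _ _ nu (sprod nu nu) w v2 iw i2.
have E := @integral_prodM _ _ _ _ _ nu (sprod nu nu) w v2 iw i2.
have E2 := @integral_prodM _ _ _ _ _ nu nu v v iv iv.
rewrite -[LHS](fineK (integrable_fin_num measurableT i3)); congr (_%:E).
transitivity ((\int[nu]_x w x) * \int[sprod nu nu]_z v2 z)%R; first exact: E.
rewrite {1}/Rintegral wP /= E2 expr2.
by rewrite /Rintegral massE.
Qed.

Lemma integral_prod3 : (\int[nu3]_X (nrm (prod3 f X) ^+ 2)%:E = (mass f ^+ 3)%:E)%E.
Proof.
rewrite exprS -(prodE iv massE); apply: eq_integral => X _.
by rewrite /prod3 !Normc.normcM !exprMn.
Qed.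

(** Heights are nonnegative and [psi] is nonincreasing, so the height of the sum may be replaced by
    that of the first point alone. The triple integral then factors. *)
Lemma curve_ext6_le : (\int[leb2]_x (nrm (curve_ext nu G1 G2 f x) ^+ 6)%:E <=
  ((2 * pi) ^+ 2 * (weighted_mass f * mass f ^+ 2))%:E)%E.
Proof.
apply: (le_trans (curve_ext_le mG1 mG2 mh h_ge0 h_density mpsi psi_bounds psi_usc h_le sf)).
rewrite [leRHS]EFinM -(prodE iu weighted_massE) lee_wpmul2l ?lee_fin ?sqr_ge0//.
have mf X1 : measurable_fun setT (fun X : T * (T * T) => X1 X) -> measurable_fun setT (fun X => v (X1 X : T)).
  by move=> m1; exact: (measurableT_comp mv m1).
have m23 : measurable_fun setT (fun X : T * (T * T) => v X.2.1 * v X.2.2).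
  by apply: measurable_funM; apply: mf; measurability_of_map.
have m1 : measurable_fun setT (fun X : T * (T * T) => v X.1) by apply: mf; measurability_of_map.
have E X : nrm (prod3 f X) ^+ 2 = v X.1 * (v X.2.1 * v X.2.2) by rewrite /prod3 !Normc.normcM !exprMn.
under eq_integral do rewrite E.
apply: ge0_le_integral.
- exact: measurableT.
- move=> X _; rewrite lee_fin; apply: mulr_ge0; last by case/andP: (psi_bounds (sum3 G2 X)).
  exact: mulr_ge0 (v_ge0 _) (mulr_ge0 (v_ge0 _) (v_ge0 _)).
- apply/measurable_EFinP; apply: measurable_funM; first exact: measurable_funM.
  exact: (measurableT_comp mpsi (measurable_sum3 mG2)).
- apply/measurable_EFinP; apply: measurable_funM => //.
  exact: (measurableT_comp mu (@measurable_fst _ _ _ _)).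
- move=> X _; rewrite lee_fin /u mulrAC.
  apply: ler_wpM2r; first exact: mulr_ge0.
  apply: ler_wpM2l => //; apply: psi_anti; rewrite /sum3 lerDl.
  exact: addr_ge0.
Qed.

Let deficit (y : T) : R := v y * (h0 - psi (G2 y)).

Let deficit_ge0 y : 0 <= deficit y.
Proof. by apply: mulr_ge0 => //; rewrite subr_ge0; case/andP: (psi_bounds (G2 y)). Qed.

Let mdeficit : measurable_fun setT deficit.
Proof.
apply: measurable_funM => //; apply: measurable_funB => //; exact: (measurableT_comp mpsi mG2).
Qed.

Let deficitE : (\int[nu]_y (deficit y)%:E = (h0 * mass f - weighted_mass f)%:E)%E.
Proof.
transitivity (\int[nu]_y ((EFin \o (fun y => (h0 * v y)%R)) y - (EFin \o u) y))%E.
  by apply: eq_integral => y _; rewrite /= -EFinB /deficit /u; congr (_%:E); ring.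
rewrite (integralB measurableT ivh iu) weighted_massE EFinB; congr (_ - _)%E.
have me : measurable_fun setT (EFin \o v) by exact/measurable_EFinP.
rewrite EFinM -massE; under eq_integral do rewrite /= EFinM.
by rewrite ge0_integralZl//; [move=> y _; rewrite lee_fin|rewrite lee_fin ltW].
Qed.

Lemma weighted_mass_le : weighted_mass f <= h0 * mass f.
Proof.
rewrite -subr_ge0 -lee_fin -deficitE.
by apply: integral_ge0 => y _; rewrite lee_fin; exact: deficit_ge0.
Qed.

(** On [S] the truncated height is at least [m], so there [h0 - psi] is at least [h0 * c * m];
    elsewhere the deficit is nonnegative. *)
Lemma mass_off_le (S : set T) (m : R) : measurable S -> 0 <= m -> m <= t1 ->
  (forall y, S y -> m <= G2 y) ->
  ((h0 * c * m)%:E * \int[nu]_(y in S) (nrm (f y) ^+ 2)%:E <= (h0 * mass f - weighted_mass f)%:E)%E.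
Proof.
move=> mS m0 mt1 mG; rewrite -deficitE.
have hcm : 0 <= h0 * c * m by rewrite mulr_ge0// mulr_ge0// ltW.
rewrite -ge0_integralZl//; last 2 first.
- by apply/measurable_EFinP; exact: measurable_funTS.
- by move=> y _; rewrite lee_fin; exact: sqr_ge0.
apply: (@le_trans _ _ (\int[nu]_(y in S) (deficit y)%:E)%E); last first.
  by apply: ge0_subset_integral => //; [exact/measurable_EFinP|move=> y _; rewrite lee_fin; exact: deficit_ge0].
apply: ge0_le_integral => //.
- by move=> y _; rewrite -EFinM lee_fin; exact: mulr_ge0 hcm (v_ge0 y).
- by apply: measurable_funeM; apply/measurable_EFinP; exact: measurable_funTS.
- by apply/measurable_EFinP; exact: measurable_funTS.
- move=> y Sy; rewrite -EFinM lee_fin /deficit mulrC; apply: ler_wpM2l; first exact: v_ge0.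
  have mm : m <= Num.min (Num.max (G2 y) 0) t1 by rewrite le_min le_max mG.
  by have := ler_wpM2l (ltW (mulr_gt0 h0_gt0 c_gt0)) mm; rewrite /psi; lra.
Qed.

(** Without deficit [f] vanishes almost everywhere that [psi < h0], that is, at every positive
    height; height 0 is a null set. *)
Lemma saturated_mass0 : nu [set y | G2 y = 0] = 0%E -> h0 * mass f <= weighted_mass f -> mass f = 0.
Proof.
move=> nu0 sat.
have d0 : (\int[nu]_y `|(deficit y)%:E| = 0)%E.
  under eq_integral => y _ do rewrite gee0_abs ?lee_fin ?deficit_ge0//.
  apply/eqP; rewrite eq_le; apply/andP; split; last by apply: integral_ge0 => y _; rewrite lee_fin; exact: deficit_ge0.
  by rewrite deficitE lee_fin subr_le0.
have mde : measurable_fun setT (fun y => (deficit y)%:E) by exact/measurable_EFinP.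
have aed := (ae_eq_integral_abs nu measurableT mde).1 d0.
have mZ : measurable [set y | G2 y = 0].
  by have := mG2 measurableT (measurable_set1 0); rewrite setTI.
have aeG : \forall y \ae nu, G2 y != 0.
  by exists [set y | G2 y = 0]; split => // y /= /negP; rewrite negbK => /eqP.
have aev : ae_eq nu setT (fun y => (v y)%:E) (cst 0%E).
  apply: (@filterS2 _ _ (ae_filter_ringOfSetsType nu) _ _ _ _ aed aeG) => y /= h1 Gy _.
  have dy : deficit y = 0 by apply: EFin_inj; exact: h1.
  move/eqP: dy; rewrite /deficit mulf_eq0 => /orP[/eqP -> //|/eqP h2].
  exfalso; have G0 : 0 < G2 y by rewrite lt_neqAle eq_sym Gy G2_ge0.
  have m0 : 0 < Num.min (Num.max (G2 y) 0) t1 by rewrite lt_min lt_max G0 t1_gt0.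
  by have := mulr_gt0 (mulr_gt0 h0_gt0 c_gt0) m0; move: h2; rewrite /psi; lra.
have E : (\int[nu]_y (v y)%:E = \int[nu]_y (cst 0 y))%E.
  by apply: ae_eq_integral => //; exact/measurable_EFinP.
by rewrite /mass E integral0.
Qed.

End one_function.

End saturation.

(** * Norms as roots of integrals, and arclength as a weighted measure on the line *)

Lemma cLnormE {d} {T : measurableType d} {R : realType} (mu : {measure set T -> \bar R})
    (n : nat) (f : T -> R[i]) (I : R) :
  (\int[mu]_x (Normc.normc (f x) ^+ n.+1)%:E = I%:E)%E ->
  exists2 x : R, 0 <= x /\ x ^+ n.+1 = I & cLnorm mu n.+1%:R f = x%:E.
Proof.
move=> fI; have n0 : n.+1%:R != 0 :> R by rewrite pnatr_eq0.
have := powR_Lnorm mu (EFin \o (@Normc.normc R \o f)) n0.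
have -> : (\int[mu]_x `|(EFin \o (@Normc.normc R \o f)) x| `^ n.+1%:R = I%:E)%E.
  rewrite -fI; apply: eq_integral => x _.
  by rewrite gee0_abs ?lee_fin ?normc_ge0// poweR_EFin powR_mulrn// normc_ge0.
rewrite /cLnorm; have := Lnorm_ge0 mu n.+1%:R%:E (EFin \o (@Normc.normc R \o f)).
case: (Lnorm _ _ _) => [x|_|//].
  rewrite lee_fin poweR_EFin => x0; rewrite powR_mulrn// => -[xI].
  by exists x.
by rewrite poweRyr.
Qed.

Lemma cLnorm_lty {d} {T : measurableType d} {R : realType} (mu : {measure set T -> \bar R})
    (n : nat) (f : T -> R[i]) : (cLnorm mu n.+1%:R f < +oo)%E ->
  (\int[mu]_x (Normc.normc (f x) ^+ n.+1)%:E < +oo)%E.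
Proof.
move=> fy; have n0 : n.+1%:R != 0 :> R by rewrite pnatr_eq0.
have -> : (\int[mu]_x (Normc.normc (f x) ^+ n.+1)%:E =
    \int[mu]_x `|(EFin \o (@Normc.normc R \o f)) x| `^ n.+1%:R)%E.
  apply: eq_integral => x _.
  by rewrite gee0_abs ?lee_fin ?normc_ge0// poweR_EFin powR_mulrn// normc_ge0.
by rewrite -powR_Lnorm// poweR_lty.
Qed.

Lemma measurable_plane_add {R : realType} :
  measurable_fun setT (fun z : plane R * plane R => (z.1 + z.2 : plane R)).
Proof.
apply: (@measurable_fun_pair _ _ _ _ _ _ (fun z : plane R * plane R => z.1.1 + z.2.1) (fun z => z.1.2 + z.2.2));
  apply: measurable_funD; measurability_of_map.
Qed.

Lemma mconv3E {R : realType} (s : {finite_measure set (plane R) -> \bar R}) (A : set (plane R)) :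
  measurable A ->
  mconv (mconv s s) s A =
  (\int[s]_x \int[s]_y \int[s]_w (\1_A (x + y + w)%R : R)%:E)%E.
Proof.
move=> mA; pose plus (z : plane R * plane R) : plane R := z.1 + z.2.
have mplus : measurable_fun setT plus := measurable_plane_add.
have mS : measurable (plus @^-1` A) by rewrite -[X in measurable X]setTI; exact: mplus.
pose H (z : plane R) := s (xsection (plus @^-1` A) z).
have mH : measurable_fun setT H by exact: measurable_fun_xsection.
have HE z : H z = (\int[s]_w (\1_A (z + w)%R : R)%:E)%E.
  transitivity (\int[s]_w (\1_(xsection (plus @^-1` A) z) w : R)%:E)%E.
    by rewrite integral_indic// ?setIT//; exact: measurable_xsection.
  by apply: eq_integral => w _; rewrite !indicE mem_xsection.
transitivity (\int[pushforward (s \x s) plus]_z H z)%E; first by [].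
rewrite (ge0_integral_pushforward mplus)//=.
transitivity (\int[s \x s]_z H (plus z))%E; first by [].
have mHp : measurable_fun setT (fun z => H (plus z)) by exact: (measurableT_comp mH mplus).
have Hp0 z : (0 <= H (plus z))%E by exact: measure_ge0.
transitivity (\int[s]_x \int[s]_y H (plus (x, y)))%E.
  exact: (fubini_tonelli1 (fun z => H (plus z)) mHp Hp0).
by apply: eq_integral => x _; apply: eq_integral => y _; rewrite HE.
Qed.

Section arclength_weight.
Context {R : realType}.
Local Notation M := (measurableTypeR R).
Local Notation leb := (@lebesgue_measure R).
Variables (g G G1 : R -> R) (r : R).
Hypothesis r_gt0 : 0 < r.
Hypothesis mG : measurable_fun [set: R] G.
Hypothesis cG1 : continuous G1.
Hypothesis GE : forall y : R, `|y| <= r -> G y = g y.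
Hypothesis dg : forall y : R, `|y| <= r -> is_derive y 1 g (G1 y).

(** The cut-off is strict, so the weight is zero on the closed set [r <= |y|] and jumps exactly at
    the two ends of the arc, which are null for arclength. *)
Definition arc_weight (y : R) : R := if `|y| < r then Num.sqrt (1 + G1 y ^+ 2) else 0.

Let s (y : R) : R := Num.sqrt (1 + G1 y ^+ 2).

Let cs : continuous s.
Proof.
move=> y; apply: (@continuous_comp _ _ _ (fun y => 1 + G1 y ^+ 2) Num.sqrt); last exact: sqrt_continuous.
by apply: cvgD; [exact: cvg_cst|apply: cvgM; exact: cG1].
Qed.

Let ms : measurable_fun [set: R] s.
Proof. exact: continuous_measurable_fun cs. Qed.

Let in_r (y : R) : y \in `[- r, r] = (`|y| <= r).
Proof. by rewrite in_itv/= ler_norml. Qed.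

Lemma arc_weight_ge0 y : 0 <= arc_weight y.
Proof. by rewrite /arc_weight; case: ifP => // _; exact: sqrtr_ge0. Qed.

Lemma arc_weight_off y : r <= `|y| -> arc_weight y = 0.
Proof. by rewrite /arc_weight leNgt => /negbTE ->. Qed.

Lemma measurable_arc_weight : measurable_fun [set: R] arc_weight.
Proof.
apply: measurable_fun_ifT; [|exact: ms|exact: measurable_cst].
by apply: measurable_fun_ltr => //; exact: measurableT_comp.
Qed.

Lemma continuous_arc_weight y : `|y| != r -> arc_weight x @[x --> y] --> arc_weight y.
Proof.
have o : open [set x : R | `|x| < r].
  by apply: (@open_comp _ _ (@Num.norm _ R) [set t | t < r]); [move=> x _; exact: norm_continuous|exact: open_lt].
have o' : open [set x : R | r < `|x|].
  by apply: (@open_comp _ _ (@Num.norm _ R) [set t | r < t]); [move=> x _; exact: norm_continuous|exact: open_gt].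
rewrite neq_lt => /orP[yr|yr].
- have E : \forall x \near y, s x = arc_weight x.
    by apply: filterS (open_nbhs_nbhs (conj o yr)) => x /= xr; rewrite /arc_weight xr.
  apply: cvg_trans (near_eq_cvg E) _; rewrite /arc_weight yr; exact: cs.
- have E : \forall x \near y, 0 = arc_weight x.
    by apply: filterS (open_nbhs_nbhs (conj o' yr)) => x /= xr; rewrite arc_weight_off// ltW.
  apply: cvg_trans (near_eq_cvg E) _; rewrite arc_weight_off ?ltW//; exact: cvg_cst.
Qed.

Lemma speed_graph (y : R) : `|y| <= r -> speed (graph_curve g) y = s y.
Proof.
move=> yr; have [d1 d2] := dg yr.
by rewrite /speed graph_derive1// /enorm /dotp /= mul1r derive1E d2 /s expr2.
Qed.

Let mGam : measurable_fun [set: M] ((fun y => (y, G y)) : M -> plane R).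
Proof. exact: measurable_fun_pair. Qed.

Let rect : rectifiable (graph_curve g) (- r) r.
Proof.
split.
  apply: eq_measurable_fun (measurable_funTS mGam) => y.
  by rewrite inE/= in_r => yr; rewrite /graph_curve GE.
have : leb.-integrable `[- r, r] (EFin \o s).
  by apply: continuous_compact_integrable; [exact: segment_compact|exact: continuous_subspaceT].
by apply: eq_integrable => //= y; rewrite inE/= in_r => yr; rewrite /= speed_graph.
Qed.

Variable nu : {finite_measure set M -> \bar R}.
Hypothesis nuE : forall f : R -> \bar R, measurable_fun [set: R] f -> (forall x, 0 <= f x)%E ->
  (\int[nu]_x f x = \int[leb]_x (f x * (arc_weight x)%:E))%E.
Local Notation sigma := (arclength (graph_curve g) (- r) r).

Lemma arclength_restrict (B : set M) (F : R -> R) : measurable B ->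
  measurable_fun [set: R] F -> (forall y, 0 <= F y) ->
  (\int[leb]_(y in `[(- r)%R, r] `&` B) (F y * s y)%:E = \int[nu]_(y in B) (F y)%:E)%E.
Proof.
move=> mB mF F0; have mI : measurable (`[- r, r]%classic `&` B : set M).
  by apply: measurableI => //; exact: measurable_itv.
have mFB : measurable_fun [set: R] ((fun y => (F y)%:E) \_ B).
  by apply/(measurable_restrictT _ _).1 => //; apply: measurable_funTS; exact/measurable_EFinP.
have FB0 y : (0 <= ((fun y => (F y)%:E) \_ B) y)%E by rewrite patchE; case: ifP => // _; rewrite lee_fin.
rewrite [RHS]integral_mkcond nuE// [LHS]integral_mkcond.
have mFs : measurable_fun [set: R] (fun y => (F y * s y)%:E).
  by apply/measurable_EFinP; apply: measurable_funM; [exact: mF|exact: ms].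
have cN : countable [set r; - r] := finite_set_countable (finite_set2 r (- r)).
apply: ae_eq_integral => //.
- by apply/(measurable_restrictT _ _).1 => //; exact: measurable_funTS.
- by apply: emeasurable_funM => //; apply/measurable_EFinP; exact: measurable_arc_weight.
- exists [set r; - r]; split.
  + exact: countable_measurable.
  + exact: countable_lebesgue_measure0.
  + move=> y /= ny; apply: contrapT => yr; apply: ny => _.
    rewrite !patchE; have [yB|yB] := pselect (B y); last first.
      by rewrite !memNset ?mul0e//= => -[].
    rewrite [in RHS]mem_set//; have [h|h] := ltP `|y| r.
      by rewrite mem_set/=; [rewrite /arc_weight h EFinM|split => //; rewrite in_r ltW].
    rewrite memNset; first by rewrite arc_weight_off// mule0.
    move=> [+ _]; rewrite /= in_r => h'; apply: yr.
    have /eqP : `|y| = r by apply/eqP; rewrite eq_le h h'.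
    by rewrite eqr_norml => /andP[/orP[]/eqP -> _]; [left|right].
Qed.

Lemma arclength_pushforward (A : set (plane R)) : measurable A ->
  sigma A = nu ((fun y => (y, G y)) @^-1` A).
Proof.
move=> mA; have mB : measurable ((fun y : M => (y, G y) : plane R) @^-1` A).
  by rewrite -[X in measurable X]setTI; exact: mGam.
rewrite arclengthE; last exact: rect.
transitivity (\int[nu]_(y in ((fun y : M => (y, G y) : plane R) @^-1` A)) (1%R)%:E)%E; last first.
  by rewrite integral_cst// mul1e.
have m1 : measurable_fun [set: R] (fun _ : R => 1 : R) by exact: measurable_cst.
apply: etrans (arclength_restrict mB m1 (fun _ => ler01)).
have E : `[- r, r]%classic `&` (graph_curve g @^-1` A) = `[- r, r]%classic `&` ((fun y => (y, G y)) @^-1` A).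
  by apply/seteqP; split => y [/= yr yA]; split => //; move: yA; rewrite /graph_curve /= GE// -in_r.
rewrite E; apply: eq_integral => y; rewrite inE/= => -[+ _].
by rewrite in_r => yr; rewrite speed_graph// mul1r.
Qed.

Lemma ge0_integral_arclength (F : plane R -> \bar R) :
  measurable_fun setT F -> (forall x, 0 <= F x)%E ->
  (\int[sigma]_x F x = \int[nu]_y F (y, G y))%E.
Proof.
move=> mF F0.
transitivity (\int[pushforward nu ((fun y => (y, G y)) : M -> plane R)]_x F x)%E.
  by apply: eq_measure_integral => //= A mA _; exact: arclength_pushforward.
by rewrite ge0_integral_pushforward// => y; rewrite inE.
Qed.

Lemma Rintegral_arclength (u : plane R -> R) : measurable_fun setT u ->
  (\int[sigma]_x u x)%R = (\int[nu]_y u (y, G y))%R.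
Proof.
move=> mu; congr fine; rewrite integralE [RHS]integralE.
have me : measurable_fun setT (EFin \o u) by exact/measurable_EFinP.
have mp := measurable_funepos me; have mn := measurable_funeneg me.
have p0 x : (0 <= (EFin \o u)^\+ x)%E by exact: funepos_ge0.
have n0 x : (0 <= (EFin \o u)^\- x)%E by exact: funeneg_ge0.
congr (_ - _)%E.
  by apply: etrans (ge0_integral_arclength mp p0) _; apply: eq_integral => y _; rewrite !funeposE.
by apply: etrans (ge0_integral_arclength mn n0) _; apply: eq_integral => y _; rewrite !funenegE.
Qed.

Lemma extension_arclength (f : plane R -> R[i]) (xi : plane R) : cmeasurable f ->
  extension sigma f xi = curve_ext nu (fun y : M => y) G (fun y => f (y, G y)) xi.
Proof.
move=> [m1 m2].
have mdot : measurable_fun setT (fun x : plane R => - dotp x xi).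
  apply: measurable_fun_opp; rewrite /dotp; apply: measurable_funD; apply: measurable_funM => //; measurability_of_map.
have mc : measurable_fun setT (fun x : plane R => cos (- dotp x xi)).
  exact: (measurableT_comp (continuous_measurable_fun (@continuous_cos R)) mdot).
have msn : measurable_fun setT (fun x : plane R => sin (- dotp x xi)).
  exact: (measurableT_comp (continuous_measurable_fun (@continuous_sin R)) mdot).
rewrite /extension /curve_ext /cintegral; congr (_ +i* _)%C.
- rewrite Rintegral_arclength//.
  have -> : (fun x : plane R => complex.Re (expi (- dotp x xi) * f x)) = (fun x =>
      cos (- dotp x xi) * complex.Re (f x) - sin (- dotp x xi) * complex.Im (f x)).
    by apply/funext => x; rewrite /expi; case: (f x).
  by apply: measurable_funB; exact: measurable_funM.
- rewrite Rintegral_arclength//.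
  have -> : (fun x : plane R => complex.Im (expi (- dotp x xi) * f x)) = (fun x =>
      cos (- dotp x xi) * complex.Im (f x) + sin (- dotp x xi) * complex.Re (f x)).
    by apply/funext => x; rewrite /expi; case: (f x).
  by apply: measurable_funD; exact: measurable_funM.
Qed.

Lemma mconv3_arclength (A : set (plane R)) : measurable A ->
  mconv (mconv sigma sigma) sigma A =
  (\int[sprod nu (sprod nu nu)]_X (\1_A (sum3 (fun y : M => y) X, sum3 G X) : R)%:E)%E.
Proof.
move=> mA; rewrite (mconv3E _ mA).
pose plus (z : plane R * plane R) : plane R := z.1 + z.2.
have mplus : measurable_fun setT plus := measurable_plane_add.
pose I (x : plane R) : \bar R := (\1_A x : R)%:E.
have mI : measurable_fun setT I by apply/measurable_EFinP; exact: measurable_indic.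
have I0 x : (0 <= I x)%E by rewrite lee_fin indicE.
pose H (z : plane R) := (\int[sigma]_w I (z + w)%R)%E.
have mH : measurable_fun setT H.
  exact: (measurable_fun_fubini_tonelli_F (fun z : plane R * plane R => I (z.1 + z.2)) (measurableT_comp mI mplus)).
have H0 z : (0 <= H z)%E by apply: integral_ge0.
have mHp : measurable_fun setT (fun z : plane R * plane R => H (z.1 + z.2)) by exact: (measurableT_comp mH mplus).
pose K (x : plane R) := (\int[sigma]_y H (x + y)%R)%E.
have mK : measurable_fun setT K.
  exact: (measurable_fun_fubini_tonelli_F (fun z : plane R * plane R => H (z.1 + z.2)) mHp).
have madd (x : plane R) : measurable_fun setT (fun w : plane R => (x + w : plane R)).
  have mp2 : measurable_fun setT (fun w : plane R => (x, w)) by exact: measurable_fun_pair.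
  exact: (measurableT_comp mplus mp2).
transitivity (\int[sigma]_x K x)%E; first by [].
rewrite ge0_integral_arclength//; last by move=> x; apply: integral_ge0.
pose F (X : M * (M * M)) := I (sum3 (fun y : M => y) X, sum3 G X).
have mid : measurable_fun [set: M] (fun y : M => y) by exact: measurable_id.
have mS1 : measurable_fun setT (sum3 (fun y : M => y)) by exact: (measurable_sum3 mid).
have mS2 : measurable_fun setT (sum3 (G : M -> R)) by exact: (measurable_sum3 mG).
have mF : measurable_fun setT F by apply: (measurableT_comp mI); exact: measurable_fun_pair.
have mF1 y1 : measurable_fun setT (fun Z : M * M => F (y1, Z)).
  by apply: (measurableT_comp mF); exact: measurable_fun_pair.
rewrite [RHS](fubini_tonelli1 F mF); last by move=> X; exact: I0.
apply: eq_integral => y1 _; rewrite /fubini_F.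
rewrite [RHS](fubini_tonelli1 (fun Z : M * M => F (y1, Z)) (mF1 y1)); last by move=> X; exact: I0.
rewrite /K ge0_integral_arclength//; last exact: (measurableT_comp mH (madd _)).
apply: eq_integral => y2 _; rewrite /fubini_F.
rewrite /H ge0_integral_arclength//; last exact: (measurableT_comp mI (madd _)).
by apply: eq_integral => y3 _; rewrite /F /sum3/= !addrA.
Qed.

End arclength_weight.

(** * Optimal constant, absence of extremizers and concentration *)

Section extremal_problem.
Context {R : realType}.
Local Notation M := (measurableTypeR R).
Local Notation leb := (@lebesgue_measure R).
Local Notation leb2 := (sprod leb leb).
Local Notation nrm := (@Normc.normc R).
Variables (sigma : {measure set (plane R) -> \bar R}) (nu : {finite_measure set M -> \bar R}).
Local Notation nu3 := (sprod nu (sprod nu nu)).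
Variables (G : R -> R) (h : plane R -> R) (c t1 h0 : R).
Hypothesis mG : measurable_fun [set: M] (G : M -> R).
Hypothesis G_ge0 : forall y, 0 <= G y.
Hypothesis sigmaE : forall F : plane R -> \bar R, measurable_fun setT F -> (forall x, 0 <= F x)%E ->
  (\int[sigma]_x F x = \int[nu]_y F (y, G y))%E.
Hypothesis extE : forall (f : plane R -> R[i]) xi, cmeasurable f ->
  extension sigma f xi = curve_ext nu (fun y : M => y) G (fun y => f (y, G y)) xi.
Hypothesis mh : measurable_fun setT h.
Hypothesis h_ge0 : forall x, 0 <= h x.
Hypothesis h_density : forall Phi : plane R -> \bar R, measurable_fun setT Phi ->
  (forall x, (0 <= Phi x)%E) ->
  (\int[nu3]_X Phi (sum3 (fun y : M => y) X, sum3 G X) = \int[leb2]_x (Phi x * (h x)%:E))%E.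
Hypotheses (c_gt0 : 0 < c) (t1_gt0 : 0 < t1) (ct1 : c * t1 <= 1) (h0_gt0 : 0 < h0).
Hypothesis h_le : forall x, h x <= h0 * (1 - c * Num.min (Num.max x.2 0) t1).
Hypothesis near : forall eta, 0 < eta -> eta < h0 -> exists F : M -> R[i],
  [/\ square_integrable nu F, (0 < \int[nu]_y (nrm (F y) ^+ 2)%:E)%E &
  (((2 * pi) ^+ 2 * (h0 - eta))%:E * \int[nu3]_X (nrm (prod3 F X) ^+ 2)%:E <=
   \int[leb2]_x (nrm (curve_ext nu (fun y : M => y) G F x) ^+ 6)%:E)%E].
Hypothesis nu_zero : nu [set y | G y = 0] = 0%E.

Let mid : measurable_fun [set: M] (fun y : M => y). Proof. exact: measurable_id. Qed.

Let pull (f : plane R -> R[i]) (y : M) : R[i] := f (y, G y).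
Let N f := mass nu (pull f).
Let P f := weighted_mass nu G c t1 h0 (pull f).

Let mpull f : cmeasurable f -> cmeasurable (pull f).
Proof.
move=> [m1 m2]; have mp : measurable_fun [set: M] ((fun y => (y, G y)) : M -> plane R) by exact: measurable_fun_pair.
by split; [exact: (measurableT_comp m1 mp)|exact: (measurableT_comp m2 mp)].
Qed.

Let L2_square f : L2fun sigma f -> square_integrable nu (pull f).
Proof.
move=> [m1 m2 /(cLnorm_lty (n := 1)) fy]; have mf : cmeasurable f by [].
split; first exact: mpull.
move: fy; rewrite (sigmaE (F := fun x => (nrm (f x) ^+ 2)%:E))//.
  by apply/measurable_EFinP; apply: measurable_funX; exact: cmeasurable_normc.
by move=> x; rewrite lee_fin sqr_ge0.
Qed.

Lemma L2_norms f : L2fun sigma f -> exists x n : R,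
  [/\ 0 <= x, 0 <= n, ext_norm sigma f = x%:E, cLnorm sigma 2 f = n%:E &
    [/\ n ^+ 2 = N f, (x ^+ 6)%:E = (\int[leb2]_x (nrm (curve_ext nu (fun y : M => y) G (pull f) x) ^+ 6)%:E)%E,
     x ^+ 6 <= (2 * pi) ^+ 2 * (P f * N f ^+ 2) & P f <= h0 * N f]].
Proof.
move=> Lf; have sf := L2_square Lf; have mf : cmeasurable f by case: Lf.
have I2 : (\int[sigma]_x (nrm (f x) ^+ 2)%:E = (N f)%:E)%E.
  rewrite (sigmaE (F := fun x => (nrm (f x) ^+ 2)%:E)); first exact: (massE sf).
    by apply/measurable_EFinP; apply: measurable_funX; exact: cmeasurable_normc.
  by move=> x; rewrite lee_fin sqr_ge0.
have [n [n0 n2] nE] := cLnormE I2.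
have up := curve_ext6_le mid mG mh h_ge0 h_density G_ge0 c_gt0 t1_gt0 ct1 h0_gt0 h_le sf.
set I := (\int[leb2]_x _)%E in up *.
have I_ge0 : (0 <= I)%E.
  by apply: integral_ge0 => x _; rewrite lee_fin exprn_ge0// normc_ge0.
have If : I \is a fin_num by rewrite ge0_fin_numE// (le_lt_trans up)// ltry.
have I6 : (\int[lebesgue2]_x (nrm (extension sigma f x) ^+ 6)%:E = (fine I)%:E)%E.
  by rewrite (fineK If); apply: eq_integral => x _; rewrite (extE x mf).
have [x [x0 x6] xE] := cLnormE I6.
exists x, n; split => //; split => //.
- by rewrite x6 fineK.
- by rewrite -lee_fin x6 fineK.
- exact: (weighted_mass_le mG c_gt0 t1_gt0 ct1 h0_gt0 sf).
Qed.

Let K6 := (2 * pi) ^+ 2 * h0.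

Let K6_gt0 : 0 < K6.
Proof. by rewrite mulr_gt0// exprn_gt0// mulr_gt0// pi_gt0. Qed.

Let rootP : exists2 k : R, 0 < k & k ^+ 6 = K6.
Proof.
exists (K6 `^ 6^-1); first exact: powR_gt0.
rewrite -powR_mulrn ?powR_ge0// -powRrM mulVf ?powRr1 ?ltW//.
Qed.

Let L2_ratio (k x n N' P' : R) : 0 <= k -> k ^+ 6 = K6 -> 0 <= x -> 0 <= n -> n ^+ 2 = N' ->
  x ^+ 6 <= (2 * pi) ^+ 2 * (P' * N' ^+ 2) -> P' <= h0 * N' -> x <= k * n.
Proof.
move=> k0 k6 x0 n0 n2 x6 PN; rewrite -(@ler_pXn2r _ 6)// ?nnegrE ?mulr_ge0//.
apply: (le_trans x6); rewrite [leRHS]exprMn k6 /K6 -[leRHS]mulrA; apply: ler_wpM2l; first exact: sqr_ge0.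
have -> : n ^+ 6 = N' * N' ^+ 2 by rewrite -n2 -exprS -exprM.
rewrite [leRHS]mulrA; apply: ler_wpM2r => //; exact: sqr_ge0.
Qed.

(** The upper bound is [x ^+ 6 <= (2 * pi) ^+ 2 * P * N ^+ 2] with [P <= h0 * N]; the hypothesis
    [near] shows that no smaller constant will do. *)
Lemma optimal_constE : exists k : R, [/\ 0 < k, k ^+ 6 = K6 & optimal_const sigma = k%:E].
Proof.
have [k k0 k6] := rootP; exists k; split => //.
have pi2 : 0 < (2 * pi) ^+ 2 :> R by rewrite exprn_gt0// mulr_gt0// pi_gt0.
have ub : (optimal_const sigma <= k%:E)%E.
  apply: ge_ereal_sup => _ [f [Lf fn] <-].
  have [x [n [x0 n0 xE nE [n2 _ x6 PN]]]] := L2_norms Lf.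
  have n_neq0 : n != 0 by move: fn; rewrite nE.
  have n_gt0 : 0 < n by rewrite lt_neqAle eq_sym n_neq0.
  rewrite xE nE inver (negbTE n_neq0) -EFinM lee_fin ler_pdivrMr//.
  by apply: (L2_ratio (ltW k0) k6 x0 n0 n2 x6 PN).
have lb eta : 0 < eta -> eta < h0 -> exists q : R,
    [/\ 0 <= q, (q%:E <= optimal_const sigma)%E & (2 * pi) ^+ 2 * (h0 - eta) <= q ^+ 6].
  move=> e0 eh; have [F [sF F0 Fle]] := near e0 eh.
  (* A function of the parameter becomes a function on the plane through the first coordinate, which
     is the parameter on a graph. *)
  pose f (x : plane R) : R[i] := F x.1.
  have mf : cmeasurable f.
    case: sF => -[m1 m2] _; split; first exact: (measurableT_comp m1 (@measurable_fst _ _ _ _)).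
    exact: (measurableT_comp m2 (@measurable_fst _ _ _ _)).
  have I2 : (\int[sigma]_x (nrm (f x) ^+ 2)%:E = (mass nu F)%:E)%E.
    rewrite (sigmaE (F := fun x => (nrm (f x) ^+ 2)%:E)); first exact: (massE sF).
      by apply/measurable_EFinP; apply: measurable_funX; exact: cmeasurable_normc.
    by move=> x; rewrite lee_fin sqr_ge0.
  have Lf : L2fun sigma f.
    have [n' _ n'E] := cLnormE I2; case: mf => m1 m2; split => //.
    by rewrite [cLnorm _ _ _]n'E ltry.
  have [x [n [x0 n0 xE nE [n2 xI x6 PN]]]] := L2_norms Lf.
  have N0 : 0 < N f by rewrite -lte_fin -(massE sF).
  have n_neq0 : n != 0 by apply: contraTneq N0 => nn; rewrite -n2 nn expr0n/= ltxx.
  have n_gt0 : 0 < n by rewrite lt_neqAle eq_sym n_neq0.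
  exists (x / n); split; first by rewrite divr_ge0.
    apply: ereal_sup_ubound; exists f; last by rewrite xE nE inver (negbTE n_neq0) -EFinM.
    by split => //; rewrite nE.
  rewrite expr_div_n ler_pdivlMr ?exprn_gt0//.
  move: Fle; rewrite (integral_prod3 sF) -EFinM -xI lee_fin.
  by rewrite -[mass nu F]/(N f) -n2 -exprM.
apply/eqP; rewrite eq_le ub /= leNgt; apply/negP => lt.
have hh : 0 < h0 / 2 by rewrite divr_gt0.
have hh' : h0 / 2 < h0 by have := h0_gt0; lra.
(* A first instance of [lb] shows that the supremum is a nonnegative real number, so that sixth
   powers can be compared. *)
have [q0 [q00 q0s _]] := lb _ hh hh'.
move: ub lt lb q0s; case: (optimal_const sigma) => [s|//|//] _; rewrite lte_fin => sk lb q0s.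
have s0 : 0 <= s by rewrite lee_fin in q0s; exact: le_trans q0s.
have s6 : s ^+ 6 < (2 * pi) ^+ 2 * h0 by rewrite -/K6 -k6 ltr_pXn2r// nnegrE// ltW.
(* If the supremum were [s], then [u < h0] would play the part of [h0]; taking [eta] to be half the
   gap [h0 - u] produces a quotient whose sixth power exceeds [s ^+ 6]. *)
pose u := s ^+ 6 / (2 * pi) ^+ 2.
have u0 : 0 <= u by apply: divr_ge0; [exact: exprn_ge0|exact: ltW].
have uh : u < h0 by rewrite ltr_pdivrMr// mulrC.
have hu : 0 < (h0 - u) / 2 by rewrite divr_gt0// subr_gt0.
have hu' : (h0 - u) / 2 < h0 by move: u0 h0_gt0; clearbody u; lra.
have [q [q1 qs qle]] := lb _ hu hu'.
have q6 : q ^+ 6 <= s ^+ 6 by rewrite lee_fin in qs; rewrite ler_pXn2r// nnegrE.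
have := le_trans qle q6; rewrite -[s ^+ 6](divfK (lt0r_neq0 pi2)) -/u mulrC ler_pM2r//.
by move: uh; clearbody u; lra.
Qed.

(** Equality in the inequality forces [P f = h0 * N f], hence no deficit, and then [saturated_mass0]
    annihilates the function. *)
Lemma no_extremizer f : ~ extremizer sigma f.
Proof.
move=> [Lf fn E]; have [k [k0 k6 kE]] := optimal_constE.
have [x [n [x0 n0 xE nE [n2 _ x6 PN]]]] := L2_norms Lf.
have pi2 : 0 < (2 * pi) ^+ 2 :> R by rewrite exprn_gt0// mulr_gt0// pi_gt0.
move: E fn; rewrite xE nE kE -EFinM => -[xkn] nn.
have n_neq0 : n != 0 by exact: nn.
have N0 : 0 < N f by rewrite -n2 exprn_even_gt0.
have sat : h0 * N f <= P f.
  move: x6; rewrite xkn exprMn k6 /K6 (_ : n ^+ 6 = (n ^+ 2) ^+ 3); last by rewrite -exprM.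
  rewrite n2 -mulrA ler_pM2l// exprS mulrA ler_pM2r// exprn_gt0//.
have := saturated_mass0 mG G_ge0 c_gt0 t1_gt0 ct1 h0_gt0 (L2_square Lf) nu_zero sat.
by move=> m0; move: N0; rewrite /N m0 ltxx.
Qed.

Section extremizing.
Variable f : nat -> plane R -> R[i].
Hypothesis ef : extremizing_seq sigma f.

Let sequences : exists k : R, exists xs ns : nat -> R, [/\ 0 < k, k ^+ 6 = K6, xs j @[j --> \oo] --> k &
  forall j, [/\ 0 <= xs j, 0 <= ns j, ns j <= 1, cLnorm sigma 2 (f j) = (ns j)%:E &
    [/\ ns j ^+ 2 = N (f j), xs j ^+ 6 <= (2 * pi) ^+ 2 * (P (f j) * N (f j) ^+ 2) &
     P (f j) <= h0 * N (f j)]]].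
Proof.
case: ef => Lf cf; have [k [k0 k6 kE]] := optimal_constE.
have H j : exists p : R * R, [/\ 0 <= p.1, 0 <= p.2, ext_norm sigma (f j) = p.1%:E, cLnorm sigma 2 (f j) = p.2%:E &
    [/\ p.2 ^+ 2 = N (f j), p.1 ^+ 6 <= (2 * pi) ^+ 2 * (P (f j) * N (f j) ^+ 2) & P (f j) <= h0 * N (f j)]].
  by have [x [n [x0 n0 xE nE [n2 _ x6 PN]]]] := L2_norms (Lf j).1; exists (x, n).
have [p hp] := choice H; exists k, (fun j => (p j).1), (fun j => (p j).2); split => //.
- move: cf; rewrite kE; have -> : (fun j => ext_norm sigma (f j)) = (fun j => ((p j).1)%:E).
    by apply/funext => j; case: (hp j).
  by move=> /fine_cvgP[_ cv]; exact: cv.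
- move=> j; have [h1 h2 h3 h4 h5] := hp j; split => //.
  by rewrite -lee_fin -h4; case: (Lf j).
Qed.

(** The inequality gives [xs j / k <= ns j <= 1], and the left end tends to 1. *)
Lemma extremizing_norm : cLnorm sigma 2 (f n) @[n --> \oo] --> 1%E.
Proof.
have [k [xs [ns [k0 k6 cx H]]]] := sequences.
have -> : (fun n => cLnorm sigma 2 (f n)) = (fun n => (ns n)%:E) by apply/funext => n; case: (H n).
apply: cvg_EFin; first exact: nearW.
apply: (@squeeze_cvgr _ _ _ _ (fun j => xs j / k) (fun=> 1)).
- apply: nearW => j; have [h1 h2 h3 _ [h4 h5 h6]] := H j; rewrite h3 andbT ler_pdivrMr// mulrC.
  exact: (L2_ratio (ltW k0) k6 h1 h2 h4 h5 h6).
- rewrite -[X in _ --> X](divff (lt0r_neq0 k0)); apply: cvgM => //; exact: cvg_cst.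
- exact: cvg_cst.
Qed.

(** Since [N <= 1], the sixth power of the norm is at most [(2 * pi) ^+ 2 * P]; its convergence to
    [K6] pushes [P] up to [h0] and the deficit [h0 * N - P] down to zero. That deficit controls the
    mass on [S] by [mass_off_le]. *)
Lemma extremizing_off (S : set M) (m eps : R) : measurable S -> 0 < m -> m <= t1 ->
  (forall y, S y -> m <= G y) -> 0 < eps ->
  \forall n \near \oo, (\int[nu]_(y in S) (nrm (f n (y, G y)) ^+ 2)%:E < eps%:E)%E.
Proof.
move=> mS m0 mt1 SG e0; have [k [xs [ns [k0 k6 cx H]]]] := sequences.
have pi2 : 0 < (2 * pi) ^+ 2 :> R by rewrite exprn_gt0// mulr_gt0// pi_gt0.
have a0 : 0 < h0 * c * m by rewrite !mulr_gt0.
have cx6 : xs j ^+ 6 @[j --> \oo] --> K6.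
  rewrite -k6; apply: (cvg_comp xs (fun t => t ^+ 6) cx); exact: exprn_continuous.
(* Above this threshold the deficit is less than [h0 * c * m * eps], the amount that [mass_off_le]
   converts into mass [eps]. *)
have lt1 : K6 - (2 * pi) ^+ 2 * (h0 * c * m * eps) < K6.
  by rewrite ltrBlDr ltrDl; apply: mulr_gt0 => //; exact: mulr_gt0.
have E1 := @cvgr_gt _ _ _ _ _ _ cx6 _ lt1; have E2 := @cvgr_gt _ _ _ _ _ _ cx _ k0.
near=> j.
have x6 : K6 - (2 * pi) ^+ 2 * (h0 * c * m * eps) < xs j ^+ 6 by near: j; exact: E1.
have xj : 0 < xs j by near: j; exact: E2.
have [h1 h2 h3 _ [h4 h5 h6]] := H j; case: ef => Lf _.
have off := mass_off_le mG c_gt0 t1_gt0 ct1 h0_gt0 (L2_square (Lf j).1) mS (ltW m0) mt1 SG.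
have N_ge0 : 0 <= N (f j) by rewrite -h4 sqr_ge0.
have N_le1 : N (f j) <= 1 by rewrite -h4 expr_le1.
have y0 : 0 < (2 * pi) ^+ 2 * (P (f j) * N (f j) ^+ 2) by apply: lt_le_trans h5; rewrite exprn_gt0.
have PN0 : 0 < P (f j) * N (f j) ^+ 2 by move: y0; rewrite pmulr_rgt0.
have P0 : 0 <= P (f j).
  rewrite leNgt; apply/negP => Pn; move: PN0; rewrite ltNge => /negP; apply.
  by apply: mulr_le0_ge0; [exact: ltW|exact: sqr_ge0].
have PNP : P (f j) * N (f j) ^+ 2 <= P (f j) by rewrite ler_piMr// expr_le1.
have def : h0 * N (f j) - P (f j) < h0 * c * m * eps.
  have h7 : h0 - h0 * c * m * eps < P (f j).
    rewrite -(ltr_pM2l pi2) mulrBr; apply: lt_le_trans x6 _; apply: le_trans h5 _.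
    by rewrite ler_pM2l.
  have := ler_wpM2l (ltW h0_gt0) N_le1; lra.
have J0 : (0 <= \int[nu]_(y in S) (nrm (f j (y, G y)) ^+ 2)%:E)%E.
  by apply: integral_ge0 => y _; rewrite lee_fin sqr_ge0.
move: off J0; rewrite -/(pull (f j)); case: (integral _ _ _) => [s| |//].
  rewrite -EFinM !lee_fin lte_fin => off _; rewrite -(ltr_pM2l a0); apply: le_lt_trans off def.
by rewrite gt0_muley ?lte_fin.
Unshelve. all: by end_near.
Qed.

End extremizing.

End extremal_problem.

Lemma exists_weighted_measure {R : realType} (W : R -> R) (C r : R) :
  measurable_fun [set: R] W -> (forall y, 0 <= W y) -> (forall y, W y <= C) ->
  (forall y, r <= `|y| -> W y = 0) ->
  exists nu : {finite_measure set (measurableTypeR R) -> \bar R},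
    forall f : R -> \bar R, measurable_fun [set: R] f -> (forall x, 0 <= f x)%E ->
    (\int[nu]_x f x = \int[lebesgue_measure]_x (f x * (W x)%:E))%E.
Proof.
move=> mW W0 WC Wr.
have mW' : measurable_fun [set: measurableTypeR R] (W : measurableTypeR R -> R) := mW.
have [w wE] : exists w : {mfun (measurableTypeR R) >-> R}, (w : R -> R) = W.
  by unshelve eexists; [exact: (@MeasurableFun.Pack _ _ (measurableTypeR R) R W
    (MeasurableFun.Class (isMeasurableFun.Build _ _ (measurableTypeR R) R W mW')))|].
have wn x : `|w x| = W x by rewrite wE ger0_norm.
have mWe : measurable_fun [set: measurableTypeR R] (fun x : measurableTypeR R => `|w x|%:E).
  have -> : (fun x : measurableTypeR R => `|w x|%:E) = EFin \o (W : measurableTypeR R -> R).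
    by apply/funext => x; rewrite /= wn.
  by apply/measurable_EFinP; exact: mW'.
have fin : fin_num_fun (weighted (@lebesgue_measure R) w).
  move=> A mA; rewrite ge0_fin_numE; last exact: measure_ge0.
  apply: (@le_lt_trans _ _ (\int[@lebesgue_measure R]_x `|w x|%:E)%E).
    by apply: ge0_subset_integral => // x _; rewrite lee_fin.
  have -> : (\int[@lebesgue_measure R]_x `|w x|%:E = \int[@lebesgue_measure R]_(x in `[(- r)%R, r]) `|w x|%:E)%E.
    rewrite [RHS]integral_mkcond; apply: eq_integral => x _; rewrite patchE; case: ifPn => //.
    rewrite notin_setE/= in_itv/= => /negP; rewrite -ler_norml -ltNge => /ltW rx.
    by rewrite wn Wr.
  apply: (@le_lt_trans _ _ (\int[@lebesgue_measure R]_(x in `[(- r)%R, r]) (cst C%:E) x)%E).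
    apply: ge0_le_integral => //; first by apply: measurable_funTS; exact: mWe.
    by move=> x _; rewrite /= lee_fin wn.
  rewrite integral_cst//.
  by rewrite /= lebesgue_measure_itv/=; case: ifP => _; rewrite ?mule0 ?ltry// -?EFinN -?EFinB -?EFinD -?EFinM ltry.
have [nu nuE] : exists nu : {finite_measure set (measurableTypeR R) -> \bar R},
    forall A, nu A = weighted (@lebesgue_measure R) w A.
  pose nu : {finite_measure set (measurableTypeR R) -> \bar R} := HB.pack
    (weighted (@lebesgue_measure R) w) (Measure_isFinite.Build _ _ _ (weighted (@lebesgue_measure R) w) fin).
  by exists nu.
exists nu => f mf f0; transitivity (\int[weighted (@lebesgue_measure R) w]_x f x)%E.
  by apply: eq_measure_integral => A _ _; exact: nuE.
rewrite [LHS](ge0_integral_weighted (@lebesgue_measure R) w mf f0).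
by apply: eq_integral => x _; rewrite wn.
Qed.

(** * The estimates applied to the extended curve *)

Section main.
Context {R : realType}.
Local Notation M := (measurableTypeR R).
Local Notation leb := (@lebesgue_measure R).
Variables (g G G1 G2 : R -> R) (lam a kap r : R).
Hypotheses (lam_gt0 : 0 < lam) (a_gt0 : 0 < a).
Hypotheses (kap_gt0 : 0 < kap) (kap_le : kap <= 1 / 3) (kap_a : kap <= a) (kap_lam : 6 * a * kap <= lam).
Let eps := 2 * a / lam - lam ^+ 2 / 2.
Hypothesis eps_gt0 : 0 < eps.
Hypothesis kap_eps : (error_const lam a + 6 * a / lam) * kap <= eps / 2.
Hypothesis kap_W : (lam ^+ 2 / 2 + 1) * kap <= 1 / 20.
Hypothesis dG : forall y : R, is_derive y 1 G (G1 y).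
Hypothesis dG1 : forall y : R, is_derive y 1 G1 (G2 y).
Hypothesis cG2 : continuous G2.
Let lo := lam * (1 - kap ^+ 2).
Let hi := lam * (1 + kap ^+ 2).
Hypothesis lo_le : forall y, lo <= G2 y.
Hypothesis le_hi : forall y, G2 y <= hi.
Hypotheses (G_0 : G 0 = 0) (G1_0 : G1 0 = 0) (G2_0 : G2 0 = lam).
Hypotheses (r_gt0 : 0 < r) (r_kap : 3 * r ^+ 2 <= kap).
Hypothesis GE : forall y : R, `|y| <= r -> G y = g y.
Hypothesis dg : forall y : R, `|y| <= r -> is_derive y 1 g (G1 y).
Hypothesis divdiff_ge : forall eta y : R, `|eta| < r -> `|y| < r ->
  lam + 4 * a * (eta ^+ 2 + eta * y + y ^+ 2) - kap * (eta ^+ 2 + y ^+ 2) <= divdiff G1 G2 eta y.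

Let W := arc_weight G1 r.
Let h := conv3 G G1 G2 W r.
Let h0 := h (0, 0).
Let sigma := arclength (graph_curve g) (- r) r.
Let C := 1 + (lam ^+ 2 / 2 + kap) * r ^+ 2.

Let kap2 : kap ^+ 2 <= 1 / 9.
Proof. by have := ler_pM (ltW kap_gt0) (ltW kap_gt0) kap_le kap_le; rewrite expr2; lra. Qed.

Let lo_gt0 : 0 < lo.
Proof. by rewrite mulr_gt0//; have := kap2; lra. Qed.

Let hi_gt0 : 0 < hi.
Proof. by rewrite mulr_gt0// ltr_wpDr ?sqr_ge0. Qed.

Let mG : measurable_fun [set: R] G.
Proof. exact: continuous_measurable_fun (continuous_curve dG). Qed.

Let cG1 : continuous G1 := continuous_curve1 dG1.

Let mW : measurable_fun [set: R] W := measurable_arc_weight r cG1.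
Let W_ge0 : forall y, 0 <= W y := arc_weight_ge0 G1 r.
Let W_off y : r <= `|y| -> W y = 0. Proof. exact: arc_weight_off. Qed.

Let W_0 : W 0 = 1.
Proof. by rewrite /W /arc_weight normr0 r_gt0 G1_0 expr0n addr0 sqrtr1. Qed.

Let kL : 0 <= lam ^+ 2 / 2 + kap.
Proof. by rewrite addr_ge0 ?(ltW kap_gt0)// divr_ge0// sqr_ge0. Qed.

(** The slope satisfies [|G1 y| <= hi * |y|], since its divided difference at 0 lies between 0 and
    [hi], and [sqrt (1 + 2 u) <= 1 + u] is applied with [u = (lam ^+ 2 / 2 + kap) * y ^+ 2]. *)
Let W_le y : W y <= 1 + (lam ^+ 2 / 2 + kap) * y ^+ 2.
Proof.
rewrite /W /arc_weight; case: ifP => _; last by rewrite addr_ge0// mulr_ge0// sqr_ge0.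
have E : G1 y = divdiff G1 G2 0 y * y by have := divdiffE G1 G2 0 y; rewrite G1_0 !subr0.
have d0 : 0 <= divdiff G1 G2 0 y by apply: le_trans (ltW lo_gt0) _; exact: (divdiff_lo dG1).
have dh : divdiff G1 G2 0 y <= hi by exact: (divdiff_hi dG1).
have d2 : divdiff G1 G2 0 y ^+ 2 <= hi ^+ 2 by rewrite ler_pXn2r ?nnegrE// ltW.
(* The excess of [hi ^+ 2] over [lam ^+ 2] carries a factor [lam ^+ 2 * kap], which [kap_W] bounds
   by [1 / 10]. *)
have h2 : hi ^+ 2 <= lam ^+ 2 + 2 * kap.
  have k2 : lam ^+ 2 / 2 * kap <= 1 / 20 by have := kap_W; have := kap_gt0; lra.
  have k3 := mulr_ge0 (ltW kap_gt0) (sqr_ge0 lam).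
  have k4 : lam ^+ 2 * kap * (2 * kap + kap * kap ^+ 2) <= 1 / 10 * (2 * kap + kap * kap ^+ 2).
    apply: ler_wpM2r; last by lra.
    by rewrite addr_ge0// ?mulr_ge0// ?sqr_ge0// ltW.
  have k5 : kap * kap ^+ 2 <= kap * (1 / 9) by rewrite ler_wpM2l// ltW.
  have -> : hi ^+ 2 = lam ^+ 2 + lam ^+ 2 * kap * (2 * kap + kap * kap ^+ 2) by rewrite /hi; ring.
  by have := kap_gt0; lra.
have G12 : G1 y ^+ 2 <= (lam ^+ 2 + 2 * kap) * y ^+ 2.
  by rewrite E exprMn ler_wpM2r ?sqr_ge0// (le_trans d2).
have p0 : 0 <= 1 + (lam ^+ 2 / 2 + kap) * y ^+ 2 by rewrite addr_ge0// mulr_ge0// sqr_ge0.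
rewrite -[leRHS](ger0_norm p0) -sqrtr_sqr ler_sqrt ?sqr_ge0//.
have -> : (1 + (lam ^+ 2 / 2 + kap) * y ^+ 2) ^+ 2 = 1 + (lam ^+ 2 + 2 * kap) * y ^+ 2 + ((lam ^+ 2 / 2 + kap) * y ^+ 2) ^+ 2.
  by field.
by rewrite -addrA lerD2l (le_trans G12)// lerDl sqr_ge0.
Qed.

Let W_leC y : W y <= C.
Proof.
have [ry|yr] := leP r `|y|; first by rewrite W_off// addr_ge0// mulr_ge0// sqr_ge0.
apply: (le_trans (W_le y)); rewrite lerD2l ler_wpM2l// -real_normK ?num_real//.
by rewrite ler_pXn2r ?nnegrE ?(ltW yr)// ltW.
Qed.

Let cW y : `|y| != r -> W x @[x --> y] --> W y.
Proof. exact: (continuous_arc_weight cG1). Qed.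

Let mh : measurable_fun [set: plane R] h.
Proof. exact: (measurable_conv3 dG dG1 cG2 lo_gt0 lo_le r mW W_ge0). Qed.

Let h_ge0 x : 0 <= h x.
Proof. exact: (conv3_ge0 G dG1 lo_gt0 lo_le r W_ge0). Qed.

Let h0_gt0 : 0 < h0.
Proof.
exact: (conv3_origin_gt0 lam_gt0 kap_gt0 kap_le dG dG1 cG2 lo_le G_0 G2_0 r_gt0 r_kap mW W_ge0 W_le W_off W_0).
Qed.

Let c := eps / (4 * lam).
Let t1 := lam / eps.
Let c_gt0 : 0 < c. Proof. by rewrite divr_gt0// mulr_gt0. Qed.
Let t1_gt0 : 0 < t1. Proof. exact: divr_gt0. Qed.
Let ct1 : c * t1 <= 1.
Proof.
have -> : c * t1 = 1 / 4 by rewrite /c /t1; field; rewrite !gt_eqF.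
lra.
Qed.

Let h_le x : h x <= h0 * (1 - c * Num.min (Num.max x.2 0) t1).
Proof.
exact: (conv3_le lam_gt0 a_gt0 kap_gt0 kap_le kap_a kap_lam eps_gt0 kap_eps kap_W dG dG1 cG2 lo_le le_hi
  G_0 G1_0 G2_0 r_gt0 r_kap mW W_ge0 W_le W_off W_0 divdiff_ge).
Qed.

Let G_lo y : lo / 2 * y ^+ 2 <= G y.
Proof. by have := taylor_lo dG dG1 0 y lo_le; rewrite G_0 G1_0 mul0r !subr0. Qed.

Let G_hi y : G y <= hi / 2 * y ^+ 2.
Proof. by have := taylor_hi 0 y dG dG1 le_hi; rewrite G_0 G1_0 mul0r !subr0. Qed.

Let lo2 : 0 < lo / 2. Proof. exact: divr_gt0. Qed.

Let G_ge0 y : 0 <= G y.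
Proof. by apply: le_trans (G_lo y); rewrite mulr_ge0 ?sqr_ge0// ltW. Qed.

Let G_gt0 y : y != 0 -> 0 < G y.
Proof. by move=> y0; apply: lt_le_trans (G_lo y); rewrite mulr_gt0// exprn_even_gt0. Qed.

Let region_eq : conv3_region g r = conv3_region G r.
Proof.
apply/seteqP; split => x [xr gx]; split => //; move: gx; rewrite GE//;
  by rewrite normrM [X in _ * X]ger0_norm// ler_pdivrMr// mulrC ltW.
Qed.

(** In the region every point other than the origin has positive height, because [G] is positive
    away from 0; [h_le] then gives a strict loss. Outside the region the density is zero. *)
Lemma conv3_strict_max (x : R * R) : x != (0, 0) -> h x < h0.
Proof.
move=> x0; have [[xr gx]|nx] := pselect (conv3_region G r x); last first.
  by rewrite /h (conv3_off _ _ _ nx); exact: h0_gt0.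
have x2 : 0 < x.2.
  have [x1|x1] := eqVneq x.1 0; last first.
    by apply: lt_le_trans gx; rewrite mulr_gt0// G_gt0// mulf_neq0.
  rewrite lt_neqAle (le_trans _ gx) ?mulr_ge0// andbT eq_sym; apply: contraNneq x0 => x20.
  by case: x x1 x20 {xr gx} => u v /= -> ->.
apply: le_lt_trans (h_le x) _; rewrite gtr_pMr// ltrBlDr ltrDl mulr_gt0//.
by rewrite lt_min lt_max x2 t1_gt0.
Qed.


Section weighted_measure.
Variable nu : {finite_measure set M -> \bar R}.
Hypothesis nuE : forall f : R -> \bar R, measurable_fun [set: R] f -> (forall x, 0 <= f x)%E ->
  (\int[nu]_x f x = \int[leb]_x (f x * (W x)%:E))%E.
Local Notation leb2 := (sprod leb leb).
Local Notation nu3 := (sprod nu (sprod nu nu)).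

Let density (Phi : plane R -> \bar R) : measurable_fun setT Phi -> (forall x, (0 <= Phi x)%E) ->
  (\int[nu3]_X Phi (sum3 (fun y : M => y) X, sum3 G X) = \int[leb2]_x (Phi x * (h x)%:E))%E.
Proof.
move=> mPhi Phi0.
exact: (conv3_density_identity dG dG1 cG2 lo_gt0 lo_le mW W_ge0 W_leC W_off nuE mPhi Phi0).
Qed.

Let h_within : {within conv3_region G r, continuous (h : R * R -> R)}.
Proof. exact: (continuous_conv3 dG dG1 cG2 lo_gt0 lo_le mW W_ge0 W_leC W_off cW). Qed.

Lemma conv3_density_conv3 : conv3_density g r h.
Proof.
split.
- by split; [exact: mh|exact: h_ge0].
- move=> A mA; rewrite (mconv3_arclength mG cG1 GE dg nuE mA).
  pose Phi (x : plane R) : \bar R := (\1_A x : R)%:E.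
  have mPhi : measurable_fun setT Phi by apply/measurable_EFinP; exact: measurable_indic.
  have Phi0 x : (0 <= Phi x)%E by rewrite lee_fin indicE.
  transitivity (\int[leb2]_x (Phi x * (h x)%:E))%E; first exact: (density mPhi Phi0).
  rewrite [RHS]integral_mkcond; apply: eq_integral => x _.
  by rewrite patchE /Phi indicE; case: (x \in A); rewrite ?mul1e ?mul0e.
- by rewrite region_eq; exact: h_within.
- by move=> x; rewrite region_eq => nx; exact: conv3_off.
Qed.

Let nu_set (A : set M) : measurable A -> (nu A = \int[leb]_(x in A) (W x)%:E)%E.
Proof.
move=> mA; transitivity (\int[nu]_x (\1_A x : R)%:E)%E; first by rewrite integral_indic// setIT.
rewrite nuE.
- rewrite [RHS]integral_mkcond; apply: eq_integral => x _.
  by rewrite patchE indicE; case: (x \in A); rewrite ?mul1e ?mul0e.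
- by apply/measurable_EFinP; exact: measurable_indic.
- by move=> x; rewrite lee_fin indicE.
Qed.

Let nu_zero : nu [set y | G y = 0] = 0%E.
Proof.
have -> : [set y : M | G y = 0] = [set (0 : R)].
  apply/seteqP; split => y /=; last by move=> ->; exact: G_0.
  by move=> Gy; apply: contrapT => /eqP y0; have := G_gt0 y0; rewrite Gy ltxx.
by rewrite (nu_set (measurable_set1 _)) integral_set1.
Qed.

Let nu_pos t : 0 < t -> (0%R < nu [set y | (G y < t)%R])%E.
Proof.
(* On []0, d[] one has [y ^+ 2 <= y], so the height stays below [hi * d <= t], and the weight is at
   least 1 inside the arc. *)
move=> t0; pose d := Num.min r (Num.min 1 (t / hi)).
have d0 : 0 < d by rewrite !lt_min r_gt0 ltr01 divr_gt0.
pose B : set M := `]0, d[%classic.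
have mB : measurable B by exact: measurable_itv.
have mGt : measurable ([set y | G y < t] : set M).
  rewrite (_ : [set y | G y < t] = [set: R] `&` G @^-1` `]-oo, t[%classic).
    exact: (mG measurableT (measurable_itv _)).
  by apply/seteqP; split => y /=; rewrite in_itv/=; [split|case].
have WB x : B x -> 1 <= W x.
  rewrite /B/= in_itv/= => /andP[x0 xd]; rewrite /W /arc_weight ger0_norm ?(ltW x0)//.
  have -> : x < r by apply: lt_le_trans xd _; rewrite ge_min lexx.
  by rewrite -[leLHS]sqrtr1; apply: ler_wsqrtr; rewrite lerDl sqr_ge0.
have BG : B `<=` [set y | G y < t].
  move=> y; rewrite /B/= in_itv/= => /andP[y0]; rewrite !lt_min => /and3P[_ y1 yt].
  have y2 : y ^+ 2 <= y by rewrite expr2 ger_pMr// ltW.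
  have y3 : hi * y < t by rewrite mulrC -ltr_pdivlMr.
  have y4 := ler_wpM2l (ltW hi_gt0) y2.
  have aux (H s z w t' : R) : w <= H / 2 * s -> H * s <= H * z -> H * z < t' -> 0 < t' -> w < t' by lra.
  exact: aux (G_hi y) y4 y3 t0.
apply: (@lt_le_trans _ _ (nu B)); last by apply: le_measure; rewrite ?inE.
rewrite (nu_set mB); apply: (@lt_le_trans _ _ (\int[leb]_(x in B) 1%:E)%E).
  by rewrite integral_cst//= lebesgue_measure_itv/= lte_fin d0 mul1e ?sube0 -?EFinB ?subr0 lte_fin.
apply: ge0_le_integral; first [exact: mB
 | by move=> x Bx; rewrite lee_fin; first [exact: WB|exact: W_ge0|exact: ler01]
 | exact: measurable_cst
 | by apply/measurable_EFinP; exact: measurable_funTS].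
Qed.

(** The region without its lower boundary. There [h] is continuous in the ordinary sense, and what
    is removed is a null graph. *)
Let U : set (plane R) := [set x | `|x.1| < 3 * r /\ 3 * G (x.1 / 3) < x.2].

Let mU : measurable U.
Proof.
pose k (x : plane R) : R := x.2 - 3 * G (x.1 / 3).
have mk : measurable_fun [set: plane R] (k : plane R -> M).
  apply: measurable_funB; first exact: measurable_snd.
  apply: measurable_funM; first exact: measurable_cst.
  apply: (measurableT_comp mG); apply: measurable_funM; last exact: measurable_cst.
  exact: measurable_fst.
have m1 : measurable_fun [set: plane R] (fst : plane R -> M) by exact: measurable_fst.
rewrite (_ : U = ([set: plane R] `&` fst @^-1` `]- (3 * r), 3 * r[%classic) `&`
                 ([set: plane R] `&` k @^-1` `]0, +oo[%classic)).
  apply: measurableI; first exact: (m1 measurableT _ (measurable_itv _)).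
  exact: (mk measurableT _ (measurable_itv _)).
apply/seteqP; split => x; rewrite /U /k /= !in_itv/= ?andbT -ltr_norml subr_gt0; first by case.
by move=> [[_ ?] [_ ?]].
Qed.

Let h_near eta : 0 < eta -> exists2 t, 0 < t & forall x : plane R, U x -> x.2 < t -> h0 - eta <= h x.
Proof.
move=> e0.
have D0 : conv3_region G r (0, 0).
  by split; [rewrite /= normr0 mulr_gt0|rewrite /= mul0r G_0 mulr0].
have /subspace_continuousP/(_ _ D0)/cvgrPdist_le/(_ eta e0) cv := h_within.
have /nbhs_ballP[d /= d0 H] : nbhs ((0, 0) : R * R)
  [set x : R * R | conv3_region G r x -> `|h (0, 0) - h x| <= eta] by exact: cv.
(* In [U] the height exceeds [3 * G (x.1 / 3)], which is at least [lo / 6 * x.1 ^+ 2]. A low point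
   is thus also close to the origin horizontally, and continuity at the origin within the region
   suffices. *)
have d2 : 0 < lo / 6 * d ^+ 2 by rewrite mulr_gt0 ?exprn_gt0// divr_gt0.
exists (Num.min d (lo / 6 * d ^+ 2)); first by rewrite lt_min d0.
move=> x [x1 x2]; rewrite lt_min => /andP[xd xl].
have x20 : 0 <= x.2 by apply: le_trans (ltW x2); rewrite mulr_ge0.
have x1d : `|x.1| < d.
  have aux (l z w v e : R) : 0 < l -> l / 2 * (z / 3) ^+ 2 <= w -> 3 * w < v -> v < l / 6 * e ^+ 2 -> z ^+ 2 < e ^+ 2.
    move=> l0 h1 h2 h3; rewrite -(ltr_pM2l l0).
    have E : l / 2 * (z / 3) ^+ 2 = l * z ^+ 2 / 18 by field.
    by move: h1; rewrite E; lra.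
  have := aux _ _ _ _ _ lo_gt0 (G_lo (x.1 / 3)) x2 xl.
  by rewrite -[x.1 ^+ 2]real_normK ?num_real// ltr_pXn2r// ?nnegrE// ltW.
have B : ball ((0, 0) : R * R) d x.
  split; rewrite /ball/= sub0r normrN; first exact: x1d.
  by rewrite ger0_norm.
have := H x B (conj x1 (ltW x2)); rewrite -[h (0, 0)]/h0.
by move=> /(le_trans (ler_norm _)); rewrite lerBlDr lerBlDl addrC.
Qed.

Let h_off : leb2 [set x | ~ U x /\ h x != 0] = 0%E.
Proof.
rewrite /sprod /product_measure1; apply: integral0_eq => x _ /=.
have : xsection [set x | ~ U x /\ h x != 0] x `<=` [set 3 * G (x / 3)].
  move=> y; rewrite /xsection/= inE => -[nU hn].
  have [xr gx] : conv3_region G r (x, y).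
    by apply: contrapT => nr; move: hn; rewrite /h conv3_off// eqxx.
  apply/eqP; rewrite eq_le gx andbT leNgt; apply/negP => lt; exact: nU.
by move=> /subset_set1[] ->; [exact: measure0|exact: lebesgue_measure_set1].
Qed.

Let U_continuous (x : R * R) : U x -> {for x, continuous (h : R * R -> R)}.
Proof.
move=> [x1 x2].
exact: (continuous_conv3_interior dG dG1 cG2 lo_gt0 lo_le mW W_ge0 W_leC W_off cW x1 x2).
Qed.

Let near_extremal eta : 0 < eta -> eta < h0 -> exists F : M -> R[i],
  [/\ square_integrable nu F, (0 < \int[nu]_y (Normc.normc (F y) ^+ 2)%:E)%E &
  (((2 * pi) ^+ 2 * (h0 - eta))%:E * \int[nu3]_X (Normc.normc (prod3 F X) ^+ 2)%:E <=
   \int[leb2]_x (Normc.normc (curve_ext nu (fun y : M => y) G F x) ^+ 6)%:E)%E].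
Proof.
move=> e0 eh; have mid : measurable_fun [set: M] (fun y : M => y) by exact: measurable_id.
have [k Hk] := near_extremizer mid mG mh h_ge0 density mU U_continuous G_ge0 h_near h_off nu_pos e0 eh.
by exists (fun y : M => (expR (- (k * G y)))%:C%C); exact: Hk.
Qed.

Let sigmaE (F : plane R -> \bar R) : measurable_fun setT F -> (forall x, 0 <= F x)%E ->
  (\int[sigma]_x F x = \int[nu]_y F (y, G y))%E.
Proof. exact: (ge0_integral_arclength mG cG1 GE dg nuE). Qed.

Let extE (f : plane R -> R[i]) xi : cmeasurable f ->
  extension sigma f xi = curve_ext nu (fun y : M => y) G (fun y => f (y, G y)) xi.
Proof. by move=> mf; apply: (extension_arclength mG cG1 GE dg nuE). Qed.

Lemma arclength_no_extremizer f : ~ extremizer sigma f.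
Proof.
exact: (no_extremizer mG G_ge0 sigmaE extE mh h_ge0 density c_gt0 t1_gt0 ct1 h0_gt0 h_le near_extremal nu_zero).
Qed.

Lemma extremizing_concentrates f : extremizing_seq sigma f -> concentrates (graph_curve g) r f 0.
Proof.
move=> ef; split.
  exact: (extremizing_norm mG G_ge0 sigmaE extE mh h_ge0 density c_gt0 t1_gt0 ct1 h0_gt0 h_le near_extremal ef).
move=> ep rho e0 rho0.
pose S : set M := [set y : R | rho <= `|y|].
pose m := Num.min (lo / 2 * rho ^+ 2) t1.
have mS : measurable S.
  have -> : S = `]-oo, (- rho)%R]%classic `|` `[rho, +oo[%classic.
    apply/seteqP; split => y; rewrite /S /= !in_itv/= andbT ler_normr [rho <= - y]lerNr.
      by move=> /orP[->|->]; [right|left].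
    by move=> [->|->]; rewrite ?orbT.
  by apply: measurableU; exact: measurable_itv.
have m0 : 0 < m by rewrite lt_min t1_gt0 andbT; apply: mulr_gt0 => //; exact: exprn_gt0.
have mt1 : m <= t1 by rewrite ge_min lexx orbT.
have SG y : S y -> m <= G y.
  move=> ry; rewrite ge_min; apply/orP; left; apply: (le_trans _ (G_lo y)); apply: ler_wpM2l; first exact: ltW.
  rewrite -[y ^+ 2]real_normK ?num_real//; apply: lerXn2r => //.
  by rewrite nnegrE ltW.
have off := extremizing_off mG G_ge0 sigmaE extE mh h_ge0 density c_gt0 t1_gt0 ct1 h0_gt0 h_le near_extremal ef mS m0 mt1 SG e0.
apply: filterS off => n offn; apply: le_lt_trans offn; rewrite le_eqVlt; apply/orP; left; apply/eqP.
pose F (y : R) := Normc.normc (f n (y, G y)) ^+ 2.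
have mF : measurable_fun [set: R] F.
  have [[[m1 m2 _] _] _] : (L2fun sigma (f n) /\ (cLnorm sigma 2 (f n) <= 1)%E) /\ True by split; [case: ef|].
  have cf : cmeasurable (f n) by [].
  have mp : measurable_fun [set: M] ((fun y => (y, G y)) : M -> plane R) by exact: measurable_fun_pair.
  by apply: measurable_funX; exact: (measurableT_comp (cmeasurable_normc cf) mp).
transitivity (\int[leb]_(y in `[(- r)%R, r] `&` S) (F y * Num.sqrt (1 + G1 y ^+ 2))%:E)%E; last first.
  exact: (arclength_restrict cG1 nuE mS mF (fun y => sqr_ge0 _)).
have -> : [set w : R | rho <= `|w - 0|] = S by apply/seteqP; split => y; rewrite /S/= subr0.
apply: eq_integral => y; rewrite inE => -[yr _].
have yr' : `|y| <= r by move: yr; rewrite /= in_itv/= -ler_norml.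
by rewrite (speed_graph dg yr') /F GE.
Qed.

End weighted_measure.

Lemma curve_extremal_problem :
  [/\ exists h : R * R -> R, conv3_density g r h /\ (forall x : R * R, x != (0, 0) -> h x < h (0, 0)),
      (forall f : nat -> R * R -> complex R, extremizing_seq sigma f -> concentrates (graph_curve g) r f 0)
    & ~ exists f : R * R -> complex R, extremizer sigma f].
Proof.
have [nu nuE] := exists_weighted_measure mW W_ge0 W_leC W_off; split.
- exists h; split; [exact: (conv3_density_conv3 nuE)|exact: conv3_strict_max].
- by move=> f; exact: (extremizing_concentrates nuE).
- by move=> [f]; exact: (arclength_no_extremizer nuE).
Qed.

End main.

Theorem theorem3 (R : realType) (lambda a : R) (phi : R -> R)
  (lambda_gt0 : 0 < lambda) (a_gt0 : 0 < a)
  (a_large : 2 * (lambda / 2) ^+ 3 < a)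
  (phi_smooth : smooth_near phi 0)
  (phi_bigO : phi =O_ (0 : R) (fun y : R => `|y| ^+ 5)) :
  let g := fun y : R => lambda / 2 * y ^+ 2 + a * y ^+ 4 + phi y in
  let gamma := graph_curve g in
  exists r0 : R, 0 < r0 /\
    forall r : R, 0 < r -> r < r0 ->
      let sigma := arclength gamma (- r) r in
      [/\ exists h : R * R -> R, conv3_density g r h /\
            (forall x : R * R, x != (0, 0) -> h x < h (0, 0)),
          (forall f : nat -> R * R -> complex R,
             extremizing_seq sigma f -> concentrates gamma r f 0)
        & ~ exists f : R * R -> complex R, extremizer sigma f].
Proof.
move=> g gamma.
(* The hypothesis [a_large] divided by [lambda / 2]: the gain from the quartic term exceeds the loss
   from arclength. *)
have eps0 : 0 < 2 * a / lambda - lambda ^+ 2 / 2.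
  rewrite subr_gt0 ltr_pdivlMr//.
  have -> : lambda ^+ 2 / 2 * lambda = 2 * (2 * (lambda / 2) ^+ 3) by field.
  by rewrite ltr_pM2l.
have q0 : 0 < 6 * a / lambda by rewrite divr_gt0// mulr_gt0.
have Q0 : 0 < lambda ^+ 2 / 2 + 1 by apply: ltr_wpDl => //; apply: divr_ge0 => //; exact: sqr_ge0.
have E0 : 0 < error_const lambda a + 6 * a / lambda.
  apply: addr_gt0 => //; rewrite /error_const.
  apply: ltr_wpDr; first by apply: exprn_ge0; exact: ltW.
  apply: ltr_wpDr; first exact: sqr_ge0.
  apply: addr_gt0 => //; apply: ltr_wpDr; first exact: sqr_ge0.
  by rewrite invr_gt0.
pose kap := Num.min (1 / 3) (Num.min a (Num.min (lambda / (6 * a))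
  (Num.min ((2 * a / lambda - lambda ^+ 2 / 2) / 2 / (error_const lambda a + 6 * a / lambda))
    (1 / 20 / (lambda ^+ 2 / 2 + 1))))).
have kap0 : 0 < kap.
  rewrite !lt_min; apply/and5P; split => //.
  - by apply: divr_gt0 => //; exact: mulr_gt0.
  - by apply: divr_gt0 => //; exact: divr_gt0.
  - by apply: divr_gt0 => //; exact: divr_gt0.
have k1 : kap <= 1 / 3 by rewrite ge_min lexx.
have k2 : kap <= a by rewrite !ge_min lexx ?orbT.
have k3 : 6 * a * kap <= lambda.
  by rewrite mulrC -ler_pdivlMr ?mulr_gt0// !ge_min lexx ?orbT.
have k4 : (error_const lambda a + 6 * a / lambda) * kap <= (2 * a / lambda - lambda ^+ 2 / 2) / 2.
  by rewrite mulrC -ler_pdivlMr// !ge_min lexx ?orbT.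
have k5 : (lambda ^+ 2 / 2 + 1) * kap <= 1 / 20.
  by rewrite mulrC -ler_pdivlMr// !ge_min lexx ?orbT.
clearbody kap.
have [rho rho0 [G [G1 [G2 [[d1 d2 c2] Gb [G0 G10 G20] GE dd]]]]] :=
  perturbed_curve lambda_gt0 a_gt0 kap0 phi_smooth phi_bigO.
(* For [r < 1] the required [3 * r ^+ 2 <= kap] follows from [3 * r <= kap]. *)
exists (Num.min rho (Num.min 1 (kap / 3))); split.
  by rewrite !lt_min rho0 ltr01 divr_gt0.
move=> r r_gt0; rewrite !lt_min => /and3P[rrho r1 rk] sigma.
have rr (y : R) : `|y| <= r -> `|y| <= rho by move=> yr; exact: le_trans yr (ltW rrho).
have r_kap : 3 * r ^+ 2 <= kap.
  have r2 : r ^+ 2 <= r by rewrite expr2 ger_pMr// ltW.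
  by move: r2 rk; lra.
apply: (@curve_extremal_problem R g G G1 G2 lambda a kap r lambda_gt0 a_gt0 kap0 k1 k2 k3 eps0 k4 k5 d1 d2 c2
  (fun y => proj1 (andP (Gb y))) (fun y => proj2 (andP (Gb y))) G0 G10 G20 r_gt0 r_kap
  (fun y yr => (GE y (rr y yr)).1) (fun y yr => (GE y (rr y yr)).2)).
by move=> eta y /ltW e1 /ltW e2; apply: dd; exact: rr.
Qed.
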